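(* In the setting of the context, assume $\hat{\mathcal{L}}^{rev}$ has a positive spectral gap. Then, for any $f\in L^2_0(\hat\pi)$, $$\mathrm{Var}(f,\hat{\mathcal{L}})\le\mathrm{Var}(f,\hat{\mathcal{L}}^{rev}).$$ Moreover, for any $\tilde f\in L^2_0(\pi)$, $$\mathrm{Var}(\tilde f\circ\tau,\hat{\mathcal{L}})\le\mathrm{Var}(\tilde f\circ\tau,\hat{\mathcal{L}}^{rev})=\mathrm{Var}(\tilde f,\mathbb{E}_\rho Q^{rev}(p))+O(\gamma^{-1}),$$ where $\tau:\mathcal{X}\times\mathbb{R}^d\to\mathcal{X}$ is the projection on the first component and $O(\gamma^{-1})$ is understood as $\gamma\to+\infty$ with all other data ($\mathcal{X},\pi,\rho,Q,\mu,\mathcal{L}^D_p,\tilde f$) fixed. In particular, for $Q$ of the factorized form described in the context with $H_{x,y}(p)-H_{y,x}(p)=-\langle\sigma_{x,y},\nabla\log\rho(p)\rangle$ for $\rho$-a.e. $p$ whenever $\bar Q_{x,y}>0$, we have $$\mathrm{Var}(\tilde f\circ\tau,\hat{\mathcal{L}})\le 2C^{-1}\,\mathrm{Var}(\tilde f,\bar Q)+O(\gamma^{-1}),\qquad C=\min_{\bar Q_{x,y}>0}\mathbb{E}_\rho|\langle\sigma_{x,y},\nabla\log\rho(p)\rangle|,$$ (the right-hand side being read as $+\infty$ if $C=0$).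
   Context: $\mathcal{X}$ is a finite set, $d\ge1$, $\pi\in\mathcal{P}(\mathcal{X})$, $\rho\in\mathcal{P}(\mathbb{R}^d)$, $\hat\pi=\pi\otimes\rho$. For each $p\in\mathbb{R}^d$, $Q(p)\in\mathbb{R}^{\mathcal{X}\times\mathcal{X}}$ satisfies $Q_{x,y}(p)\ge0$ for $x\neq y$, $Q_{x,x}(p)=-\sum_{y\ne x}Q_{x,y}(p)$, and $Q_{x,y}(p)=0$ when $\{x,y\}\not\subset\mathrm{supp}(\pi)$; $\mu:\mathcal{X}\times\mathbb{R}^d\to\mathbb{R}^d$; all components of $Q$ and $\mu$ are in $L^2(\rho)$ as functions of $p$. $\mathcal{L}^D_p$ is the generator of a $\rho$-reversible Markov semigroup on $\mathbb{R}^d$, $\hat{\mathcal{L}}^D_p=\mathrm{Id}\otimes\mathcal{L}^D_p$, $\gamma\ge0$. The operator $$\hat{\mathcal{L}}f(x,p)=\sum_{y}Q_{x,y}(p)f(y,p)+\langle\mu_x(p),\nabla_pf(x,p)\rangle+\gamma\hat{\mathcal{L}}^D_pf(x,p)$$ is the generator of a (uniquely existing) Markov process $(Z_t)_{t\ge0}$ on $\mathcal{X}\times\mathbb{R}^d$, has domain $\hat{\mathcal{D}}\subset L^2(\hat\pi)$, and $C_c^\infty(\mathcal{X}\times\mathbb{R}^d)$ (functions with $f(x,\cdot)$ smooth compactly supported for each $x$) is a core for it. Put $q_x(p)=\sum_{y}Q_{y,x}(p)\pi_y/\pi_x$ for $x\in\mathrm{supp}(\pi)$ and $q_x(p)=0$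 otherwise. It is assumed that $(Z_t)$ is $\hat\pi$-invariant, i.e. for $\pi$-a.e. $x$, $\int\langle\nabla_pf,\mu_x\rangle\,\mathrm{d}\rho=-\int fq_x\,\mathrm{d}\rho$ for all $f\in C_c^\infty(\mathbb{R}^d)$. Reversible part: $Q^\dagger(p)=\mathrm{diag}(1/\pi)Q(p)^\top\mathrm{diag}(\pi)-\mathrm{diag}(q(p))$ (entries $Q_{y,x}(p)\pi_y/\pi_x$ read as $0$ if $\pi_x=0$), $Q^{rev}(p)=\frac12(Q(p)+Q^\dagger(p))$, and $\hat{\mathcal{L}}^{rev}f(x,p)=\sum_yQ^{rev}_{x,y}(p)f(y,p)+\gamma\hat{\mathcal{L}}^D_pf(x,p)$ for $f\in C_c^\infty(\mathcal{X}\times\mathbb{R}^d)$. Standing assumption: $\hat{\mathcal{L}}^{rev}$, with domain $\hat{\mathcal{D}}^{rev}\subset L^2(\hat\pi)$, is the self-adjoint operator associated to a closed symmetric Dirichlet form, and $C_c^\infty(\mathcal{X}\times\mathbb{R}^d)$ is a core for it; in particular $\hat{\mathcal{D}}\subset\hat{\mathcal{D}}^{rev}$ and $\langle f,\hat{\mathcal{L}}f\rangle_{L^2(\hat\pi)}=\langle f,\hat{\mathcal{L}}^{rev}f\rangle_{L^2(\hat\pi)}$ for $f\in\hat{\mathcal{D}}$. In statements with $\gamma\to\infty$ the assumptions are meant for all the values of $\gamma$ considered. Spectral gap: $\mathrm{Gap}(\hat{\mathcal{L}}^{rev})=\inf\{-\langle\hat{\mathcal{L}}^{rev}f,f\rangle_{L^2(\hat\pi)}/\|f\|^2_{L^2(\hat\pi)}:f\in\hat{\mathcal{D}}^{rev}\setminus\{0\},\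 \mathbb{E}_{\hat\pi}f=0\}$. $L^2_0(\nu)$ denotes the mean-zero functions in $L^2(\nu)$. Asymptotic variance: for the generator $\mathcal{A}$ of an ergodic Markov process with invariant law $\nu$ and $f$ in the range of $\mathcal{A}$, $\mathrm{Var}(f,\mathcal{A}):=2\langle f,g\rangle_{L^2(\nu)}$, where $g\in L^2_0(\nu)$ (in the domain of $\mathcal{A}$) solves the Poisson equation $-\mathcal{A}g=f$. Used with $\nu=\hat\pi$ for $\hat{\mathcal{L}},\hat{\mathcal{L}}^{rev}$ and $\nu=\pi$ for the generators $\mathbb{E}_\rho Q^{rev}(p)=\int Q^{rev}\,\mathrm{d}\rho$ and $\bar Q$ on $\mathcal{X}$. Factorized form: $\bar Q$ is a $\pi$-reversible generator on $\mathcal{X}$ ($\pi_x\bar Q_{x,y}=\pi_y\bar Q_{y,x}$), with $\bar Q_{x,y}=0$ if $\{x,y\}\not\subset\mathrm{supp}(\pi)$; $\rho$ has a positive density with $\nabla\log\rho:=\rho^{-1}\nabla\rho\in L^2(\rho)$; for $x\ne y$, $Q_{x,y}(p)=\bar Q_{x,y}H_{x,y}(p)$ if $\bar Q_{x,y}>0$ and $0$ otherwise, with $H_{x,y}:\mathbb{R}^d\to[0,\infty)$ in $L^2(\rho)$; $\sigma_{x,y}\in\mathbb{R}^d$ with $\sigma_{x,y}=-\sigma_{y,x}$ for $\bar Q_{x,y}>0$. The minimum defining $C$ is over $x\ne y$. *)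

(* Defs.v *)
From HB Require Import structures.
From mathcomp Require Import all_boot all_order all_algebra.
From mathcomp Require Import all_classical all_reals all_analysis.

Set Implicit Arguments.
Unset Strict Implicit.
Unset Printing Implicit Defensive.
Import Order.TTheory GRing.Theory Num.Theory.
Import numFieldNormedType.Exports.
Local Open Scope classical_set_scope.
Local Open Scope ring_scope.

(* r(gamma) = O(gamma^-1) as gamma -> +oo.  The library's [=O_F] needs a packaged
   filter, which +oo lacks. *)
Definition bigO_inv (R : realType) (r : R -> R) : Prop :=
  exists K : R, \forall gamma \near +oo, `|r gamma| <= K * gamma^-1.

(** * Unbounded operators on L^2(nu)

   Elements of L^2(nu) are represented by functions; every notion below is
   insensitive to changes on null sets.  An unbounded operator is its graph:
   [A f g] means that f is in the domain of A and A f = g. *)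

Definition operator (R : realType) (T : Type) := (T -> R) -> (T -> R) -> Prop.

Section L2.
Context {R : realType} {disp : measure_display} {T : measurableType disp}.
Variable nu : probability T R.
Implicit Types (A : operator R T) (f g h : T -> R) (P : R -> R.-pker T ~> T).

Definition L2 f : Prop := f \in Lfun nu 2%:E.

Definition ip f g : R := \int[nu]_z (f z * g z).

(* [Lnorm] takes values in [\bar R], so that the convergences below cannot hold
   because of a junk value. *)
Definition dist2 f g : \bar R := 'N[nu]_2%:E [EFin \o (f \- g)].

Definition cvgL2 (u : nat -> T -> R) f : Prop :=
  dist2 (u n) f @[n --> \oo] --> 0%E.

Definition mean0 f : Prop := L2 f /\ \int[nu]_z f z = 0.

Definition denseL2 (D : set (T -> R)) : Prop :=
  forall f, L2 f -> exists u : nat -> T -> R, (forall n, D (u n)) /\ cvgL2 u f.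

Definition dom A : set (T -> R) := [set f | exists g, A f g].

(* For a closed operator A: A is the closure of its restriction to C. *)
Definition core (C : set (T -> R)) A : Prop :=
  C `<=` dom A /\
  forall f g, A f g -> exists u v : nat -> T -> R,
    [/\ forall n, C (u n) /\ A (u n) (v n), cvgL2 u f & cvgL2 v g].

Definition self_adjoint A : Prop :=
  denseL2 (dom A) /\
  forall f g, A f g <->
    [/\ L2 f, L2 g & forall u v, A u v -> ip f v = ip g u].

(** ** Markov semigroups; only times t >= 0 are relevant *)

Definition markov_semigroup P : Prop :=
  (forall x B, measurable B -> P 0 x B = \d_x B) /\
  (forall (s t : R) x B, 0 <= s -> 0 <= t -> measurable B ->
     P (s + t) x B = kcomp_noparam (P s) (P t) x B).

Definition invariant_law P : Prop :=
  forall (t : R) B, 0 <= t -> measurable B -> (\int[nu]_x P t x B = nu B)%E.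

Definition reversible P : Prop :=
  forall (t : R) B B', 0 <= t -> measurable B -> measurable B' ->
    (\int[nu]_(x in B) P t x B' = \int[nu]_(x in B') P t x B)%E.

Definition kernel_act (k : R.-pker T ~> T) f : T -> R :=
  fun x => \int[k x]_y f y.

Definition strongly_continuous P : Prop :=
  forall f, L2 f -> dist2 (kernel_act (P t) f) f @[t --> 0^'+] --> 0%E.

Definition generator_of P A : Prop :=
  forall f g, A f g <->
    [/\ L2 f, L2 g &
      dist2 (fun x => t^-1 * (kernel_act (P t) f x - f x)) g
        @[t --> 0^'+] --> 0%E].

(** ** Dirichlet forms; D is the domain of the form E *)

Record dirichlet_form (D : set (T -> R)) (E : (T -> R) -> (T -> R) -> R) : Prop
  := DirichletForm {
  form_L2 : D `<=` L2 ;
  form_ae : forall f g, D f -> L2 g -> f = g %[ae nu] ->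
    D g /\ forall h, D h -> E f h = E g h ;
  form_domD : forall a f g, D f -> D g -> D (fun x => a * f x + g x) ;
  form_dense : denseL2 D ;
  form_linear : forall a f g h, D f -> D g -> D h ->
    E (fun x => a * f x + g x) h = a * E f h + E g h ;
  form_sym : forall f g, D f -> D g -> E f g = E g f ;
  form_ge0 : forall f, D f -> 0 <= E f f ;
  form_closed : forall u : nat -> T -> R, (forall n, D (u n)) ->
    (forall e : R, 0 < e -> exists N, forall m n, (N <= m)%N -> (N <= n)%N ->
       E (u m \- u n) (u m \- u n) + ip (u m \- u n) (u m \- u n) < e) ->
    exists f, [/\ D f, E (u n \- f) (u n \- f) @[n --> \oo] --> 0
                & cvgL2 u f] ;
  form_markov : forall f, D f ->
    let g := fun x => Num.min (Num.max (f x) 0) 1 in D g /\ E g g <= E f f }.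

Definition associated (D : set (T -> R)) (E : (T -> R) -> (T -> R) -> R) A :=
  forall f g, A f g <->
    [/\ D f, L2 g & forall h, D h -> E f h = - ip g h].

(** ** Spectral gap and asymptotic variance *)

(* The infimum is taken in [\bar R]: it is +oo if L^2_0(nu) = {0}. *)
Definition spectral_gap A : \bar R :=
  ereal_inf [set e | exists f g,
    [/\ A f g, \int[nu]_z f z = 0, ~ (f = cst 0 %[ae nu])
      & e = (- ip g f / ip f f)%:E]].

Definition poisson A f g : Prop := mean0 g /\ A g (\- f).

Definition asvar A f : R := 2 * ip f (xget (cst 0) [set g | poisson A f g]).

(* [asvar A f] is the asymptotic variance of f only under this condition. *)
Definition asvar_defined A f : Prop :=
  (exists g, poisson A f g) /\
  (forall g g', poisson A f g -> poisson A f g' -> g = g' %[ae nu]).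

End L2.

(** * The state spaces *)

(* The finite set X with the discrete sigma-algebra.  Library measurable types
   are pointed; the point x0 plays no other role (a set that carries a
   probability measure is nonempty). *)
Definition fspace (X : finType) (x0 : X) : Type := X.

Section fspace.
Variables (X : finType) (x0 : X).
HB.instance Definition _ := Choice.on (fspace x0).
HB.instance Definition _ := isPointed.Build (fspace x0) x0.
HB.instance Definition _ := @isMeasurable.Build default_measure_display
  (fspace x0) discrete_measurable discrete_measurable0
  discrete_measurableC discrete_measurableU.
End fspace.

(* R^d with its Borel sigma-algebra *)
Definition Rd (R : realType) (d : nat) :=
  g_sigma_algebraType (@open 'rV[R]_d).

Section euclidean.
Context {R : realType} {d : nat}.
Implicit Types (f : 'rV[R]_d -> R) (p : 'rV[R]_d).

Definition dot (u v : 'rV[R]_d) : R := \sum_(i < d) u 0 i * v 0 i.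

Definition pderiv (i : 'I_d) f : 'rV[R]_d -> R := 'D_(delta_mx 0 i) f.

Definition grad f p : 'rV[R]_d := \row_i pderiv i f p.

Fixpoint Ck (k : nat) f : Prop :=
  continuous f /\
  if k is k'.+1 then
    forall i, (forall p, derivable f p (delta_mx 0 i)) /\ Ck k' (pderiv i f)
  else True.

Definition Ccinfty f : Prop :=
  (forall k, Ck k f) /\ compact (closure [set p | f p != 0]).

(* This characterizes Lebesgue measure on R^d. *)
Definition is_lebesgue (leb : {measure set (Rd R d) -> \bar R}) : Prop :=
  forall a b : 'rV[R]_d, (forall i, a 0 i <= b 0 i) ->
    leb [set p | forall i, a 0 i <= p 0 i <= b 0 i]
      = (\prod_(i < d) (b 0 i - a 0 i))%:E.

Definition weak_gradient (leb : {measure set (Rd R d) -> \bar R})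
    (r : Rd R d -> R) (G : Rd R d -> 'rV[R]_d) : Prop :=
  forall i : 'I_d,
    [/\ measurable_fun [set: Rd R d] (fun p => G p 0 i),
        forall K : set 'rV[R]_d, compact K ->
          leb.-integrable (K : set (Rd R d)) (EFin \o (fun p => G p 0 i))
      & forall phi, Ccinfty phi ->
          \int[leb]_p (pderiv i phi p * r p) = - \int[leb]_p (phi p * G p 0 i)].

(* rho has a positive Lebesgue density r, and s = r^-1 grad r is in L^2(rho). *)
Definition grad_log_density (rho : probability (Rd R d) R)
    (s : Rd R d -> 'rV[R]_d) : Prop :=
  exists (leb : {measure set (Rd R d) -> \bar R}) (r : Rd R d -> R)
         (G : Rd R d -> 'rV[R]_d),
    [/\ is_lebesgue leb,
        measurable_fun [set: Rd R d] r /\ (forall p, 0 < r p),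
        forall B : set (Rd R d), measurable B ->
          (rho B = \int[leb]_(p in B) (r p)%:E)%E,
        weak_gradient leb r G
      & (forall p, s p = (r p)^-1 *: G p) /\
        (forall i, L2 rho (fun p => s p 0 i))].

End euclidean.

(** * The lifted generator and its reversible part *)

Record model (R : realType) (X : finType) (x0 : X) (d : nat) := Model {
  piX : probability (fspace x0) R ;
  rho : probability (Rd R d) R ;
  Q : Rd R d -> X -> X -> R ;
  mu : X -> Rd R d -> 'rV[R]_d ;
  LD : operator R (Rd R d) }.

Section model.
Context {R : realType} {X : finType} {x0 : X} {d : nat}.
Variable M : model R x0 d.

Definition pihat : probability (fspace x0 * Rd R d)%type R :=
  (piX M \x rho M)%E.

Definition wt (x : X) : R := fine (piX M [set (x : fspace x0)]).

Definition sec (f : fspace x0 * Rd R d -> R) (x : X) : Rd R d -> R :=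
  fun p => f (x, p).

Definition tau_lift (ft : fspace x0 -> R) : fspace x0 * Rd R d -> R :=
  ft \o fst.

Definition Ccinfty_ext (f : fspace x0 * Rd R d -> R) : Prop :=
  forall x, Ccinfty (sec f x).

Definition q (x : X) (p : Rd R d) : R :=
  if wt x == 0 then 0 else \sum_y Q M p y x * wt y / wt x.

Definition Qdag (p : Rd R d) (x y : X) : R :=
  (if wt x == 0 then 0 else Q M p y x * wt y / wt x)
  - (if x == y then q x p else 0).

Definition Qrev (p : Rd R d) (x y : X) : R := 2^-1 * (Q M p x y + Qdag p x y).

Definition EQrev (x y : X) : R := \int[rho M]_p Qrev p x y.

(* The operator on L^2(pi) given by a matrix *)
Definition matrix_op (K : X -> X -> R) : operator R (fspace x0) :=
  fun f g => g = (fun x => \sum_y K x y * f y) %[ae piX M].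

(* Id (x) L^D_p *)
Definition LDhat : operator R (fspace x0 * Rd R d) :=
  fun f g => [/\ L2 pihat f, L2 pihat g
    & forall x, wt x != 0 -> LD M (sec f x) (sec g x)].

Record model_ok : Prop := ModelOk {
  Q_ge0 : forall p x y, x != y -> 0 <= Q M p x y ;
  Q_diag : forall p x, Q M p x x = - \sum_(y | y != x) Q M p x y ;
  Q_supp : forall p x y, wt x = 0 \/ wt y = 0 -> Q M p x y = 0 ;
  Q_L2 : forall x y, L2 (rho M) (fun p => Q M p x y) ;
  mu_L2 : forall x i, L2 (rho M) (fun p => mu M x p 0 i) ;
  LD_gen : exists P, [/\ markov_semigroup P, reversible (rho M) P,
    strongly_continuous (rho M) P & generator_of (rho M) P (LD M)] ;
  mu_inv : \forall x \ae piX M, forall f : 'rV[R]_d -> R, Ccinfty f ->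
    \int[rho M]_p dot (grad f p) (mu M x p) = - \int[rho M]_p (f p * q x p) }.

Variable gamma : R.

(* In the next two definitions g stands for Id (x) L^D_p applied to f. *)
Definition Lhat_formula (f g : fspace x0 * Rd R d -> R) :
    fspace x0 * Rd R d -> R :=
  fun z => \sum_y Q M z.2 z.1 y * f (y, z.2)
           + dot (mu M z.1 z.2) (grad (sec f z.1) z.2) + gamma * g z.

Definition Lrev_formula (f g : fspace x0 * Rd R d -> R) :
    fspace x0 * Rd R d -> R :=
  fun z => \sum_y Qrev z.2 z.1 y * f (y, z.2) + gamma * g z.

Record Lhat_ok (L : operator R (fspace x0 * Rd R d)) : Prop := LhatOk {
  Lhat_gen : exists P, [/\ markov_semigroup P, invariant_law pihat P,
    strongly_continuous pihat P & generator_of pihat P L] ;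
  Lhat_expr : forall f, Ccinfty_ext f ->
    exists2 g, LDhat f g & L f (Lhat_formula f g) ;
  Lhat_core : core pihat Ccinfty_ext L }.

Record Lrev_ok (L Lrev : operator R (fspace x0 * Rd R d)) : Prop := LrevOk {
  Lrev_expr : forall f, Ccinfty_ext f ->
    exists2 g, LDhat f g & Lrev f (Lrev_formula f g) ;
  Lrev_sa : self_adjoint pihat Lrev ;
  Lrev_form : exists D E, dirichlet_form pihat D E /\ associated pihat D E Lrev ;
  Lrev_core : core pihat Ccinfty_ext Lrev ;
  Lrev_Lhat : forall f g, L f g ->
    exists2 h, Lrev f h & ip pihat f g = ip pihat f h }.

(* The standing assumptions at the value gamma, with a positive spectral gap *)
Definition admissible (L Lrev : operator R (fspace x0 * Rd R d)) : Prop :=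
  [/\ 0 <= gamma, Lhat_ok L, Lrev_ok L Lrev
    & (0 < spectral_gap pihat Lrev)%E].

End model.

(** * Factorized form *)

Section factorized.
Context {R : realType} {X : finType} {x0 : X} {d : nat}.
Variable M : model R x0 d.
Variables (Qbar : X -> X -> R) (H : X -> X -> Rd R d -> R).
Variables (sigma : X -> X -> 'rV[R]_d) (s : Rd R d -> 'rV[R]_d).

(* s is the gradient of log rho *)
Record factorized : Prop := Factorized {
  Qbar_ge0 : forall x y, x != y -> 0 <= Qbar x y ;
  Qbar_diag : forall x, Qbar x x = - \sum_(y | y != x) Qbar x y ;
  Qbar_rev : forall x y, wt M x * Qbar x y = wt M y * Qbar y x ;
  Qbar_supp : forall x y, wt M x = 0 \/ wt M y = 0 -> Qbar x y = 0 ;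
  s_grad_log : grad_log_density (rho M) s ;
  H_ge0 : forall x y p, 0 < Qbar x y -> 0 <= H x y p ;
  H_L2 : forall x y, 0 < Qbar x y -> L2 (rho M) (H x y) ;
  Q_fact : forall p x y, x != y ->
    Q M p x y = if 0 < Qbar x y then Qbar x y * H x y p else 0 ;
  sigma_anti : forall x y, 0 < Qbar x y -> sigma x y = - sigma y x ;
  H_sub : forall x y, 0 < Qbar x y ->
    \forall p \ae rho M, H x y p - H y x p = - dot (sigma x y) (s p) }.

(* +oo if no rate of Qbar is positive *)
Definition Cmin : \bar R :=
  \big[Order.min/+oo%E]_(xy : X * X | (xy.1 != xy.2) && (0 < Qbar xy.1 xy.2))
    (\int[rho M]_p (`|dot (sigma xy.1 xy.2) (s p)|%:E))%E.

(* 2 C^-1 v, read as +oo if C = 0 (in the library +oo * 0 = 0) *)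
Definition Cbound (v : R) : \bar R :=
  if Cmin == 0%E then +oo%E else (2%:E * Cmin^-1 * v%:E)%E.

End factorized.

(* Main.v *)
Require Import Defs.
From HB Require Import structures.
From mathcomp Require Import all_boot all_order all_algebra.
From mathcomp Require Import all_classical all_reals all_analysis.
From mathcomp Require Import measurable_realfun.
From mathcomp Require Import ring lra.
Set Implicit Arguments.
Unset Strict Implicit.
Unset Printing Implicit Defensive.
Import Order.TTheory GRing.Theory Num.Theory.
Import numFieldNormedType.Exports.
Local Open Scope classical_set_scope.
Local Open Scope ring_scope.

(* Both Poisson equations are solved without resolvents and without using the
   completeness of L^2: a coercive quadratic functional is minimized, and the
   minimizing sequence, being Cauchy in the form norm, converges because the
   Dirichlet form is closed.  For the generator L of the semigroup P the
   functional is |f + L u|^2; a near-minimizer leaves a residual h with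
   |<h, P_T h - h>| <= eps |P_T h - h|, and the decay of P_T on mean-zero
   functions forces h to be small.  The comparison of the variances is then the
   positivity of -Lrev at the difference of the two solutions.

   Functions of x alone belong to the domain of Lrev, so the spectral gap passes
   to the averaged matrix; functions of p alone give a spectral gap kappa for
   L^D.  If g and h solve the lifted and the averaged Poisson equation, then
   w = g - h o tau satisfies -Lrev w = r for a residual r with zero mean along
   the fibres, and the variance defect <w, r> dominates
   gamma kappa |w - E_rho w|^2 while being at most |r| |w - E_rho w|, hence is
   O(1 / gamma).  The factorized case compares Dirichlet forms, using
   H_xy + H_yx >= |H_xy - H_yx|. *)

(** * Linear identities in a module *)

(** The two Poisson equations call for different functionals. For [Lrev] the Dirichlet principle
    gives a weak solution, and self-adjointness makes it strong. For the nonsymmetric [L] a weak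
    solution would only solve the equation of the adjoint; hence the least-squares functional, whose
    minimizing sequence makes [f + L u] itself small, so that closedness of the generator concludes.
    The link between [L] and [Lrev] is the equality of their quadratic forms. It carries over both
    the spectral gap and the form norm, so the closedness of one Dirichlet form supplies the limits
    for both operators. The least-squares residual h need not lie in the domain of [L], so it cannot
    be tested against [L h]; the increment P_T h - h is a legitimate substitute, being a limit of
    elements of the range. For large gamma, the residual r does not involve gamma, and neither does
    kappa: the gap lambda at one value gamma0 gives kappa = lambda / gamma0 for [L^D], which is the
    same operator for every gamma. *)

(* [lmodule R V] proves an identity between linear combinations in V by
   comparing the coefficients of the atoms with [ring]. *)
Section lmod_reflection.
Context {R : realType} {V : lmodType R}.

Inductive lexpr :=
  LVar of nat | LZero | LAdd of lexpr & lexpr | LOpp of lexpr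
  | LScale of R & lexpr.

Fixpoint leval (env : seq V) (e : lexpr) : V :=
  match e with
  | LVar i => nth 0 env i
  | LZero => 0
  | LAdd e1 e2 => leval env e1 + leval env e2
  | LOpp e1 => - leval env e1
  | LScale a e1 => a *: leval env e1
  end.

Fixpoint lcoef (e : lexpr) (i : nat) : R :=
  match e with
  | LVar j => if j == i then 1 else 0
  | LZero => 0
  | LAdd e1 e2 => lcoef e1 i + lcoef e2 i
  | LOpp e1 => - lcoef e1 i
  | LScale a e1 => a * lcoef e1 i
  end.

Lemma levalE env e :
  leval env e = \sum_(i < size env) lcoef e i *: nth 0 env i.
Proof.
elim: e => [j||e1 IH1 e2 IH2|e1 IH|a e1 IH] /=.
- have [jlt|jge] := ltnP j (size env).
    rewrite (bigD1 (Ordinal jlt))//= eqxx scale1r big1 ?addr0// => i.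
    by rewrite -val_eqE /= eq_sym => /negPf ->; rewrite scale0r.
  rewrite nth_default// big1// => i _; case: eqP => [ji|]; last by rewrite scale0r.
  by have := ltn_ord i; rewrite -ji ltnNge jge.
- by rewrite big1// => i _; rewrite scale0r.
- by rewrite IH1 IH2 -big_split; apply: eq_bigr => i _; rewrite scalerDl.
- by rewrite IH -sumrN; apply: eq_bigr => i _; rewrite scaleNr.
- by rewrite IH scaler_sumr; apply: eq_bigr => i _; rewrite scalerA.
Qed.

(** A recursion on the number of atoms, so that on a concrete environment simplification yields a
    finite conjunction, one [ring] goal per atom. *)
Fixpoint same_coef e1 e2 n : Prop :=
  if n is m.+1 then lcoef e1 m = lcoef e2 m /\ same_coef e1 e2 m else True.

Lemma leval_eq env e1 e2 :
  same_coef e1 e2 (size env) -> leval env e1 = leval env e2.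
Proof.
move=> h; rewrite !levalE; apply: eq_bigr => -[i /= ilt] _.
congr (_ *: _); elim: (size env) h i ilt => [//|n IH] /= [hn h] i.
by rewrite ltnS leq_eqVlt => /orP[/eqP->//|]; exact: IH.
Qed.

End lmod_reflection.

Ltac lmod_mem x env :=
  lazymatch env with
  | nil => constr:(false)
  | cons x _ => constr:(true)
  | cons _ ?e => lmod_mem x e
  end.

Ltac lmod_index x env :=
  lazymatch env with
  | cons x _ => constr:(0%N)
  | cons _ ?e => let i := lmod_index x e in constr:(S i)
  end.

Ltac lmod_env t env :=
  lazymatch t with
  | (?a + ?b)%R => let env1 := lmod_env a env in lmod_env b env1
  | (- ?a)%R => lmod_env a env
  | (_ *: ?a)%R => lmod_env a env
  | 0%R => env
  | _ => lazymatch lmod_mem t env with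
         | true => env
         | false => constr:(cons t env)
         end
  end.

Ltac lmod_reify R t env :=
  lazymatch t with
  | (?a + ?b)%R => let x := lmod_reify R a env in
                   let y := lmod_reify R b env in constr:(@LAdd R x y)
  | (- ?a)%R => let x := lmod_reify R a env in constr:(@LOpp R x)
  | (?c *: ?a)%R => let x := lmod_reify R a env in constr:(@LScale R c x)
  | 0%R => constr:(@LZero R)
  | _ => let i := lmod_index t env in constr:(@LVar R i)
  end.

Ltac lmodule R V :=
  lazymatch goal with
  | |- ?x = ?y =>
    let env0 := lmod_env x (@nil V) in
    let env := lmod_env y env0 in
    let e1 := lmod_reify R x env in
    let e2 := lmod_reify R y env in
    apply: (@leval_eq _ _ env e1 e2); rewrite /=; repeat split; ring
  end.

(** * Symmetric bilinear forms, near-minimizers and seminorms *)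

Record bilinear_sym (R : realType) (V : lmodType R) (B : V -> V -> R) : Prop :=
  BilinearSym {
  bilin_l : forall a u v w, B (a *: u + v) w = a * B u w + B v w ;
  bilin_sym : forall u v, B u v = B v u }.

Section bilinear.
Context {R : realType} {V : lmodType R} {B : V -> V -> R}.
Hypothesis BP : bilinear_sym B.

Lemma bilinDl u v w : B (u + v) w = B u w + B v w.
Proof. by rewrite -[u]scale1r (bilin_l BP) mul1r scale1r. Qed.

Lemma bilin0l w : B 0 w = 0.
Proof. by apply: (addIr (B 0 w)); rewrite -bilinDl add0r add0r. Qed.

Lemma bilinZl a u w : B (a *: u) w = a * B u w.
Proof. by rewrite -[a *: u]addr0 (bilin_l BP) bilin0l addr0. Qed.

Lemma bilinNl u w : B (- u) w = - B u w.
Proof. by rewrite -scaleN1r bilinZl mulN1r. Qed.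

Lemma bilinBl u v w : B (u - v) w = B u w - B v w.
Proof. by rewrite bilinDl bilinNl. Qed.

Lemma bilinDr u v w : B w (u + v) = B w u + B w v.
Proof. by rewrite !(bilin_sym BP w) bilinDl. Qed.

Lemma bilinZr a u w : B w (a *: u) = a * B w u.
Proof. by rewrite !(bilin_sym BP w) bilinZl. Qed.

Lemma bilinNr u w : B w (- u) = - B w u.
Proof. by rewrite !(bilin_sym BP w) bilinNl. Qed.

Lemma bilinBr u v w : B w (u - v) = B w u - B w v.
Proof. by rewrite bilinDr bilinNr. Qed.

Definition bilinE := (bilinDl, bilinDr, bilinNl, bilinNr, bilinZl, bilinZr).

Lemma bilin_sqD u v : B (u + v) (u + v) = B u u + 2 * B u v + B v v.
Proof. rewrite !bilinE (bilin_sym BP v u); ring. Qed.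

End bilinear.

(** The polynomial is evaluated at its minimizer [- b / a]. If [a = 0] and [b] is nonzero, its value
    at [- (c + 1) / (2 * b)] is -1, a contradiction. *)
Lemma quad_discr (R : realFieldType) (a b c : R) : 0 <= a -> 0 <= c ->
  (forall s, 0 <= a * s ^+ 2 + 2 * s * b + c) -> b ^+ 2 <= c * a.
Proof.
move=> a0 c0 h; case: (ltgtP 0 a) a0 => // [a0|a0] _.
  have := h (- b / a); rewrite -(ler_pM2r a0) mul0r => h1.
  rewrite -subr_ge0; suff -> : c * a - b ^+ 2
    = (a * (- b / a) ^+ 2 + 2 * (- b / a) * b + c) * a by [].
  by field; rewrite gt_eqF.
rewrite -a0 mulr0; case: (eqVneq b 0) => [->|b0]; first by rewrite expr0n.
exfalso; have := h (- (c + 1) / (2 * b)).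
rewrite -a0 mul0r add0r.
have -> : 2 * (- (c + 1) / (2 * b)) * b + c = -1 by field.
by rewrite ler0N1.
Qed.

Definition lin_subspace (R : realType) (V : lmodType R) (S : set V) :=
  S 0 /\ forall a u v, S u -> S v -> S (a *: u + v).

Section near_minimizer.
Context {R : realType} {W : lmodType R} {b : W -> W -> R} {l : W -> R}.
Context {S : set W}.
Hypothesis bP : bilinear_sym b.
Hypothesis l_lin : forall a u v, l (a *: u + v) = a * l u + l v.
Hypothesis SP : lin_subspace S.
Hypothesis b_ge0 : forall u, S u -> 0 <= b u u.

(** An approximate Euler-Lagrange equation: if J u is within [e] of its infimum, the polynomial s ->
    J (s h + u) - J u + e is nonnegative, and its discriminant bounds the derivative of J at u along
    h. Positivity of [b] is asked for on [S] only, because the form minimized in [symmetric_poisson]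
    is nonnegative just on the graph of the operator. *)
Lemma near_minimizer (m e : R) : 0 < e ->
  (forall u, S u -> m <= b u u + 2 * l u) ->
  exists2 u, S u & forall h, S h -> (b u h + l h) ^+ 2 <= e * b h h.
Proof.
move=> e0 lb; pose J u := b u u + 2 * l u.
have [S0 Slin] := SP.
have hi : has_inf (J @` S).
  split; first by exists (J 0), 0.
  by exists m => _ [u Su <-]; exact: lb.
have [_ [u Su <-] Ju] := inf_adherent e0 hi.
exists u => // h Sh; apply: quad_discr; rewrite ?b_ge0 ?ltW// => s.
have : inf (J @` S) <= J (s *: h + u).
  by apply: (inf_lbound hi.2); exists (s *: h + u) => //; exact: Slin.
have -> : J (s *: h + u) = J u + (b h h * s ^+ 2 + 2 * s * (b u h + l h)).
  rewrite /J l_lin !(bilinE bP) (bilin_sym bP h u); ring.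
move=> h1; lra.
Qed.

End near_minimizer.

Section seminorm.
Context {R : realType} {V : lmodType R} {B : V -> V -> R}.
Hypothesis BP : bilinear_sym B.
Hypothesis B_ge0 : forall u, 0 <= B u u.

Lemma cauchy_schwarz_sq u v : B u v ^+ 2 <= B u u * B v v.
Proof.
rewrite mulrC; apply: quad_discr => // s.
have := B_ge0 (s *: u + v); rewrite !(bilinE BP) (bilin_sym BP v u).
by move=> h; lra.
Qed.

Definition semin (u : V) : R := Num.sqrt (B u u).
Local Notation N := semin.

Lemma semin_ge0 u : 0 <= N u. Proof. exact: sqrtr_ge0. Qed.

Lemma sqr_semin u : N u ^+ 2 = B u u. Proof. exact/sqr_sqrtr/B_ge0. Qed.

Lemma cauchy_schwarz u v : `|B u v| <= N u * N v.
Proof.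
rewrite -sqrtr_sqr -sqrtrM ?B_ge0//.
by apply: ler_wsqrtr; exact: cauchy_schwarz_sq.
Qed.

Lemma cauchy_schwarz_le u v : B u v <= N u * N v.
Proof. exact/(le_trans (ler_norm _))/cauchy_schwarz. Qed.

Lemma seminD u v : N (u + v) <= N u + N v.
Proof.
rewrite -(ler_pXn2r (_ : 0 < 2)%N) ?nnegrE ?addr_ge0 ?semin_ge0//.
rewrite sqr_semin (bilin_sqD BP) -!sqr_semin sqrrD.
have := cauchy_schwarz_le u v; lra.
Qed.

Lemma seminZ a u : N (a *: u) = `|a| * N u.
Proof.
rewrite /N !(bilinE BP) mulrA -expr2 sqrtrM ?sqr_ge0// sqrtr_sqr.
by [].
Qed.

Lemma seminN u : N (- u) = N u.
Proof. by rewrite -scaleN1r seminZ normrN1 mul1r. Qed.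

Lemma semin_dist u v : N (u - v) = N (v - u).
Proof. by rewrite -seminN opprB. Qed.

Lemma semin_tri w u v : N (u - v) <= N (u - w) + N (w - v).
Proof.
have -> : u - v = (u - w) + (w - v) by rewrite addrA subrK.
exact: seminD.
Qed.

Lemma semin0 : N 0 = 0.
Proof. by rewrite /N (bilin0l BP) sqrtr0. Qed.

Lemma semin_le_dist u v : N u <= N v + N (u - v).
Proof. by have := seminD v (u - v); rewrite addrC subrK. Qed.

Lemma semin_eq u v : N (u - v) = 0 -> N u = N v.
Proof.
move=> h; apply/eqP; rewrite eq_le.
have := semin_le_dist u v; have := semin_le_dist v u.
by rewrite semin_dist h !addr0 => -> ->.
Qed.

End seminorm.

(** * Contraction semigroups on a pre-Hilbert space *)

Section semigroup.
Context {R : realType} {V : lmodType R} {B : V -> V -> R} {P : R -> V -> V}.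
Hypothesis BP : bilinear_sym B.
Hypothesis B_ge0 : forall u, 0 <= B u u.
Local Notation N := (@semin R V B).
Implicit Types (s t dl e a T M : R) (u v w : V) (n : nat).

(* The identities hold only up to seminorm zero: the elements of V will be
   functions, not classes modulo null sets. *)
Hypothesis P_nonexp : forall t u v, 0 <= t -> N (P t u - P t v) <= N (u - v).
Hypothesis P_lin : forall t a u v, 0 <= t ->
  N (P t (a *: u + v) - (a *: P t u + P t v)) = 0.
Hypothesis P_0 : forall u, N (P 0 u - u) = 0.
Hypothesis P_add : forall s t u, 0 <= s -> 0 <= t ->
  N (P (s + t) u - P s (P t u)) = 0.

(** The graph of the infinitesimal generator, with the difference quotient multiplied out by t. *)
Definition generates (u v : V) : Prop := forall e : R, 0 < e ->
  exists2 dl, 0 < dl & forall t, 0 < t < dl -> N (P t u - u - t *: v) <= e * t.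
Local Notation G := generates.

Lemma P_zero t : 0 <= t -> N (P t 0) = 0.
Proof.
move=> t0; have := P_lin (-1) 0 0 t0.
by rewrite scaler0 addr0 scaleN1r addNr subr0.
Qed.

Lemma P_contr t u : 0 <= t -> N (P t u) <= N u.
Proof.
move=> t0; have := P_nonexp u 0 t0.
have := @semin_le_dist _ _ _ BP B_ge0 (P t u) (P t 0).
rewrite P_zero// subr0; lra.
Qed.

Lemma generates_lin a u u' v v' :
  G u u' -> G v v' -> G (a *: u + v) (a *: u' + v').
Proof.
move=> Gu Gv e e0.
pose c := (`|a| + 1); have c0 : 0 < c by rewrite ltr_wpDl.
have ec0 : 0 < e / c by rewrite divr_gt0.
have [d1 d10 h1] := Gu _ ec0.
have [d2 d20 h2] := Gv _ ec0.
exists (Num.min d1 d2); first by rewrite lt_min d10.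
move=> t /andP[t0]; rewrite lt_min => /andP[td1 td2].
have {}h1 : N (P t u - u - t *: u') <= e / c * t by apply: h1; rewrite t0.
have {}h2 : N (P t v - v - t *: v') <= e / c * t by apply: h2; rewrite t0.
have -> : P t (a *: u + v) - (a *: u + v) - t *: (a *: u' + v')
  = (P t (a *: u + v) - (a *: P t u + P t v))
    + (a *: (P t u - u - t *: u') + (P t v - v - t *: v')) by lmodule R V.
apply: (le_trans (seminD BP B_ge0 _ _)).
rewrite (P_lin _ _ _ (ltW t0)) add0r; apply: (le_trans (seminD BP B_ge0 _ _)).
rewrite (seminZ BP).
have -> : e * t = `|a| * (e / c * t) + e / c * t.
  by rewrite /c; field; rewrite gt_eqF.
by rewrite lerD// ler_wpM2l.
Qed.

Lemma generates0 : G 0 0.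
Proof.
move=> e e0; exists 1 => // t /andP[t0 _].
by rewrite scaler0 !subr0 P_zero ?mulr_ge0 ?ltW.
Qed.

(** The increment after time s is [P s] applied to the increment after time 0, and [P s] does not
    expand. A first-order error known at time 0 therefore holds uniformly along the whole orbit. *)
Lemma P_step s t u u' : 0 <= s -> 0 <= t ->
  N (P (s + t) u - P s u - t *: P s u') <= N (P t u - u - t *: u').
Proof.
move=> s0 t0.
have -> : P (s + t) u - P s u - t *: P s u'
  = (P (s + t) u - P s (P t u)) + ((P s (P t u) - P s (t *: u' + u))
     + (P s (t *: u' + u) - (t *: P s u' + P s u))) by lmodule R V.
apply: (le_trans (seminD BP B_ge0 _ _)); rewrite P_add// add0r.
apply: (le_trans (seminD BP B_ge0 _ _)); rewrite P_lin// addr0.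
apply: (le_trans (P_nonexp _ _ s0)).
by have -> : P t u - (t *: u' + u) = P t u - u - t *: u' by lmodule R V.
Qed.

Lemma generates_P s u u' : 0 <= s -> G u u' -> G (P s u) (P s u').
Proof.
move=> s0 Gu e e0; have [dl dl0 h] := Gu e e0.
exists dl => // t /andP[t0 tdl]; apply: le_trans (h t _); last by rewrite t0.
apply: le_trans (P_step u u' s0 (ltW t0)).
have -> : P t (P s u) - P s u - t *: P s u'
  = (P (s + t) u - P s u - t *: P s u') - (P (s + t) u - P t (P s u)).
  by lmodule R V.
apply: (le_trans (seminD BP B_ge0 _ _)); rewrite (seminN BP).
by rewrite [s + t]addrC P_add ?addr0// ltW.
Qed.

Lemma P_mono s t u : 0 <= s <= t -> N (P t u) <= N (P s u).
Proof.
move=> /andP[s0 st]; have ts0 : 0 <= t - s by rewrite subr_ge0.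
apply: le_trans (P_contr (P s u) ts0).
rewrite (@semin_eq _ _ _ BP B_ge0 (P t u) (P (t - s) (P s u)))//.
by rewrite -{1}(subrK s t) P_add.
Qed.

(** A left Riemann sum for the integral of P_s u over [0, n dl]. It replaces a vector-valued
    integral, whose existence would require completeness, and unlike the integral it is in the
    domain of the generator by mere linearity. *)
Definition rsum (dl : R) (n : nat) (u : V) : V :=
  \sum_(k < n) dl *: P (k%:R * dl) u.

Lemma rsumS dl n u : rsum dl n.+1 u = rsum dl n u + dl *: P (n%:R * dl) u.
Proof. by rewrite /rsum big_ord_recr. Qed.

Lemma generates_rsum dl n u u' : 0 <= dl -> G u u' ->
  G (rsum dl n u) (rsum dl n u').
Proof.
move=> dl0 Gu; elim: n => [|n IH]; first by rewrite /rsum !big_ord0; exact: generates0.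
rewrite !rsumS addrC [X in G _ X]addrC.
by apply: generates_lin => //; apply: generates_P => //; rewrite mulr_ge0.
Qed.

Lemma rsum_step dl n u u' e : 0 <= dl -> 
  N (P dl u - u - dl *: u') <= e ->
  N (P (n%:R * dl) u - u - rsum dl n u') <= n%:R * e.
Proof.
move=> dl0 h; elim: n => [|n IH].
  by rewrite /rsum big_ord0 !mul0r subr0 P_0.
have -> : P (n.+1%:R * dl) u - u - rsum dl n.+1 u'
  = (P (n%:R * dl) u - u - rsum dl n u')
    + (P (n%:R * dl + dl) u - P (n%:R * dl) u - dl *: P (n%:R * dl) u').
  have -> : n.+1%:R * dl = n%:R * dl + dl by rewrite -natr1 mulrDl mul1r.
  by rewrite rsumS; lmodule R V.
apply: (le_trans (seminD BP B_ge0 _ _)).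
rewrite -[in leRHS]natr1 mulrDl mul1r lerD//.
by apply: le_trans h; apply: P_step => //; rewrite mulr_ge0.
Qed.

Lemma mesh (T b : R) : 0 < T -> 0 < b ->
  exists n dl, [/\ 0 < dl, dl < b, n%:R * dl = T & (0 < n)%N].
Proof.
move=> T0 b0; pose n := (Num.trunc (T / b)).+1.
have n0 : 0 < n%:R :> R by rewrite ltr0n.
exists n, (T / n%:R); split=> //; first by rewrite divr_gt0.
- rewrite ltr_pdivrMr// mulrC -ltr_pdivrMr//.
  by rewrite /n truncnS_gt.
- by rewrite mulrCA divff ?mulr1// gt_eqF.
Qed.

(** The fundamental theorem of calculus for t -> P_t u in discrete form: each of the n steps
    contributes an error of at most (e / T) dl, and n dl = T. *)
Lemma rsum_approx T u u' e : 0 < T -> 0 < e -> G u u' ->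
  exists n dl, [/\ 0 < dl, n%:R * dl = T & N (P T u - u - rsum dl n u') <= e].
Proof.
move=> T0 e0 Gu; have eT : 0 < e / T by rewrite divr_gt0.
have [b b0 h] := Gu _ eT.
have [n [dl [dl0 dlb nT n0]]] := mesh T0 b0.
exists n, dl; split => //.
have := @rsum_step dl n u u' (e / T * dl) (ltW dl0).
rewrite nT mulrCA nT divfK ?gt_eqF//; apply.
by apply: h; rewrite dl0.
Qed.

Lemma rsum_near dl n u M : 0 < dl ->
  (forall s, 0 <= s -> s <= n%:R * dl -> N (P s u - u) <= M) ->
  N (rsum dl n u - (n%:R * dl) *: u) <= n%:R * dl * M.
Proof.
move=> dl0; elim: n => [|n IH] h.
  by rewrite /rsum big_ord0 !mul0r scale0r subr0 (semin0 BP).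
have -> : rsum dl n.+1 u - (n.+1%:R * dl) *: u
   = (rsum dl n u - (n%:R * dl) *: u) + dl *: (P (n%:R * dl) u - u).
  by rewrite rsumS -natr1; lmodule R V.
apply: (le_trans (seminD BP B_ge0 _ _)).
rewrite -[in leRHS]natr1 !mulrDl mul1r lerD//.
  apply: IH => s s0 sn; apply: h => //; apply: (le_trans sn).
  by rewrite ler_wpM2r ?ler_nat// ltW.
rewrite (seminZ BP) gtr0_norm//; apply: ler_wpM2l; first exact: ltW.
apply: h.
  by rewrite mulr_ge0// ltW.
by rewrite ler_wpM2r ?ler_nat// ltW.
Qed.

(** A mean value inequality: the derivative P_s u' of the orbit stays within [M] of [u'] up to time
    [T], and Riemann sums stand in for the integral of the derivative. *)
Lemma generates_increment T u u' M : 0 < T -> G u u' ->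
  (forall s, 0 <= s -> s <= T -> N (P s u' - u') <= M) ->
  N (P T u - u - T *: u') <= T * M.
Proof.
move=> T0 Gu h; apply/ler_addgt0Pr => e e0.
have [n [dl [dl0 nT h1]]] := rsum_approx T0 e0 Gu.
have := @rsum_near dl n u' M dl0; rewrite nT => /(_ h) h2.
have := @semin_tri _ _ _ BP B_ge0 (rsum dl n u') (P T u - u) (T *: u').
lra.
Qed.

Hypothesis P_cont : forall u e, 0 < e ->
  exists2 dl, 0 < dl & forall t, 0 < t < dl -> N (P t u - u) <= e.

(** The generator is closed. The threshold [dl] comes from strong continuity at the limit [u']
    alone, before any approximant is chosen, so the bound of [generates_increment] survives the
    passage to the limit. *)
Lemma generates_closed u u' :
  (forall e, 0 < e -> exists v v', [/\ G v v', N (v - u) <= e & N (v' - u') <= e]) ->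
  G u u'.
Proof.
move=> h e e0; have e20 : 0 < e / 2 by lra.
have [dl dl0 hdl] := P_cont u' e20.
exists dl => // t /andP[t0 tdl]; apply/ler_addgt0Pr => k k0.
(* The errors add up to t (e / 2 + 3 et) + 2 et, which is at most (7 / 8) e t + k / 2. *)
pose et := Num.min (k / 4) (e / 8).
have et0 : 0 < et by rewrite /et lt_min; apply/andP; split; lra.
have [v [v' [Gv h1 h2]]] := h _ et0.
have hM s : 0 <= s -> s <= t -> N (P s v' - v') <= e / 2 + 2 * et.
  move=> s0 st.
  have h3 : N (P s u' - u') <= e / 2.
    have [s1|s1] := ltP 0 s.
      by apply: hdl; rewrite s1 (le_lt_trans st).
    have -> : s = 0 by apply/eqP; rewrite eq_le s0 s1.
    by rewrite P_0 ltW.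
  have -> : P s v' - v' = (P s v' - P s u') + ((P s u' - u') + (u' - v')).
    by lmodule R V.
  have := seminD BP B_ge0 (P s v' - P s u') ((P s u' - u') + (u' - v')).
  have := seminD BP B_ge0 (P s u' - u') (u' - v').
  have := P_nonexp v' u' s0.
  rewrite (semin_dist BP u' v'); lra.
have h3 := generates_increment t0 Gv hM.
have -> : P t u - u - t *: u' = (P t v - v - t *: v')
   + ((P t u - P t v) + ((v - u) + t *: (v' - u'))) by lmodule R V.
have h4 := seminD BP B_ge0 (P t v - v - t *: v') ((P t u - P t v) + ((v - u) + t *: (v' - u'))).
have h5 := seminD BP B_ge0 (P t u - P t v) ((v - u) + t *: (v' - u')).
have h6 := seminD BP B_ge0 (v - u) (t *: (v' - u')).
have h7 := P_nonexp u v (ltW t0).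
rewrite (seminZ BP) gtr0_norm// in h6.
rewrite (semin_dist BP u v) in h7.
have h8 := ler_wpM2l (ltW t0) h2.
have h9 : et <= k / 4 by rewrite /et ge_min lexx.
have h10 : et <= e / 8 by rewrite /et ge_min lexx orbT.
have h11 := ler_wpM2l (ltW t0) h10.
have h12 : 0 <= t * e by rewrite mulr_ge0 ?ltW.
lra.
Qed.

Context {lam : R}.
Hypothesis lam0 : 0 < lam.
Hypothesis coercive : forall u u', G u u' -> lam * B u u <= - B u u'.

(** One Euler step [v] = [w] + dl w' + r with |r| <= h dl. Coercivity makes the cross term with w' a
    loss of 2 dl lam |w|^2; the remaining terms are of order dl h and dl^2, hence negligible after
    summation. *)
Lemma decay_step (dl h : R) (w w' v : V) (x y : R) : 0 < dl -> 0 <= h <= 1 ->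
  G w w' -> N w <= x -> N w' <= y -> N (v - w - dl *: w') <= h * dl ->
  B v v <= B w w - 2 * dl * (lam * B w w)
           + dl * (2 * x * h + dl * (y + 1) ^+ 2).
Proof.
move=> dl0 /andP[h0 h1] Ga ax ay hc.
set r := v - w - dl *: w' in hc.
have -> : v = w + (dl *: w' + r) by rewrite /r; lmodule R V.
rewrite (bilin_sqD BP) (bilinDr BP) (bilinZr BP).
have k1 := coercive Ga.
have k2 : B w r <= x * (h * dl).
  apply: (le_trans (cauchy_schwarz_le BP B_ge0 _ _)).
  by apply: ler_pM => //; exact: semin_ge0.
have k3 : B (dl *: w' + r) (dl *: w' + r) <= (dl * (y + 1)) ^+ 2.
  rewrite -(sqr_semin B_ge0).
  have k4 : N (dl *: w' + r) <= dl * (y + 1).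
    apply: (le_trans (seminD BP B_ge0 _ _)); rewrite (seminZ BP) gtr0_norm//.
    rewrite mulrDr mulr1 lerD ?ler_pM2l//.
    by apply: (le_trans hc); rewrite ler_piMl// ltW.
  by rewrite ler_pXn2r ?nnegrE// ?semin_ge0//; apply: le_trans k4; exact: semin_ge0.
have k5 := ler_wpM2l (ltW dl0) k1.
rewrite exprMn in k3.
set s := B (dl *: w' + r) (dl *: w' + r) in k3 *.
lra.
Qed.

(** Norms decrease along the orbit, so every step loses at least 2 dl lam |P_T u|^2, measured by the
    final value, and the losses simply add up. The factor is weaker than an exponential, but being
    below 1 is what [range_dense] requires of it. *)
Lemma decay T u u' : 0 < T -> G u u' ->
  B (P T u) (P T u) * (1 + 2 * lam * T) <= B u u.
Proof.
move=> T0 Gu; apply/ler_addgt0Pr => e e0.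
pose x := N u; pose y := N u'.
have x0 : 0 <= x by exact: semin_ge0.
have y0 : 0 <= y by exact: semin_ge0.
have x1 : 0 < 4 * T * (x + 1) by rewrite !mulr_gt0// ltr_wpDl.
have y2 : 0 < (y + 1) ^+ 2 by rewrite exprn_gt0// ltr_wpDl.
have y1 : 0 < 2 * T * (y + 1) ^+ 2 by rewrite mulr_gt0// mulr_gt0.
(* The relative step error [h] and the bound on [dl] further down each keep one of the two terms of
   [T * kp] below e / 2, where [kp] is the error per unit of time. *)
pose h := Num.min 1 (e / (4 * T * (x + 1))).
have h0 : 0 < h by rewrite /h lt_min ltr01 divr_gt0.
have h1 : h <= 1 by rewrite /h ge_min lexx.
have he : h * (4 * T * (x + 1)) <= e.
  by rewrite -ler_pdivlMr// /h ge_min lexx orbT.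
have [b b0 hb] := Gu _ h0.
have bb0 : 0 < Num.min b (e / (2 * T * (y + 1) ^+ 2)).
  by rewrite lt_min b0 divr_gt0.
have [n [dl [dl0 dlb nT n0]]] := mesh T0 bb0.
move: dlb; rewrite lt_min => /andP[dlb]; rewrite ltr_pdivlMr// => dle.
pose beta := B (P T u) (P T u).
pose kp := 2 * x * h + dl * (y + 1) ^+ 2.
suff key j : (j <= n)%N -> B (P (j%:R * dl) u) (P (j%:R * dl) u)
    + j%:R * dl * (2 * lam * beta) <= B u u + j%:R * dl * kp.
  have := key n (leqnn n); rewrite nT -/beta /kp => k.
  have xh : x * h <= (x + 1) * h by apply: ler_wpM2r (ltW h0) _ _ _; rewrite lerDl.
  have xhT := ler_wpM2l (ltW T0) xh.
  lra.
elim: j => [_|j IH jn].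
  rewrite !mul0r !addr0 -!(sqr_semin B_ge0).
  by rewrite (semin_eq BP B_ge0 (P_0 u)).
have {}IH := IH (ltnW jn).
have jd0 : 0 <= j%:R * dl by rewrite mulr_ge0// ltW.
have st := @decay_step dl h (P (j%:R * dl) u) (P (j%:R * dl) u')
  (P (j.+1%:R * dl) u) x y dl0.
have {}st := st _ (generates_P jd0 Gu) (P_contr u jd0) (P_contr u' jd0) _.
have hh : 0 <= h <= 1 by rewrite ltW.
have {}st := st hh.
have dd : N (P (j.+1%:R * dl) u - P (j%:R * dl) u - dl *: P (j%:R * dl) u') <= h * dl.
  rewrite -natr1 mulrDl mul1r; apply: (le_trans (P_step _ _ jd0 (ltW dl0))).
  by apply: hb; rewrite dl0.
have {}st := st dd.
have mono : beta <= B (P (j%:R * dl) u) (P (j%:R * dl) u).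
  rewrite /beta -!(sqr_semin B_ge0) ler_pXn2r ?nnegrE ?semin_ge0//.
  by apply: P_mono; rewrite jd0 -nT ler_wpM2r ?(ltW dl0)// ler_nat ltnW.
have m2 : dl * (lam * beta) <= dl * (lam * B (P (j%:R * dl) u) (P (j%:R * dl) u)).
  by rewrite !ler_pM2l.
rewrite -/kp in st.
have -> : j.+1%:R * dl = j%:R * dl + dl by rewrite -natr1 mulrDl mul1r.
rewrite -natr1 mulrDl mul1r in st.
set X := B (P (j%:R * dl + dl) u) _ in st *.
lra.
Qed.

Hypothesis dense : forall u e, 0 < e -> exists v v', G v v' /\ N (u - v) <= e.

(** Both sides are continuous in [u], so the decay extends beyond the domain of the generator, where
    the residual of [range_dense] may lie. *)
Lemma decay_dense u : B (P 1 u) (P 1 u) * (1 + 2 * lam) <= B u u.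
Proof.
pose c := 1 + 2 * lam; have c0 : 0 < c by rewrite addr_gt0// mulr_gt0.
suff h : N (P 1 u) * Num.sqrt c <= N u.
  have := h; rewrite -ler_sqr ?nnegrE ?mulr_ge0 ?semin_ge0 ?sqrtr_ge0//.
  by rewrite exprMn !(sqr_semin B_ge0) sqr_sqrtr// ltW.
apply/ler_addgt0Pr => e e0; pose s := Num.sqrt c.
have s0 : 0 <= s by exact: sqrtr_ge0.
have es0 : 0 < e / (s + 1) by rewrite divr_gt0// ltr_wpDl.
have [v [v' [Gv h]]] := dense u es0.
have d1 := decay ltr01 Gv; rewrite mulr1 -/c in d1.
have d2 : N (P 1 v) * s <= N v.
  rewrite -ler_sqr ?nnegrE ?mulr_ge0 ?semin_ge0//.
  by rewrite exprMn !(sqr_semin B_ge0) sqr_sqrtr// ltW.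
have d3 := @semin_le_dist _ _ _ BP B_ge0 (P 1 u) (P 1 v).
have d4 := @semin_le_dist _ _ _ BP B_ge0 v u.
have d5 := P_nonexp u v ler01.
rewrite (semin_dist BP v u) in d4.
have d6 : N (u - v) * (s + 1) <= e by rewrite -ler_pdivlMr// ltr_wpDl.
have d7 := ler_wpM2r s0 d3.
have d8 := ler_wpM2r s0 d5.
rewrite -/s; lra.
Qed.

(** The residual [h] of a least-squares near-minimizer is almost orthogonal to the range of the
    generator, hence to all increments [P 1 v - v], and in particular to the one with [v = h]. As
    P_1 contracts strictly, <h, h - P_1 h> is at least k |h|^2, which makes h small. *)
Lemma range_dense f e : 0 < e ->
  exists u u', G u u' /\ N (f + u') <= e.
Proof.
move=> e0; pose c := 1 + 2 * lam; have c1 : 1 < c by rewrite ltrDl mulr_gt0.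
pose k := 1 - (Num.sqrt c)^-1.
have sc1 : 1 < Num.sqrt c by rewrite -[ltLHS]sqrtr1 ltr_sqrt// (lt_trans ltr01).
have sc0 := lt_trans ltr01 sc1.
have k0 : 0 < k by rewrite /k subr_gt0 invf_lt1//; lra.
(* Chosen so that the final inequality k |h|^2 <= 2 r |h| reads |h| <= e; the factor 2 comes from
   |P_1 h - h| <= 2 |h|. *)
pose r := e * k / 2; have r0 : 0 < r by rewrite /r divr_gt0// mulr_gt0.
have rE : r = e * k / 2 by [].
clearbody r.
(* The generator is a relation, so the minimization runs over its graph, a subspace of [V * V]. *)
pose b (p q : V * V) := B p.2 q.2; pose l (p : V * V) := B f p.2.
have bP : bilinear_sym b.
  by split => [a [? ?] [? ?] [? ?]|[? ?] [? ?]]; rewrite /b/= ?(bilin_l BP)// (bilin_sym BP).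
have lP a (p q : V * V) : l (a *: p + q) = a * l p + l q.
  by rewrite /l/= !(bilinE BP).
have SP : lin_subspace [set p : V * V | G p.1 p.2].
  split; first exact: generates0.
  by move=> a p q Gp Gq; exact: generates_lin.
have b0 (p : V * V) : G p.1 p.2 -> 0 <= b p p by rewrite /b.
have lb (p : V * V) : G p.1 p.2 -> - B f f <= b p p + 2 * l p.
  move=> _; have := B_ge0 (p.2 + f).
  by rewrite (bilin_sqD BP) /b /l (bilin_sym BP f); lra.
have [[u u'] /= Gu hu] := near_minimizer bP lP SP b0 (exprn_gt0 2 r0) lb.
exists u, u'; split=> //; pose h := f + u'.
have hG v v' : G v v' -> `|B h v'| <= r * N v'.
  move=> Gv; have := hu (v, v') Gv; rewrite /b /l /= => hv.
  rewrite -ler_sqr ?nnegrE ?normr_ge0 ?mulr_ge0 ?semin_ge0 ?(ltW r0)//.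
  rewrite real_normK ?num_real// exprMn (sqr_semin B_ge0) /h.
  by rewrite (bilinDl BP) addrC.
(* The increment is approximated by the Riemann sum of [P] applied to [v'], which is the generator
   applied to the Riemann sum of [v]. *)
have hP1 : forall v v', G v v' -> `|B h (P 1 v - v)| <= r * N (P 1 v - v).
  move=> v v' Gv; apply/ler_addgt0Pr => d d0.
  have dh0 : 0 < d / (N h + r) by rewrite divr_gt0// ltr_wpDl// semin_ge0.
  have [n [dl [dl0 _ hd]]] := rsum_approx ltr01 dh0 Gv.
  set w := rsum dl n v' in hd.
  have h1 : `|B h w| <= r * N w by exact: hG (generates_rsum n (ltW dl0) Gv).
  have h2 := cauchy_schwarz BP B_ge0 h (P 1 v - v - w).
  have h3 : `|B h (P 1 v - v)| <= `|B h (P 1 v - v - w)| + `|B h w|.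
    by rewrite (le_trans _ (ler_normD _ _))// -(bilinDr BP) subrK.
  have h4 := @semin_le_dist _ _ _ BP B_ge0 w (P 1 v - v).
  rewrite (semin_dist BP w) in h4.
  have h5 := ler_wpM2l (ltW r0) h4.
  have h6 : N (P 1 v - v - w) * (N h + r) <= d.
    by rewrite -ler_pdivlMr// ltr_wpDl// semin_ge0.
  lra.
have hP v : `|B h (P 1 v - v)| <= r * N (P 1 v - v).
  apply/ler_addgt0Pr => d d0.
  have dh0 : 0 < d / (2 * (N h + r)) by rewrite divr_gt0// mulr_gt0// ltr_wpDl// semin_ge0.
  have [w [w' [Gw hw]]] := dense v dh0.
  have h1 := hP1 _ _ Gw.
  have h6 : N (v - w) * (2 * (N h + r)) <= d.
    by rewrite -ler_pdivlMr// mulr_gt0// ltr_wpDl// semin_ge0.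
  pose z := (P 1 v - v) - (P 1 w - w).
  have h7 : N z <= 2 * N (v - w).
    have -> : z = (P 1 v - P 1 w) + (w - v) by rewrite /z; lmodule R V.
    have := seminD BP B_ge0 (P 1 v - P 1 w) (w - v).
    have := P_nonexp v w ler01; rewrite (semin_dist BP w v); lra.
  have h2 := cauchy_schwarz BP B_ge0 h z.
  have h3 : `|B h (P 1 v - v)| <= `|B h z| + `|B h (P 1 w - w)|.
    by rewrite (le_trans _ (ler_normD _ _))// -(bilinDr BP) subrK.
  have h4 := @semin_le_dist _ _ _ BP B_ge0 (P 1 w - w) (P 1 v - v).
  rewrite (semin_dist BP (P 1 w - w)) -/z in h4.
  have h5 := ler_wpM2l (ltW r0) h4.
  have h8 := ler_wpM2l (semin_ge0 (B := B) h) h7.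
  have h9 := ler_wpM2l (ltW r0) h7.
  lra.
have dh := decay_dense h.
have hP1h : N (P 1 h) <= (1 - k) * N h.
  rewrite /k opprB addrC subrK mulrC ler_pdivlMr//.
  rewrite -ler_sqr ?nnegrE ?mulr_ge0 ?semin_ge0 ?(ltW sc0)//.
  by rewrite exprMn !(sqr_semin B_ge0) sqr_sqrtr// ltW// (lt_trans ltr01).
have h1 : N (P 1 h - h) <= 2 * N h.
  apply: (le_trans (seminD BP B_ge0 _ _)); rewrite (seminN BP).
  have := P_contr h ler01; lra.
have h2 : B h (P 1 h) <= (1 - k) * N h ^+ 2.
  apply: (le_trans (cauchy_schwarz_le BP B_ge0 _ _)).
  by rewrite expr2 mulrCA ler_wpM2l// semin_ge0.
have h3 := hP h; have h4 := ler_wpM2l (ltW r0) h1.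
have h5 : B h h - B h (P 1 h) <= 2 * r * N h.
  have := ler_norm (- B h (P 1 h - h)); rewrite normrN (bilinBr BP) in h3 *; lra.
rewrite -(sqr_semin B_ge0) in h5; rewrite -/h.
have h6 : k * N h * N h <= k * e * N h.
  by move: h5 h2; rewrite rE expr2; lra.
have [nh|nh] := eqVneq (N h) 0; first by rewrite nh ltW.
have nh0 : 0 < N h by rewrite lt_neqAle eq_sym nh semin_ge0.
by rewrite ler_pM2r// ler_pM2l in h6.
Qed.

End semigroup.

(** * Abstract Poisson equations *)

Section poisson_solvability.
Context {R : realType} {V : lmodType R} {B : V -> V -> R}.
Hypothesis BP : bilinear_sym B.
Hypothesis B_ge0 : forall u, 0 <= B u u.
Local Notation N := (@semin R V B).
Implicit Types (u v f h : V) (A : V -> V -> Prop).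

(* For w' = A w this is the squared form norm of w. *)
Definition energy (w w' : V) : R := - B w w' + B w w.

(** Only a limit in seminorm is asked for. That it belongs to the domain is recovered later, from
    self-adjointness or from closedness of the generator. *)
Definition energy_complete A : Prop := forall u u' : nat -> V,
  (forall n, A (u n) (u' n)) ->
  (forall e : R, 0 < e -> exists n0, forall m n, (n0 <= m)%N -> (n0 <= n)%N ->
    energy (u m - u n) (u' m - u' n) < e) ->
  exists v : V, forall e : R, 0 < e ->
    exists n0, forall n, (n0 <= n)%N -> N (u n - v) <= e.

Lemma inv_succ_cauchy (K : R) (F : nat -> nat -> R) :
  (forall m n, F m n <= K * (m.+1%:R^-1 + n.+1%:R^-1) ^+ 2) ->
  forall e : R, 0 < e -> exists n0, forall m n, (n0 <= m)%N -> (n0 <= n)%N ->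
    F m n < e.
Proof.
move=> h e e0; pose K1 : R := `|K| + 1.
have K10 : 0 < K1 by rewrite ltr_wpDl.
pose n0 := Num.trunc (4 * K1 / e); exists n0 => m n n0m n0n.
have n00 : 0 < n0.+1%:R :> R by rewrite ltr0n.
have n0e : n0.+1%:R^-1 * (4 * K1) < e.
  by rewrite mulrC ltr_pdivrMr// [e * _]mulrC -ltr_pdivrMr// /n0 truncnS_gt.
have inv_le k : (n0 <= k)%N -> 0 <= (k.+1%:R^-1 : R) <= n0.+1%:R^-1.
  by move=> n0k; rewrite invr_ge0 ler0n/= lef_pV2 ?posrE// ler_nat ltnS.
have /andP[m1 m2] := inv_le _ n0m; have /andP[n1 n2] := inv_le _ n0n.
set x := m.+1%:R^-1 in m1 m2; set y := n.+1%:R^-1 in n1 n2.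
set z := n0.+1%:R^-1 in n0e m2 n2.
have z0 : 0 <= z by exact: le_trans m2.
have z1 : z <= 1 by rewrite /z invf_le1// ler1n.
have KK : K <= K1 by rewrite /K1 (le_trans (ler_norm K))// lerDl.
apply: (le_lt_trans (h m n)); apply: le_lt_trans n0e.
have s1 : (x + y) ^+ 2 <= 4 * z.
  have -> : 4 * z = (2 * z) * 2 by ring.
  by rewrite expr2; apply: ler_pM; rewrite ?addr_ge0//; lra.
have s0 : 0 <= (x + y) ^+ 2 by rewrite sqr_ge0.
rewrite (le_trans (ler_wpM2r s0 KK))// (le_trans (ler_wpM2l (ltW K10) s1))//.
by have -> : K1 * (4 * z) = z * (4 * K1) by ring.
Qed.

Context {lam : R}.
Hypothesis lam0 : 0 < lam.

(** Coercivity turns the upper bound into N w <= d / lam. The two summands of the constant then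
    bound - B w w' and B w w respectively. *)
Lemma energy_bound (w w' : V) (d : R) : 0 <= d ->
  lam * B w w <= - B w w' -> - B w w' <= d * N w ->
  energy w w' <= (lam^-1 + lam^-1 ^+ 2) * d ^+ 2.
Proof.
move=> d0 co le; have sq := sqr_semin B_ge0 w.
have w0 : 0 <= N w by exact: semin_ge0.
have l0 : 0 <= lam^-1 by rewrite invr_ge0 ltW.
have wd : N w <= lam^-1 * d.
  have [nw|nw] := eqVneq (N w) 0; first by rewrite nw mulr_ge0.
  have nw0 : 0 < N w by rewrite lt_neqAle eq_sym nw.
  rewrite mulrC ler_pdivlMr// -(ler_pM2r nw0) mulrAC -expr2 sq mulrC.
  exact: le_trans le.
have w2 : N w ^+ 2 <= (lam^-1 * d) ^+ 2 by rewrite ler_sqr ?nnegrE ?mulr_ge0.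
have dw := ler_wpM2l d0 wd.
rewrite /energy -sq mulrDl -!exprMn; apply: lerD => //.
have -> : lam^-1 * d ^+ 2 = d * (lam^-1 * d) by ring.
exact: le_trans dw.
Qed.

(** The Dirichlet principle for the functional - <u, A u> - 2 <f, u>. The conclusion is the weak
    form of the equation - A v = f, tested on the domain of [A]. *)
Lemma symmetric_poisson A :
  A 0 0 ->
  (forall a u u' v v', A u u' -> A v v' -> A (a *: u + v) (a *: u' + v')) ->
  (forall u u' v v', A u u' -> A v v' -> B u v' = B u' v) ->
  (forall u u', A u u' -> lam * B u u <= - B u u') ->
  energy_complete A ->
  forall f, exists v, forall h h', A h h' -> B v h' = - B f h.
Proof.
move=> A0 Alin Asym Aco Acompl f.
(* Symmetrized so as to be symmetric on all of [V * V]; on the graph of [A] it reduces to - <u, A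
   v>. *)
pose b (p q : V * V) := - 2^-1 * (B p.1 q.2 + B p.2 q.1).
pose l (p : V * V) := - B f p.1.
have bP : bilinear_sym b.
  split => [a [? ?] [? ?] [? ?]|[p p'] [q q']]; rewrite /b/=.
    rewrite !(bilinE BP); ring.
  rewrite (bilin_sym BP q) (bilin_sym BP q'); ring.
have lP a (p q : V * V) : l (a *: p + q) = a * l p + l q.
  rewrite /l/= !(bilinE BP); ring.
have bE (p q : V * V) : A p.1 p.2 -> A q.1 q.2 -> b p q = - B p.1 q.2.
  by move=> Ap Aq; rewrite /b -(Asym _ _ _ _ Ap Aq); lra.
have SP : lin_subspace [set p : V * V | A p.1 p.2].
  split; first exact: A0.
  by move=> a x y Ax Ay; exact: Alin.
have b0 (p : V * V) : A p.1 p.2 -> 0 <= b p p.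
  by move=> Ap; rewrite bE//; apply: le_trans (Aco _ _ Ap); rewrite mulr_ge0// ltW.
(* Completing the square in lam |u|^2 - 2 |f| |u|. *)
have lb (p : V * V) : A p.1 p.2 -> - (N f ^+ 2 / lam) <= b p p + 2 * l p.
  move=> Ap; rewrite bE// /l; have := Aco _ _ Ap.
  have := cauchy_schwarz_le BP B_ge0 f p.1; rewrite -(sqr_semin B_ge0).
  set x := N f; set y := N p.1 => c1 c2.
  have : 0 <= (lam * y - x) ^+ 2 / lam by rewrite mulr_ge0 ?sqr_ge0 ?invr_ge0 ?ltW.
  have -> : (lam * y - x) ^+ 2 / lam = lam * y ^+ 2 - 2 * (x * y) + x ^+ 2 / lam.
    by field; rewrite gt_eqF.
  move=> c3; lra.
have ex n : exists p : V * V, A p.1 p.2 /\ forall h h', A h h' ->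
    `|B p.1 h' + B f h| ^+ 2 <= n.+1%:R^-1 ^+ 2 * - B h h'.
  have e0 : 0 < (n.+1%:R^-1 : R) ^+ 2 by rewrite exprn_gt0// invr_gt0 ltr0n.
  have [p Ap hp] := near_minimizer bP lP SP b0 e0 lb.
  exists p; split => // h h' Ah.
  have := hp (h, h') Ah; rewrite (bE _ (h, h'))// (bE (h, h') (h, h'))//= /l/=.
  by rewrite real_normK ?num_real// -opprD sqrrN.
have [F hF] := choice ex.
have Adist m n : A ((F m).1 - (F n).1) ((F m).2 - (F n).2).
  have := Alin (-1) _ _ _ _ (hF n).1 (hF m).1.
  by rewrite !scaleN1r !(addrC (- _)).
have bound m n : energy ((F m).1 - (F n).1) ((F m).2 - (F n).2)
    <= (1 + lam^-1) * (m.+1%:R^-1 + n.+1%:R^-1) ^+ 2.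
  set x := (F m).1 - _; set x' := (F m).2 - _; pose c := - B x x'.
  have Ax : A x x' by exact: Adist.
  have cB : lam * B x x <= c by exact: Aco.
  have c0 : 0 <= c by apply: le_trans cB; rewrite mulr_ge0// ltW.
  (* The approximate equations of [F m] and [F n] are both tested on their own difference.
     Subtracting them removes [f] and leaves c <= d * sqrt c, that is c <= d^2, for the energy c of
     the difference. *)
  have half k : `|B (F k).1 x' + B f x| <= k.+1%:R^-1 * Num.sqrt c.
    have [_ /(_ _ _ Ax)] := hF k; rewrite -/c => hk.
    rewrite -ler_sqr ?nnegrE ?normr_ge0 ?mulr_ge0 ?invr_ge0 ?sqrtr_ge0//.
    by rewrite exprMn sqr_sqrtr.
  pose s := Num.sqrt c; pose d : R := m.+1%:R^-1 + n.+1%:R^-1.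
  have d0 : 0 <= d by rewrite addr_ge0// invr_ge0.
  have s0 : 0 <= s by exact: sqrtr_ge0.
  have ss : s ^+ 2 = c by rewrite sqr_sqrtr.
  have cs : s ^+ 2 <= d * s.
    have -> : s ^+ 2 = (B (F n).1 x' + B f x) - (B (F m).1 x' + B f x).
      by rewrite ss /c {1}/x !(bilinE BP); ring.
    apply: (le_trans (ler_norm _)); apply: (le_trans (ler_normB _ _)).
    by rewrite addrC mulrDl lerD ?half.
  have sd : s <= d.
    have [->//|nw] := eqVneq s 0.
    have nw0 : 0 < s by rewrite lt_neqAle eq_sym nw.
    by rewrite expr2 ler_pM2r in cs.
  have cd : c <= d ^+ 2 by rewrite -ss ler_sqr ?nnegrE.
  rewrite /energy -/c -/d mulrDl mul1r lerD//.
  by rewrite mulrC ler_pdivlMr// mulrC (le_trans cB).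
have [v hv] := Acompl (fst \o F) (snd \o F) (fun n => (hF n).1)
  (inv_succ_cauchy bound).
exists v => h h' Ah; apply/eqP; rewrite -subr_eq0 opprK -normr_le0.
apply/ler_addgt0Pr => e e0; rewrite add0r.
pose s := Num.sqrt (- B h h'); pose K := s + N h' + 1.
have s0 : 0 <= s by exact: sqrtr_ge0.
have Nh0 : 0 <= N h' by exact: semin_ge0.
have K0 : 0 < K by rewrite /K; lra.
have eK0 : 0 < e / K by rewrite divr_gt0.
have [n0 hn0] := hv _ eK0.
pose n := maxn n0 (Num.trunc (e / K)^-1).
have h1 : N ((F n).1 - v) <= e / K by apply: hn0; rewrite leq_maxl.
have h2 : (n.+1%:R^-1 : R) <= e / K.
  rewrite -[leRHS]invrK lef_pV2 ?posrE ?invr_gt0 ?ltr0n//.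
  rewrite ltW// (lt_le_trans (truncnS_gt _))// ler_nat ltnS leq_maxr.
  by [].
have [_ /(_ _ _ Ah) h3] := hF n.
have h4 : `|B (F n).1 h' + B f h| <= n.+1%:R^-1 * s.
  rewrite -ler_sqr ?nnegrE ?normr_ge0 ?mulr_ge0 ?invr_ge0//.
  rewrite exprMn sqr_sqrtr//; apply: le_trans (Aco _ _ Ah).
  by rewrite mulr_ge0// ltW.
have h5 := cauchy_schwarz BP B_ge0 ((F n).1 - v) h'.
have h6 : `|B v h' + B f h| <= `|B (F n).1 h' + B f h| + `|B ((F n).1 - v) h'|.
  apply: le_trans (ler_normB _ _); rewrite (bilinBl BP) le_eqVlt.
  by apply/orP; left; apply/eqP; congr (`|_|); ring.
have h7 := ler_wpM2r s0 h2; have h8 := ler_wpM2r Nh0 h1.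
have h9 : e / K * s + e / K * N h' + e / K = e.
  by rewrite -!mulrDr -{2}[e / K]mulr1 -mulrDr divfK// gt_eqF.
rewrite (le_trans h6)// (le_trans (lerD (le_trans h4 h7) (le_trans h5 h8)))//.
by rewrite -[leRHS]h9 lerDl ltW.
Qed.

(** By density of the range there are u_n with |f + L u_n| <= 1 / (n + 1). Coercivity makes them
    Cauchy in energy, and closedness of the generator identifies the limit. *)
Lemma semigroup_poisson (P : R -> V -> V) :
  (forall t u v, 0 <= t -> N (P t u - P t v) <= N (u - v)) ->
  (forall t a u v, 0 <= t ->
    N (P t (a *: u + v) - (a *: P t u + P t v)) = 0) ->
  (forall u, N (P 0 u - u) = 0) ->
  (forall s t u, 0 <= s -> 0 <= t -> N (P (s + t) u - P s (P t u)) = 0) ->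
  (forall u e, 0 < e ->
    exists2 dl, 0 < dl & forall t, 0 < t < dl -> N (P t u - u) <= e) ->
  (forall u u', @generates R V B P u u' -> lam * B u u <= - B u u') ->
  (forall u e, 0 < e ->
    exists v v', @generates R V B P v v' /\ N (u - v) <= e) ->
  energy_complete (@generates R V B P) ->
  forall f, exists u, @generates R V B P u (- f).
Proof.
move=> Pn Pl P0 Pa Pc co de Gc f.
have ex n : exists p : V * V, @generates R V B P p.1 p.2
    /\ N (f + p.2) <= n.+1%:R^-1.
  have e0 : 0 < (n.+1%:R^-1 : R) by rewrite invr_gt0 ltr0n.
  have [u [u' [Gu hu]]] := range_dense BP B_ge0 Pn Pl P0 Pa lam0 co de f e0.
  by exists (u, u').
have [F hF] := choice ex.
have Gdist m n : @generates R V B P ((F m).1 - (F n).1) ((F m).2 - (F n).2).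
  have := generates_lin BP B_ge0 Pl (-1) (hF n).1 (hF m).1.
  by rewrite !scaleN1r !(addrC (- _)).
have bound m n : energy ((F m).1 - (F n).1) ((F m).2 - (F n).2)
    <= (lam^-1 + lam^-1 ^+ 2) * (m.+1%:R^-1 + n.+1%:R^-1) ^+ 2.
  apply: energy_bound; first by rewrite addr_ge0// invr_ge0.
    exact: co.
  set x := (F m).1 - _; set x' := (F m).2 - _.
  have h1 : N x' <= m.+1%:R^-1 + n.+1%:R^-1.
    have -> : x' = (f + (F m).2) - (f + (F n).2) by rewrite /x'; lmodule R V.
    apply: (le_trans (seminD BP B_ge0 _ _)); rewrite (seminN BP).
    by rewrite lerD//; [have [] := hF m|have [] := hF n].
  rewrite -(bilinNr BP) mulrC; apply: (le_trans (cauchy_schwarz_le BP B_ge0 _ _)).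
  by rewrite (seminN BP) ler_wpM2l// semin_ge0.
have [v hv] := Gc (fst \o F) (snd \o F) (fun n => (hF n).1)
  (inv_succ_cauchy bound).
exists v; apply: (generates_closed BP B_ge0 Pn Pl P0 Pa Pc) => e e0.
have [n0 hn0] := hv _ e0.
pose n := maxn n0 (Num.trunc e^-1).
exists (F n).1, (F n).2; split; first by have [] := hF n.
  by apply: hn0; rewrite leq_maxl.
rewrite opprK addrC; have [_ hn] := hF n; apply: (le_trans hn).
rewrite -[leRHS]invrK lef_pV2 ?posrE ?invr_gt0 ?ltr0n//.
by rewrite ltW// (lt_le_trans (truncnS_gt _))// ler_nat ltnS leq_maxr.
Qed.

End poisson_solvability.

(** * Square-integrable functions *)

Lemma cvg_EFin0P (R : realType) (I : Type) (F : set_system I) (FF : Filter F)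
    (s : I -> R) : (forall i, 0 <= s i) ->
  ((s i)%:E @[i --> F] --> 0%E) <->
  (forall e : R, 0 < e -> \forall i \near F, s i <= e).
Proof.
move=> s0; split=> [/fine_cvgP[_ /cvgrPdist_le h] e e0|h].
  by apply: filterS (h e e0) => i /=; rewrite sub0r normrN ger0_norm.
apply/fine_cvgP; split; first exact: nearW.
apply/cvgrPdist_le => e e0; apply: filterS (h e e0) => i /=.
by rewrite sub0r normrN ger0_norm.
Qed.

Section L2_theory.
Context {R : realType} {disp : measure_display} {T : measurableType disp}.
Variable nu : probability T R.
Implicit Types f g h : T -> R.

Lemma L2_measurable f : L2 nu f -> measurable_fun [set: T] f.
Proof. by rewrite /L2 inE => /andP[/[!inE]]. Qed.

Lemma L2P f : L2 nu f <-> measurable_fun [set: T] f /\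
  (\int[nu]_x ((f x ^+ 2)%:E) < +oo)%E.
Proof.
split=> [Lf|[mf fin]].
  split; first exact: L2_measurable.
  have /integrableP[_] := Lfun2_integrable_sqr Lf.
  apply: le_lt_trans; apply: ge0_le_integral => //=.
  - by move=> x _; rewrite lee_fin sqr_ge0.
  - by apply/measurable_EFinP/measurable_funX; exact: L2_measurable.
  - apply/measurable_EFinP; apply: measurableT_comp => //.
    by apply/measurable_funX; exact: L2_measurable.
  - by move=> x _; rewrite lee_fin ler_norm.
rewrite /L2 inE; apply/andP; split; rewrite inE//=.
rewrite /finite_norm unlock poweR_lty//.
apply: le_lt_trans fin; apply: ge0_le_integral => //=.
- by apply/measurable_EFinP/(measurableT_comp (measurable_powR _)); exact: measurableT_comp.
- by apply/measurable_EFinP/measurable_funX.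
- by move=> x _; rewrite lee_fin powR_mulrn// real_normK// num_real.
Qed.

Lemma L2_integrableM f g : L2 nu f -> L2 nu g ->
  nu.-integrable [set: T] (EFin \o (fun x => f x * g x)).
Proof. by move=> Lf Lg; apply/Lfun1_integrable; exact: Lfun2_mul_Lfun1. Qed.

Lemma L2_cst (c : R) : L2 nu (cst c).
Proof. exact: Lfun_cst. Qed.

Lemma L2_integrable f : L2 nu f -> nu.-integrable [set: T] (EFin \o f).
Proof.
move=> Lf; apply/Lfun1_integrable; apply: Lfun_subset12 Lf.
exact: fin_num_measure.
Qed.

Lemma L2_lin (a : R) f g : L2 nu f -> L2 nu g -> L2 nu (fun x => a * f x + g x).
Proof.
move=> Lf Lg; have h12 : (1 <= 2%:E :> \bar R)%E by rewrite lee1n.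
have [_ cl] := Lfun_submod_closed nu h12.
exact: (cl a f g Lf Lg).
Qed.

Lemma L2D f g : L2 nu f -> L2 nu g -> L2 nu (f \+ g).
Proof.
move=> Lf Lg; rewrite (_ : f \+ g = fun x => 1 * f x + g x); first exact: L2_lin.
by apply/funext => x; rewrite mul1r.
Qed.

Lemma L2N f : L2 nu f -> L2 nu (\- f).
Proof.
move=> Lf; rewrite (_ : \- f = fun x => -1 * f x + cst 0 x).
  by apply: L2_lin => //; exact: L2_cst.
by apply/funext => x /=; rewrite mulN1r addr0.
Qed.

Lemma L2B f g : L2 nu f -> L2 nu g -> L2 nu (f \- g).
Proof. by move=> Lf Lg; exact: L2D (L2N Lg). Qed.

Lemma L2Z (a : R) f : L2 nu f -> L2 nu (fun x => a * f x).
Proof.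
move=> Lf; rewrite (_ : (fun _ => _) = fun x => a * f x + cst 0 x).
  by apply: L2_lin => //; exact: L2_cst.
by apply/funext => x /=; rewrite addr0.
Qed.

Lemma ipC f g : ip nu f g = ip nu g f.
Proof. by apply: eq_Rintegral => x _; rewrite mulrC. Qed.

Lemma ip_lin (a : R) f g h : L2 nu f -> L2 nu g -> L2 nu h ->
  ip nu (fun x => a * f x + g x) h = a * ip nu f h + ip nu g h.
Proof.
move=> Lf Lg Lh; rewrite /ip -RintegralZl ?L2_integrableM// -RintegralD//.
- by apply: eq_Rintegral => x _; rewrite mulrDl mulrA.
- under eq_fun do rewrite mulrA.
  by apply: L2_integrableM => //; exact: L2Z.
- exact: L2_integrableM.
Qed.

Lemma ipDl f g h : L2 nu f -> L2 nu g -> L2 nu h ->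
  ip nu (f \+ g) h = ip nu f h + ip nu g h.
Proof.
move=> Lf Lg Lh; rewrite -[X in _ = X + _]mul1r -ip_lin//.
by congr ip; apply/funext => x; rewrite mul1r.
Qed.

Lemma ipZl (a : R) f h : L2 nu f -> L2 nu h ->
  ip nu (fun x => a * f x) h = a * ip nu f h.
Proof.
move=> Lf Lh; rewrite /ip -RintegralZl ?L2_integrableM//.
by apply: eq_Rintegral => x _; rewrite mulrA.
Qed.

Lemma ipNl f h : L2 nu f -> L2 nu h -> ip nu (\- f) h = - ip nu f h.
Proof.
move=> Lf Lh; rewrite -mulN1r -ipZl//.
by congr ip; apply/funext => x; rewrite mulN1r.
Qed.

Lemma ipBl f g h : L2 nu f -> L2 nu g -> L2 nu h ->
  ip nu (f \- g) h = ip nu f h - ip nu g h.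
Proof. by move=> Lf Lg Lh; rewrite ipDl ?ipNl//; exact: L2N. Qed.

Lemma ipDr f g h : L2 nu f -> L2 nu g -> L2 nu h ->
  ip nu h (f \+ g) = ip nu h f + ip nu h g.
Proof. by move=> *; rewrite !(ipC h) ipDl. Qed.

Lemma ipNr f h : L2 nu f -> L2 nu h -> ip nu h (\- f) = - ip nu h f.
Proof. by move=> *; rewrite !(ipC h) ipNl. Qed.

Lemma ipBr f g h : L2 nu f -> L2 nu g -> L2 nu h ->
  ip nu h (f \- g) = ip nu h f - ip nu h g.
Proof. by move=> *; rewrite !(ipC h) ipBl. Qed.

Lemma ipZr (a : R) f h : L2 nu f -> L2 nu h ->
  ip nu h (fun x => a * f x) = a * ip nu h f.
Proof. by move=> *; rewrite !(ipC h) ipZl. Qed.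

Lemma ip_ge0 f : 0 <= ip nu f f.
Proof. by apply: Rintegral_ge0 => x _; rewrite -expr2 sqr_ge0. Qed.

Lemma ip_cs f g : L2 nu f -> L2 nu g ->
  ip nu f g ^+ 2 <= ip nu g g * ip nu f f.
Proof.
move=> Lf Lg; apply: quad_discr; rewrite ?ip_ge0// => s.
have := ip_ge0 (fun x => s * f x + g x).
have Lsg := L2_lin s Lf Lg.
rewrite ip_lin// !(ipC _ (fun x => s * f x + g x)) !ip_lin// (ipC g f); lra.
Qed.

Lemma ip_cst1 f : ip nu f (cst 1) = \int[nu]_x f x.
Proof. by apply: eq_Rintegral => x _; rewrite mulr1. Qed.

Lemma ip_cstr f c : L2 nu f -> ip nu f (cst c) = c * \int[nu]_x f x.
Proof.
move=> Lf; rewrite -ip_cst1 -ipZr//; last exact: L2_cst.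
by congr ip; apply/funext => x /=; rewrite mulr1.
Qed.

Lemma EFin_ip f g : L2 nu f -> L2 nu g ->
  (ip nu f g)%:E = (\int[nu]_x (f x * g x)%:E)%E.
Proof.
by move=> Lf Lg; rewrite /ip /Rintegral fineK//; apply: integrable_fin_num => //; exact: L2_integrableM.
Qed.

Lemma dist2E f g : L2 nu f -> L2 nu g ->
  dist2 nu f g = (Num.sqrt (ip nu (f \- g) (f \- g)))%:E.
Proof.
move=> Lf Lg; have Lfg := L2B Lf Lg.
rewrite /dist2 unlock -powR12_sqrt ?ip_ge0//.
rewrite -poweR_EFin EFin_ip//; congr (_ `^ _)%E.
apply: eq_integral => x _ /=.
by rewrite powR_mulrn// real_normK ?num_real// expr2.
Qed.

Lemma ip_eq0 f : L2 nu f -> ip nu f f = 0 -> f = cst 0 %[ae nu].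
Proof.
move=> Lf f0; have mf := L2_measurable Lf.
have mf2 : measurable_fun [set: T] (EFin \o (fun x => f x ^+ 2)).
  by apply/measurable_EFinP/measurable_funX.
have [h _] := ae_eq_integral_abs nu measurableT mf2.
have /h : (\int[nu]_x `|(f x ^+ 2)%:E|)%E = 0%E.
  transitivity (ip nu f f)%:E; last by rewrite f0.
  rewrite EFin_ip//; apply: eq_integral => x _ /=.
  by rewrite ger0_norm ?sqr_ge0// expr2.
apply: filterS => x /= /(_ I) [] /eqP; rewrite sqrf_eq0 => /eqP ->.
by [].
Qed.

Lemma ae_ip f g h : L2 nu f -> L2 nu g -> L2 nu h -> f = g %[ae nu] ->
  ip nu f h = ip nu g h.
Proof.
move=> Lf Lg Lh fg; rewrite /ip /Rintegral; congr fine.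
apply: ae_eq_integral => //.
- by apply/measurable_EFinP/measurable_funM; exact: L2_measurable.
- by apply/measurable_EFinP/measurable_funM; exact: L2_measurable.
- by apply: filterS fg => x /= + _ => /(_ I) ->.
Qed.

Lemma ae_ip_eq0 f g : L2 nu f -> L2 nu g -> f = g %[ae nu] ->
  ip nu (f \- g) (f \- g) = 0.
Proof.
move=> Lf Lg fg; have Lfg := L2B Lf Lg.
rewrite ipBl//; apply/eqP; rewrite subr_eq0; apply/eqP.
exact: ae_ip.
Qed.

Lemma ip_sub_eq0 f g h : L2 nu f -> L2 nu g -> L2 nu h ->
  ip nu (f \- g) (f \- g) = 0 -> ip nu f h = ip nu g h.
Proof.
move=> Lf Lg Lh h0; have := ip_cs (L2B Lf Lg) Lh.
rewrite h0 mulr0 => hs; apply/eqP; rewrite -subr_eq0 -ipBl// -sqrf_eq0.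
by rewrite eq_le hs sqr_ge0.
Qed.

Lemma ip_sub_ae f g : L2 nu f -> L2 nu g ->
  ip nu (f \- g) (f \- g) = 0 -> f = g %[ae nu].
Proof.
move=> Lf Lg /(ip_eq0 (L2B Lf Lg)); apply: filterS => x /= h _.
by apply/eqP; rewrite -subr_eq0 h.
Qed.

Lemma cvgL2P (u : nat -> T -> R) f : (forall n, L2 nu (u n)) -> L2 nu f ->
  cvgL2 nu u f <-> (forall e : R, 0 < e -> exists n0, forall n, (n0 <= n)%N ->
    Num.sqrt (ip nu (u n \- f) (u n \- f)) <= e).
Proof.
move=> Lu Lf; rewrite /cvgL2.
under eq_fun do rewrite dist2E//.
rewrite cvg_EFin0P => [|n]; last exact: sqrtr_ge0.
split=> h e e0; have := h e e0; first by move=> [n0 _ hn]; exists n0.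
by move=> [n0 hn]; exists n0.
Qed.

End L2_theory.

(** * Markov kernels acting on square-integrable functions *)

Section kernels.
Context {R : realType} {disp : measure_display} {T : measurableType disp}.
Implicit Types (k l : R.-pker T ~> T) (f g : T -> R).

(* [k x] as a probability measure. *)
Definition klaw k (x : T) : set T -> \bar R := k x.

HB.instance Definition _ k x := isMeasure.Build _ _ _ (klaw k x)
  (measure0 (k x)) (measure_ge0 (k x)) (@measure_semi_sigma_additive _ _ _ (k x)).

HB.instance Definition _ k x := Measure_isProbability.Build _ _ _ (klaw k x)
  (@prob_kernel _ _ _ _ _ k x).

Lemma integral_klaw k x (D : set T) (f : T -> \bar R) :
  (\int[klaw k x]_(y in D) f y = \int[k x]_(y in D) f y)%E.
Proof. exact: eq_measure_integral. Qed.

Lemma kernel_actE k f x : kernel_act k f x = \int[klaw k x]_y f y.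
Proof. by rewrite /kernel_act /Rintegral integral_klaw. Qed.

(** One statement for two situations: [m] is the law of a composed kernel, or it is an invariant
    law, [l] then being the constant kernel. *)
Lemma integral_kernel_mixture l k x (m : {measure set T -> \bar R})
    (f : T -> \bar R) :
  (forall B, measurable B -> m B = \int[l x]_y k y B)%E ->
  (forall y, 0 <= f y)%E -> measurable_fun [set: T] f ->
  (\int[m]_y f y = \int[l x]_y \int[k y]_z f z)%E.
Proof.
move=> h f0 mf.
rewrite -(@integral_kcomp _ _ _ T T T R l (kernel.kernel_snd k) x f f0 mf).
by apply: eq_measure_integral => B mB _; exact: h.
Qed.

Lemma measurable_kernel_act k f : measurable_fun [set: T] f ->
  measurable_fun [set: T] (kernel_act k f).
Proof.
move=> mf; rewrite /kernel_act /Rintegral.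
apply: (measurableT_comp (fine_measurable measurableT)).
under eq_fun do rewrite integralE.
apply: emeasurable_funB; apply: measurable_fun_integral_kernel => //.
- exact: measurable_kernel.
- by apply: measurable_funepos; exact/measurable_EFinP.
- exact: measurable_kernel.
- by apply: measurable_funeneg; exact/measurable_EFinP.
Qed.

(** Tonelli's theorem for the positive and the negative part. The inner integrals may be infinite at
    some points, where [kernel_act] takes a default value; integrability confines these points to a
    null set. *)
Lemma Rintegral_kernel_mixture l k x (m : {measure set T -> \bar R}) f :
  (forall B, measurable B -> m B = \int[l x]_y k y B)%E ->
  m.-integrable [set: T] (EFin \o f) ->
  \int[m]_y f y = \int[l x]_y kernel_act k f y.
Proof.
move=> h fi; have mf : measurable_fun [set: T] (EFin \o f) by exact: measurable_int fi.
have mfp := measurable_funepos mf; have mfn := measurable_funeneg mf.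
pose A y := (\int[k y]_z (EFin \o f)^\+ z)%E.
pose B y := (\int[k y]_z (EFin \o f)^\- z)%E.
have A0 y : (0 <= A y)%E by exact: integral_ge0.
have B0 y : (0 <= B y)%E by exact: integral_ge0.
have mA : measurable_fun [set: T] A.
  by apply: measurable_fun_integral_kernel => //; exact: measurable_kernel.
have mB : measurable_fun [set: T] B.
  by apply: measurable_fun_integral_kernel => //; exact: measurable_kernel.
have iA : (\int[m]_y (EFin \o f)^\+ y = \int[l x]_y A y)%E.
  exact: integral_kernel_mixture.
have iB : (\int[m]_y (EFin \o f)^\- y = \int[l x]_y B y)%E.
  exact: integral_kernel_mixture.
have Ai : (l x).-integrable [set: T] A.
  apply/integrableP; split=> //; under eq_integral do rewrite gee0_abs//.
  rewrite -iA; have /integrableP[_] := integrable_funepos measurableT fi.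
  by under eq_integral do rewrite gee0_abs//.
have Bi : (l x).-integrable [set: T] B.
  apply/integrableP; split=> //; under eq_integral do rewrite gee0_abs//.
  rewrite -iB; have /integrableP[_] := integrable_funeneg measurableT fi.
  by under eq_integral do rewrite gee0_abs//.
rewrite /Rintegral; congr fine.
rewrite [LHS]integralE iA iB -integralB//.
apply: ae_eq_integral => //.
- exact: emeasurable_funB.
- apply/measurable_EFinP/measurable_kernel_act; exact/measurable_EFinP.
- have := integrable_ae measurableT Bi; have := integrable_ae measurableT Ai.
  apply: filterS2 => y /(_ I) Ay /(_ I) By _ /=.
  by rewrite /kernel_act /Rintegral integralE fineK// fin_numB Ay.
Qed.

(** Jensen's inequality for the square, obtained as Cauchy-Schwarz against the constant 1 under the
    law [k x]. *)
Lemma kernel_act_sqr k f x : measurable_fun [set: T] f ->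
  ((kernel_act k f x ^+ 2)%:E <= \int[k x]_y (f y ^+ 2)%:E)%E.
Proof.
move=> mf; rewrite -integral_klaw.
have [fin|] := ltP (\int[klaw k x]_y (f y ^+ 2)%:E)%E +oo%E; last first.
  by rewrite leye_eq => /eqP ->; rewrite leey.
have Lf : L2 (klaw k x) f by apply/L2P.
rewrite kernel_actE -ip_cst1.
have := ip_cs Lf (L2_cst (klaw k x) 1).
have -> : ip (klaw k x) (cst 1) (cst 1) = 1.
  rewrite ip_cst1 /= Rintegral_cst// mul1r.
  by have /= -> := @probability_setT _ _ _ (klaw k x).
rewrite mul1r -lee_fin => h; apply: (le_trans h).
by rewrite EFin_ip.
Qed.

Section invariant.
Variable nu : probability T R.

Definition kernel_inv k : Prop :=
  forall B, measurable B -> (\int[nu]_x k x B = nu B)%E.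

(** Presents [nu] as a kernel, so that invariance becomes a case of kernel composition; the starting
    point is then arbitrary. *)
Let cst_kernel : R.-pker T ~> T :=
  kprobability (@measurable_cst _ _ T (pprobability T R) setT nu).

Lemma integral_kernel_inv k (f : T -> \bar R) : kernel_inv k ->
  (forall y, 0 <= f y)%E -> measurable_fun [set: T] f ->
  (\int[nu]_y f y = \int[nu]_y \int[k y]_z f z)%E.
Proof.
move=> kinv f0 mf.
apply: (@integral_kernel_mixture cst_kernel k point nu) => // B mB.
exact/esym/kinv.
Qed.

Lemma mean_kernel_act k f : kernel_inv k -> L2 nu f ->
  \int[nu]_y kernel_act k f y = \int[nu]_y f y.
Proof.
move=> kinv Lf; apply/esym.
apply: (@Rintegral_kernel_mixture cst_kernel k point nu); last exact: L2_integrable.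
by move=> B mB; exact/esym/kinv.
Qed.

Lemma L2_kernel_act k f : kernel_inv k -> L2 nu f -> L2 nu (kernel_act k f).
Proof.
move=> kinv /L2P[mf fin]; have mk := measurable_kernel_act k mf.
apply/L2P; split => //.
apply: le_lt_trans fin; rewrite (@integral_kernel_inv k (fun y => (f y ^+ 2)%:E))//.
- apply: ge0_le_integral => //.
  + by move=> y _; rewrite lee_fin sqr_ge0.
  + by apply/measurable_EFinP/measurable_funX.
  + apply: measurable_fun_integral_kernel => //; first exact: measurable_kernel.
      by move=> y; rewrite lee_fin sqr_ge0.
    by apply/measurable_EFinP/measurable_funX.
  + by move=> y _; exact: kernel_act_sqr.
- by move=> y; rewrite lee_fin sqr_ge0.
- by apply/measurable_EFinP/measurable_funX.
Qed.

Lemma kernel_act_contr k f : kernel_inv k -> L2 nu f ->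
  ip nu (kernel_act k f) (kernel_act k f) <= ip nu f f.
Proof.
move=> kinv Lf; have mf := L2_measurable Lf.
have mk := measurable_kernel_act k mf; have Lk := L2_kernel_act kinv Lf.
rewrite -lee_fin !EFin_ip//; under eq_integral do rewrite -expr2.
under [leRHS]eq_integral do rewrite -expr2.
rewrite (@integral_kernel_inv k (fun y => (f y ^+ 2)%:E))//.
- apply: ge0_le_integral => //.
  + by move=> y _; rewrite lee_fin sqr_ge0.
  + by apply/measurable_EFinP/measurable_funX.
  + apply: measurable_fun_integral_kernel => //; first exact: measurable_kernel.
      by move=> y; rewrite lee_fin sqr_ge0.
    by apply/measurable_EFinP/measurable_funX.
  + by move=> y _; exact: kernel_act_sqr.
- by move=> y; rewrite lee_fin sqr_ge0.
- by apply/measurable_EFinP/measurable_funX.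
Qed.

(** By invariance the function x -> (integral of f^2 under [k x]) has a finite integral, hence is
    finite off a null set. This justifies linearity and composition of [kernel_act] almost
    everywhere. *)
Lemma L2_ae_klaw k f : kernel_inv k -> L2 nu f ->
  \forall x \ae nu, L2 (klaw k x) f.
Proof.
move=> kinv /L2P[mf fin].
have m2 : measurable_fun [set: T] (EFin \o (fun y => f y ^+ 2)).
  by apply/measurable_EFinP/measurable_funX.
have f20 y : (0 <= (f y ^+ 2)%:E)%E by rewrite lee_fin sqr_ge0.
have : nu.-integrable [set: T] (fun x => \int[k x]_y (f y ^+ 2)%:E)%E.
  apply/integrableP; split.
    by apply: measurable_fun_integral_kernel => //; exact: measurable_kernel.
  under eq_integral do rewrite gee0_abs ?integral_ge0//.
  by rewrite -(integral_kernel_inv kinv f20 m2).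
move/(integrable_ae measurableT); apply: filterS => x /(_ I).
rewrite ge0_fin_numE ?integral_ge0// => h.
by apply/L2P; rewrite integral_klaw.
Qed.

Lemma kernel_act_lin k (a : R) f g : kernel_inv k -> L2 nu f -> L2 nu g ->
  kernel_act k (fun x => a * f x + g x)
    = (fun x => a * kernel_act k f x + kernel_act k g x) %[ae nu].
Proof.
move=> kinv Lf Lg; have := L2_ae_klaw kinv Lg; have := L2_ae_klaw kinv Lf.
apply: filterS2 => x Lfx Lgx _; rewrite !kernel_actE -!ip_cst1 ip_lin//.
exact: L2_cst.
Qed.

Lemma kernel_act_comp l k (m : R.-pker T ~> T) f :
  (forall x B, measurable B -> m x B = kcomp_noparam l k x B) ->
  kernel_inv m -> L2 nu f ->
  kernel_act m f = kernel_act l (kernel_act k f) %[ae nu].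
Proof.
move=> h minv Lf; have := L2_ae_klaw minv Lf.
apply: filterS => x Lfx _; apply: Rintegral_kernel_mixture.
  by move=> B mB; rewrite h.
have /integrableP[mf fi] := L2_integrable Lfx.
by apply/integrableP; split => //; rewrite -integral_klaw.
Qed.

End invariant.
End kernels.

(** * Poisson equations for generators and self-adjoint operators *)

Section mean_zero_space.
Context {R : realType} {disp : measure_display} {T : measurableType disp}.
Variable nu : probability T R.

Lemma mean_cst (c : R) : \int[nu]_x c = c.
Proof.
rewrite Rintegral_cst// -[RHS](mulr1 c); congr (_ * _).
exact: (congr1 fine (@probability_setT _ _ _ nu)).
Qed.

Definition mean0_pred : {pred T -> R} := [pred f | `[< mean0 nu f >]].

Lemma mean0_lin (a : R) f g : mean0 nu f -> mean0 nu g ->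
  mean0 nu (fun x => a * f x + g x).
Proof.
move=> [Lf f0] [Lg g0]; split; first exact: L2_lin.
rewrite -ip_cst1 ip_lin ?ip_cst1 ?f0 ?g0 ?mulr0 ?addr0//; exact: L2_cst.
Qed.

Lemma mean0_cst0 : mean0 nu (cst 0).
Proof.
by split; [exact: L2_cst|rewrite /= mean_cst].
Qed.

Lemma mean0_submod_closed : submod_closed mean0_pred.
Proof.
split; first by apply/asboolP; exact: mean0_cst0.
by move=> a f g /asboolP f0 /asboolP g0; apply/asboolP; exact: mean0_lin.
Qed.

HB.instance Definition _ :=
  GRing.isSubmodClosed.Build R (T -> R) mean0_pred mean0_submod_closed.

(** Mean-zero functions as an [lmodType], to which the abstract results apply; on this space the
    spectral gap is a coercivity bound. No quotient by null sets is taken. *)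
Record L2_0 := MkL20 { L20_fun :> T -> R ; L20P : L20_fun \in mean0_pred }.

HB.instance Definition _ := [isSub for L20_fun].
HB.instance Definition _ := [Choice of L2_0 by <:].
HB.instance Definition _ := [SubChoice_isSubLmodule of L2_0 by <:].

Definition mkL20 f (f0 : mean0 nu f) : L2_0 := MkL20 (asboolT f0).

Lemma L20_mean0 (u : L2_0) : mean0 nu u.
Proof. by have /asboolP := L20P u. Qed.

Lemma L20_L2 (u : L2_0) : L2 nu u. Proof. by have [] := L20_mean0 u. Qed.

Definition ip0 (u v : L2_0) : R := ip nu u v.

Lemma ip0_bilinear : bilinear_sym ip0.
Proof.
by split=> [a u v w|u v]; [exact: ip_lin (L20_L2 _) (L20_L2 _) (L20_L2 _)|exact: ipC].
Qed.

Lemma ip0_ge0 u : 0 <= ip0 u u. Proof. exact: ip_ge0. Qed.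

Definition energy_cauchy (u u' : nat -> T -> R) : Prop :=
  forall e : R, 0 < e -> exists n0, forall m n, (n0 <= m)%N -> (n0 <= n)%N ->
    - ip nu (u m \- u n) (u' m \- u' n) + ip nu (u m \- u n) (u m \- u n) < e.

Definition op_energy_complete (A : operator R T) : Prop :=
  forall u u' : nat -> T -> R, (forall n, A (u n) (u' n)) ->
    (forall n, mean0 nu (u n)) ->
    energy_cauchy u u' -> exists2 v, L2 nu v & cvgL2 nu u v.

Lemma cvgL2_mean0 (u : nat -> T -> R) v : (forall n, mean0 nu (u n)) ->
  L2 nu v -> cvgL2 nu u v -> mean0 nu v.
Proof.
move=> u0 Lv /cvgL2P h; split => //; apply/eqP; rewrite -normr_le0.
have {}h := h (fun n => (u0 n).1) Lv.
apply/ler_addgt0Pr => e e0; rewrite add0r.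
have [n0 /(_ n0 (leqnn _)) hn] := h e e0; have [Lu u0'] := u0 n0.
have := ip_cs (L2B Lu Lv) (L2_cst nu 1).
have -> : ip nu (cst 1) (cst 1) = 1.
  by rewrite ip_cst1 /= mean_cst.
rewrite mul1r ip_cst1.
have -> : \int[nu]_x (u n0 \- v) x = - \int[nu]_x v x.
  by rewrite RintegralB//; [rewrite u0' sub0r|exact: L2_integrable|exact: L2_integrable].
rewrite sqrrN => h1; rewrite -sqrtr_sqr (le_trans _ hn)//.
by rewrite ler_wsqrtr.
Qed.

Lemma op_energy_complete0 (A : operator R T) :
  op_energy_complete A ->
  energy_complete (B := ip0) (fun u v => A (u : T -> R) (v : T -> R)).
Proof.
move=> Ac u u' Au ca.
have [v Lv uv] := Ac (fun n => u n) (fun n => u' n) Au (fun n => L20_mean0 (u n)) ca.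
exists (mkL20 (cvgL2_mean0 (fun n => L20_mean0 (u n)) Lv uv)) => e e0.
by have /cvgL2P := uv; apply => // n; exact: L20_L2.
Qed.

End mean_zero_space.

Section selfadjoint.
Context {R : realType} {disp : measure_display} {T : measurableType disp}.
Variables (nu : probability T R) (A : operator R T).
Hypothesis Asa : self_adjoint nu A.

Lemma sa_L2 f g : A f g -> L2 nu f /\ L2 nu g.
Proof. by move=> /Asa.2[]. Qed.

Lemma sa_sym f g u v : A f g -> A u v -> ip nu f v = ip nu g u.
Proof. by move=> /Asa.2[_ _ h] /h. Qed.

Lemma sa_lin (a : R) f f' g g' : A f f' -> A g g' ->
  A (fun x => a * f x + g x) (fun x => a * f' x + g' x).
Proof.
move=> Af Ag; have [Lf Lf'] := sa_L2 Af; have [Lg Lg'] := sa_L2 Ag.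
apply/Asa.2; split; try exact: L2_lin.
move=> u v Auv; have [Lu Lv] := sa_L2 Auv.
by rewrite !ip_lin// (sa_sym Af Auv) (sa_sym Ag Auv).
Qed.

Lemma sa_sub f f' g g' : A f f' -> A g g' -> A (f \- g) (f' \- g').
Proof.
move=> Af Ag; have := sa_lin (-1) Ag Af.
have E (h k : T -> R) : (fun x => -1 * h x + k x) = k \- h.
  by apply/funext => x; rewrite mulN1r addrC.
by rewrite !E.
Qed.

Context {lam : R}.
Hypothesis lam0 : 0 < lam.
Hypothesis gap : forall f g, A f g -> \int[nu]_x f x = 0 ->
  lam * ip nu f f <= - ip nu f g.
Hypothesis A1 : A (cst 1) (cst 0).
Hypothesis Acomplete : op_energy_complete nu A.

Lemma sa_mean0 f g : A f g -> mean0 nu g.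
Proof.
move=> Afg; have [Lf Lg] := sa_L2 Afg; split => //.
have := sa_sym A1 Afg; rewrite ipC ip_cst1 => ->.
by rewrite ipC ip_cstr// mul0r.
Qed.

Lemma sa_center f g : A f g -> A (f \- cst (\int[nu]_x f x)) g.
Proof.
move=> Afg; set c := \int[nu]_x f x.
have := sa_lin (- c) A1 Afg.
rewrite (_ : (fun x => _ * cst 1 x + _) = f \- cst c); last first.
  by apply/funext => x /=; rewrite mulr1 addrC.
rewrite (_ : (fun x => _ * cst 0 x + _) = g)//.
by apply/funext => x /=; rewrite mulr0 add0r.
Qed.

Lemma center_mean0 f : L2 nu f -> mean0 nu (f \- cst (\int[nu]_x f x)).
Proof.
move=> Lf; split; first by apply: L2B => //; exact: L2_cst.
rewrite RintegralB//; try by apply: L2_integrable => //; exact: L2_cst.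
by rewrite mean_cst subrr.
Qed.

(** The weak equation is known for mean-zero test functions. It extends to the whole domain by
    centering, because [A] annihilates constants and [f] has mean zero; by self-adjointness it then
    says that [v] is in the domain with value [- f]. *)
Lemma sa_poisson f : mean0 nu f -> exists g, poisson nu A f g.
Proof.
move=> f0; pose A' (u v : L2_0 nu) := A u v.
have [||||v hv] := @symmetric_poisson R (L2_0 nu) (@ip0 _ _ _ nu)
  (ip0_bilinear nu) (ip0_ge0 (nu := nu)) lam lam0 A' _ _ _ _
  (op_energy_complete0 Acomplete) (mkL20 f0).
- have := sa_lin (-1) A1 A1.
  rewrite /A' /= (_ : (fun x => _ * cst 1 x + _) = cst 0); last first.
    by apply/funext => x /=; rewrite mulr1 addNr.
  rewrite (_ : (fun x => _ * cst 0 x + _) = cst 0)//.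
  by apply/funext => x /=; rewrite mulr0 addr0.
- by move=> a u u' w w'; exact: sa_lin.
- by move=> u u' w w'; exact: sa_sym.
- by move=> u u' Au; apply: gap => //; have [] := L20_mean0 u.
exists v; split; first exact: L20_mean0.
have Lf := f0.1; have Lv := L20_L2 v.
apply/Asa.2; split => //; first exact: L2N.
move=> u w Auw; have [Lu Lw] := sa_L2 Auw.
have u0 := center_mean0 Lu; have w0 := sa_mean0 Auw.
have := hv (mkL20 u0) (mkL20 w0) (sa_center Auw).
rewrite /ip0 /= => ->; rewrite ipNl// ipBr//; last exact: L2_cst.
by rewrite (ip_cstr _ Lf) f0.2 mulr0 subr0.
Qed.

Lemma sa_poisson_unique f g g' : poisson nu A f g -> poisson nu A f g' ->
  g = g' %[ae nu].
Proof.
move=> [[Lg g0] Ag] [[Lg' g0'] Ag'].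
apply: ip_sub_ae => //.
have := gap (sa_sub Ag Ag').
rewrite RintegralB ?g0 ?g0' ?subrr//; try exact: L2_integrable.
move=> /(_ erefl); rewrite (_ : (\- f) \- (\- f) = cst 0); last first.
  by apply/funext => x /=; rewrite subrr.
rewrite ip_cstr ?mul0r ?oppr0; last exact: L2B.
rewrite pmulr_rle0// => h; apply/eqP; rewrite eq_le h; exact: ip_ge0.
Qed.

End selfadjoint.

(** [asvar] evaluates a chosen solution; as solutions agree up to null sets, any of them gives the
    same value. *)
Lemma asvar_eq (R : realType) (disp : measure_display) (T : measurableType disp)
    (nu : probability T R) (A : operator R T) f g :
  L2 nu f -> asvar_defined nu A f -> poisson nu A f g -> asvar nu A f = 2 * ip nu f g.
Proof.
move=> Lf [ex un] pg; rewrite /asvar.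
have px : poisson nu A f (xget (cst 0) [set g | poisson nu A f g]).
  by case: xgetP => [y _ //|h]; have [y /h] := ex.
congr (2 * _); rewrite ipC [RHS]ipC; apply: ae_ip => //.
- by have [[]] := px.
- by have [[]] := pg.
- exact: un.
Qed.

Lemma near_right0P (R : realType) (Q : R -> Prop) :
  (\forall t \near 0^'+, Q t) <->
  (exists2 dl : R, 0 < dl & forall t, 0 < t < dl -> Q t).
Proof.
split.
  move=> [e /= e0 h]; exists e => // t /andP[t0 te]; apply: h => //=.
  by rewrite sub0r normrN gtr0_norm.
move=> [dl dl0 h]; exists dl => // t /=; rewrite sub0r normrN => h1 t0.
by apply: h; rewrite t0 (le_lt_trans (ler_norm _)).
Qed.

Lemma cvg_right0P (R : realType) (phi : R -> \bar R) (s : R -> R) :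
  (forall t, 0 < t -> phi t = (s t)%:E) -> (forall t, 0 <= s t) ->
  (phi t @[t --> 0^'+] --> 0%E) <-> (forall e : R, 0 < e ->
    exists2 dl, 0 < dl & forall t, 0 < t < dl -> s t <= e).
Proof.
move=> phiE s0.
have E : (phi t @[t --> 0^'+] --> 0%E) <-> ((s t)%:E @[t --> 0^'+] --> 0%E).
  split; apply: cvg_trans; apply: near_eq_cvg.
    by apply/near_right0P; exists 1 => // t /andP[/phiE ->].
  by apply/near_right0P; exists 1 => // t /andP[/phiE ->].
rewrite E cvg_EFin0P//; split=> h e e0; first by apply/near_right0P; exact: h.
by apply/near_right0P; exact: h.
Qed.

Section generator.
Context {R : realType} {disp : measure_display} {T : measurableType disp}.
Variables (nu : probability T R) (P : R -> R.-pker T ~> T) (L : operator R T).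
Hypothesis Pinv : forall t, 0 <= t -> kernel_inv nu (P t).
Hypothesis PL : generator_of nu P L.
Local Notation nrm f := (Num.sqrt (ip nu f f)).

Lemma generator_L2 f g : L f g -> L2 nu f /\ L2 nu g.
Proof. by move=> /PL[]. Qed.

Lemma L2_increment f g t : 0 <= t -> L2 nu f -> L2 nu g ->
  L2 nu (fun x => kernel_act (P t) f x - f x - t * g x).
Proof.
move=> t0 Lf Lg; apply: L2B; last exact: L2Z.
by apply: L2B => //; exact: L2_kernel_act (Pinv t0) Lf.
Qed.

Lemma nrmZ (a : R) f : L2 nu f -> nrm (fun x => a * f x) = `|a| * nrm f.
Proof.
move=> Lf; rewrite ipZl ?ipZr//; last exact: L2Z.
by rewrite mulrA -expr2 sqrtrM ?sqr_ge0// sqrtr_sqr.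
Qed.

Lemma generatorP f g : L f g <-> [/\ L2 nu f, L2 nu g &
  forall e : R, 0 < e -> exists2 dl, 0 < dl & forall t, 0 < t < dl ->
    nrm (fun x => kernel_act (P t) f x - f x - t * g x) <= e * t].
Proof.
suff E : L2 nu f -> L2 nu g ->
    (dist2 nu (fun x => t^-1 * (kernel_act (P t) f x - f x)) g
        @[t --> 0^'+] --> 0%E) <->
    forall e : R, 0 < e -> exists2 dl, 0 < dl & forall t, 0 < t < dl ->
    nrm (fun x => kernel_act (P t) f x - f x - t * g x) <= e * t.
  by split=> [/PL[Lf Lg /(E Lf Lg)]|[Lf Lg /(E Lf Lg) h]] //; apply/PL.
move=> Lf Lg; pose s t := `|t^-1| * nrm (fun x => kernel_act (P t) f x - f x - t * g x).
rewrite (@cvg_right0P _ _ s) => [|t t0|t]; last by rewrite mulr_ge0 ?sqrtr_ge0.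
  have sE e t : 0 < t -> (s t <= e)
      = (nrm (fun x => kernel_act (P t) f x - f x - t * g x) <= e * t).
    by move=> t0; rewrite /s gtr0_norm ?invr_gt0// [t^-1 * _]mulrC ler_pdivrMr.
  by split=> h e e0; have [dl dl0 hd] := h e e0; exists dl => // t
    /[dup] /andP[t0 _] /hd; rewrite sE.
have Lt := L2_kernel_act (Pinv (ltW t0)) Lf.
rewrite dist2E//; last by apply: L2Z; exact: L2B.
congr EFin; rewrite /s -nrmZ; last exact: L2_increment (ltW t0) Lf Lg.
rewrite (_ : _ \- g
  = fun x => t^-1 * (kernel_act (P t) f x - f x - t * g x))//.
apply/funext => x /=; by rewrite [RHS]mulrBr mulrA mulVf ?mul1r// gt_eqF.
Qed.

(** Invariance makes P_t f - f mean-free, so t |integral of g| is at most the norm of the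
    first-order remainder, which is o(t). *)
Lemma generator_mean f g : L f g -> \int[nu]_x g x = 0.
Proof.
move=> /generatorP[Lf Lg h]; apply/eqP; rewrite -normr_le0.
apply/ler_addgt0Pr => e e0; rewrite add0r.
have [dl dl0 hd] := h e e0.
pose t := dl / 2; have t0 : 0 < t by rewrite divr_gt0.
have tdl : 0 < t < dl by rewrite t0 ltr_pdivrMr// ltr_pMr// ltr1n.
have {hd} := hd t tdl; set r := (fun x => _) => hr.
have Lr : L2 nu r by exact: L2_increment (ltW t0) Lf Lg.
have Lk := L2_kernel_act (Pinv (ltW t0)) Lf.
have rE : \int[nu]_x r x = - (t * \int[nu]_x g x).
  have Lk' := L2B Lk Lf; have Lt := L2Z t Lg.
  rewrite /r RintegralB//; [|exact: L2_integrable Lk'|exact: L2_integrable Lt].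
  rewrite RintegralB//; [|exact: L2_integrable Lk|exact: L2_integrable Lf].
  rewrite (mean_kernel_act (Pinv (ltW t0)) Lf) subrr sub0r RintegralZl//.
  exact: L2_integrable.
have := ip_cs Lr (L2_cst nu 1); rewrite !ip_cst1 rE mean_cst mul1r sqrrN => h1.
have h2 : `|t * \int[nu]_x g x| <= nrm r by rewrite -sqrtr_sqr ler_wsqrtr.
rewrite -(ler_pM2l t0) [t * e]mulrC (le_trans _ hr)// (le_trans _ h2)//.
by rewrite normrM gtr0_norm.
Qed.

Lemma kernel_act_cst t (c : R) : kernel_act (P t) (cst c) = cst c.
Proof. by apply/funext => x; rewrite kernel_actE /= mean_cst. Qed.

Lemma ae_nrm f g : L2 nu f -> L2 nu g -> f = g %[ae nu] -> nrm f = nrm g.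
Proof.
move=> Lf Lg fg; congr Num.sqrt; rewrite (ae_ip Lf Lg Lf fg) ipC.
exact: ae_ip.
Qed.

Lemma generator_center f g c : L f g -> L (f \- cst c) g.
Proof.
move=> /generatorP[Lf Lg h]; have Lc := L2_cst nu c; have Lfc := L2B Lf Lc.
apply/generatorP; split=> // e e0; have [dl dl0 hd] := h e e0.
exists dl => // t /[dup] /andP[t0 _] /hd; apply: le_trans.
have kinv := Pinv (ltW t0); rewrite le_eqVlt; apply/orP; left; apply/eqP.
apply: ae_nrm; [exact: L2_increment (ltW t0) _ _|exact: L2_increment (ltW t0) _ _|].
have := kernel_act_lin (-1) kinv Lc Lf; apply: filterS => x /(_ I) + _.
rewrite (_ : (fun x => _ * cst c x + _) = f \- cst c); last first.
  by apply/funext => y /=; rewrite mulN1r addrC.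
move=> ->; rewrite kernel_act_cst /=; ring.
Qed.

Hypothesis Pm : markov_semigroup P.
Hypothesis Pc : strongly_continuous nu P.
Context {lam : R}.
Hypothesis lam0 : 0 < lam.
Hypothesis gap : forall f g, L f g -> \int[nu]_x f x = 0 ->
  lam * ip nu f f <= - ip nu f g.
Hypothesis Lcomplete : op_energy_complete nu L.
Hypothesis Ldense : forall f, L2 nu f -> forall e : R, 0 < e ->
  exists g g', L g g' /\ nrm (f \- g) <= e.

Lemma ip_shift f (c : R) : L2 nu f -> \int[nu]_x f x = - c ->
  ip nu (f \+ cst c) (f \+ cst c) = ip nu f f - c ^+ 2.
Proof.
move=> Lf fc; have Lc := L2_cst nu c.
rewrite ipDl//; last exact: L2D.
rewrite !ipDr// (ipC nu (cst c) f) !ip_cstr//= mean_cst fc; ring.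
Qed.

Lemma mean0_kernel_act t (u : L2_0 nu) : 0 <= t -> mean0 nu (kernel_act (P t) u).
Proof.
move=> t0; have Lu := L20_L2 u; split; first exact: L2_kernel_act (Pinv t0) Lu.
by rewrite (mean_kernel_act (Pinv t0) Lu); have [] := L20_mean0 u.
Qed.

Definition act0 (t : R) (u : L2_0 nu) : L2_0 nu :=
  match pselect (0 <= t) with
  | left t0 => mkL20 (mean0_kernel_act u t0)
  | right _ => u
  end.

Lemma act0E t u : 0 <= t -> act0 t u = kernel_act (P t) u :> (T -> R).
Proof. by rewrite /act0; case: pselect. Qed.

Let N (u : L2_0 nu) : R := semin (B := @ip0 _ _ _ nu) u.

Lemma act0_lin t a u v : 0 <= t ->
  N (act0 t (a *: u + v) - (a *: act0 t u + act0 t v)) = 0.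
Proof.
move=> t0; have kinv := Pinv t0; have Lu := L20_L2 u; have Lv := L20_L2 v.
rewrite /N /semin /ip0 /= !act0E//=.
rewrite (ae_ip_eq0 _ _ (kernel_act_lin a kinv Lu Lv)) ?sqrtr0//.
  by apply: L2_kernel_act kinv _; exact: L2_lin.
by apply: L2_lin; exact: L2_kernel_act kinv _.
Qed.

Lemma act0_contr t u : 0 <= t -> N (act0 t u) <= N u.
Proof.
move=> t0; rewrite /N /semin /ip0 act0E//; apply: ler_wsqrtr.
exact: kernel_act_contr (Pinv t0) (L20_L2 u).
Qed.

Let BP := ip0_bilinear nu.
Let B0 := ip0_ge0 (nu := nu).

Lemma act0_nonexp t u v : 0 <= t -> N (act0 t u - act0 t v) <= N (u - v).
Proof.
move=> t0; apply: le_trans (act0_contr (u - v) t0).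
have h := act0_lin (-1) v u t0.
rewrite (_ : -1 *: v + u = u - v) in h; last by rewrite scaleN1r addrC.
rewrite (_ : -1 *: act0 t v + act0 t u = act0 t u - act0 t v) in h; last first.
  by rewrite scaleN1r addrC.
by rewrite /N (semin_eq BP B0 h).
Qed.

Lemma act0_zero u : N (act0 0 u - u) = 0.
Proof.
rewrite /N /semin /ip0 /= act0E//.
rewrite (_ : kernel_act (P 0) u = u); last first.
  apply/funext => x; rewrite /kernel_act /Rintegral.
  rewrite (@eq_measure_integral _ _ _ _ (\d_x)) => [|B mB _]; last exact: Pm.1.
  rewrite integral_dirac//; first by rewrite diracT mul1e.
  by apply/measurable_EFinP/(L2_measurable (L20_L2 u)).
rewrite (_ : ip _ _ _ = 0) ?sqrtr0//.
by apply: ae_ip_eq0; [exact: L20_L2|exact: L20_L2|exact: nearW].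
Qed.

Lemma act0_add s t u : 0 <= s -> 0 <= t ->
  N (act0 (s + t) u - act0 s (act0 t u)) = 0.
Proof.
move=> s0 t0; have st0 := addr_ge0 s0 t0; have Lu := L20_L2 u.
rewrite /N /semin /ip0 /= !act0E//.
rewrite (_ : ip _ _ _ = 0) ?sqrtr0//; apply: ae_ip_eq0.
- exact: L2_kernel_act (Pinv st0) Lu.
- by apply: L2_kernel_act (Pinv s0) _; exact: L2_kernel_act (Pinv t0) Lu.
- apply: kernel_act_comp => //; last exact: Pinv.
  by move=> x B mB; exact: Pm.2.
Qed.

Lemma act0_generates u v : generates (B := @ip0 _ _ _ nu) (P := act0) u v <-> L u v.
Proof.
have E t : 0 <= t -> (act0 t u - u - t *: v : L2_0 nu)
    = (fun x => kernel_act (P t) u x - u x - t * v x) :> (T -> R).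
  by move=> t0; rewrite /= act0E.
split=> [h|/generatorP[Lu Lv h] e e0].
  apply/generatorP; split; [exact: L20_L2|exact: L20_L2|] => e e0.
  have [dl dl0 hd] := h e e0; exists dl => // t /[dup] /andP[t0 _] /hd.
  by rewrite /semin /ip0 E// ltW.
have [dl dl0 hd] := h e e0; exists dl => // t /[dup] /andP[t0 _] /hd.
by rewrite /semin /ip0 E// ltW.
Qed.

Lemma generator_poisson f : mean0 nu f -> exists g, poisson nu L f g.
Proof.
move=> f0.
have cont (u : L2_0 nu) e : 0 < e ->
    exists2 dl, 0 < dl & forall t, 0 < t < dl -> N (act0 t u - u) <= e.
  move: e; apply/(@cvg_right0P _ (fun t => dist2 nu (kernel_act (P t) u) u)).
  - move=> t t0; rewrite dist2E; [|exact: L2_kernel_act (Pinv (ltW t0)) (L20_L2 u)|exact: L20_L2].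
    by rewrite /N /semin /ip0 /= act0E// ltW.
  - by move=> t; exact: sqrtr_ge0.
  - exact: Pc (L20_L2 u).
have co u v : generates (B := @ip0 _ _ _ nu) (P := act0) u v ->
    lam * ip0 u u <= - ip0 u v.
  by move=> /act0_generates Luv; apply: gap => //; have [] := L20_mean0 u.
have dense (u : L2_0 nu) e : 0 < e -> exists v v',
    generates (B := @ip0 _ _ _ nu) (P := act0) v v' /\ N (u - v) <= e.
  move=> e0; have Lu := L20_L2 u; have [g [g' [Lgg' ug]]] := Ldense Lu e0.
  have [Lg Lg'] := generator_L2 Lgg'.
  have g0 := center_mean0 Lg.
  have g'0 : mean0 nu g' by split => //; exact: generator_mean Lgg'.
  exists (mkL20 g0), (mkL20 g'0); split.
    by apply/act0_generates; exact: generator_center.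
  apply: le_trans ug; apply: ler_wsqrtr; rewrite /ip0 /=.
  (* Centering the approximant brings it closer to [u]: the difference [u \- g] has mean [- c], so
     adding [c] lowers its squared norm by c^2. *)
  set c := \int[nu]_x g x.
  have Lug := L2B Lu Lg; have Lc := L2_cst nu c.
  set w := (X in ip _ X X <= _).
  pose v : T -> R := u \- g.
  have -> : w = v \+ cst c.
    apply/funext => x; change (u x - (g x - c) = u x - g x + c); ring.
  have vE : \int[nu]_x v x = - c.
    rewrite RintegralB//; [|exact: L2_integrable|exact: L2_integrable].
    by have [_ ->] := L20_mean0 u; rewrite sub0r.
  rewrite (ip_shift Lug vE).
  by rewrite gerBl sqr_ge0.
have compl : energy_complete (B := @ip0 _ _ _ nu)
    (generates (B := @ip0 _ _ _ nu) (P := act0)).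
  move=> u u' Gu; apply: (op_energy_complete0 Lcomplete) => n.
  exact/act0_generates.
have [u /act0_generates Gu] := semigroup_poisson BP B0 lam0 act0_nonexp act0_lin act0_zero
  act0_add cont co dense compl (mkL20 f0).
by exists u; split => //; exact: L20_mean0.
Qed.

End generator.

(** * Existence and comparison of asymptotic variances *)

Section comparison.
Context {R : realType} {disp : measure_display} {T : measurableType disp}.
Variable nu : probability T R.
Local Notation nrm f := (Num.sqrt (ip nu f f)).

Lemma nrmD f g : L2 nu f -> L2 nu g -> nrm (f \+ g) <= nrm f + nrm g.
Proof.
move=> Lf Lg; have Lfg := L2D Lf Lg.
have sq h : nrm h ^+ 2 = ip nu h h by rewrite sqr_sqrtr// ip_ge0.
rewrite -ler_sqr ?nnegrE ?addr_ge0 ?sqrtr_ge0// sqrrD !sq.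
rewrite ipDl// !ipDr// (ipC nu g f).
have : ip nu f g <= nrm f * nrm g.
  apply: (le_trans (ler_norm _)).
  rewrite -ler_sqr ?nnegrE ?mulr_ge0 ?sqrtr_ge0// exprMn !sq.
  by rewrite real_normK ?num_real// [leRHS]mulrC ip_cs.
lra.
Qed.

Lemma spectral_gapP (A : operator R T) : (0 < spectral_gap nu A)%E ->
  (forall f g, A f g -> L2 nu f /\ L2 nu g) ->
  exists2 lam : R, 0 < lam & forall f g, A f g -> \int[nu]_x f x = 0 ->
    lam * ip nu f f <= - ip nu f g.
Proof.
move=> gap0 AL2.
have [lam lam0 lamG] : exists2 lam : R, 0 < lam & (lam%:E <= spectral_gap nu A)%E.
  case: (spectral_gap nu A) gap0 => [r|_|//]; first by rewrite lte_fin; exists r.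
  (* An infinite gap means that the infimum is over the empty set; any positive constant will do. *)
  by exists 1 => //; rewrite leey.
exists lam => // f g Afg f0; have [Lf Lg] := AL2 _ _ Afg.
have [fae|fae] := pselect (f = cst 0 %[ae nu]).
  have L0 := L2_cst nu 0.
  rewrite (ae_ip Lf L0 Lf fae) (ae_ip Lf L0 Lg fae).
  by rewrite !(ipC nu (cst 0)) !ip_cstr// !mul0r mulr0 oppr0.
have ff0 : 0 < ip nu f f.
  rewrite lt_neqAle ip_ge0 andbT eq_sym; apply/eqP => h.
  by apply: fae; exact: ip_eq0.
rewrite -ler_pdivlMr// -lee_fin (le_trans lamG)//.
by apply: ereal_inf_lbound; exists f, g; split => //; rewrite (ipC nu g).
Qed.

(** Equality of the quadratic forms of [L] and [A] makes the energy of [L] the form norm of [A], so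
    closedness of the Dirichlet form applies to sequences in the domain of [L]. *)
Lemma form_energy_complete (D : set (T -> R)) E (A L : operator R T) :
  dirichlet_form nu D E -> associated nu D E A ->
  (forall f f' g g', L f f' -> L g g' -> mean0 nu f -> mean0 nu g ->
    L (f \- g) (f' \- g')) ->
  (forall f g, L f g -> exists2 h, A f h & ip nu f g = ip nu f h) ->
  op_energy_complete nu L.
Proof.
move=> DE AE Lsub LA u u' Lu u0 ca.
have Du f g : L f g -> D f by move=> /LA[h /AE[]].
have [e e0|v [Dv _ uv]] := form_closed DE (fun n => Du _ _ (Lu n)).
  have [n0 hn0] := ca e e0; exists n0 => m n n0m n0n.
  have Lmn := Lsub _ _ _ _ (Lu m) (Lu n) (u0 m) (u0 n).
  have [h /AE[Dmn _ Eh] iph] := LA _ _ Lmn.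
  by rewrite Eh// ipC -iph; exact: hn0.
by exists v => //; exact: form_L2 DE _ Dv.
Qed.

Section operators.
Variables (C : set (T -> R)) (L A : operator R T) (P : R -> R.-pker T ~> T).
Hypothesis Pm : markov_semigroup P.
Hypothesis Pinv : invariant_law nu P.
Hypothesis Pc : strongly_continuous nu P.
Hypothesis PL : generator_of nu P L.
Hypothesis CL : C `<=` dom L.
Hypothesis Asa : self_adjoint nu A.
Hypothesis Aform : exists D E, dirichlet_form nu D E /\ associated nu D E A.
Hypothesis Acore : core nu C A.
Hypothesis LA : forall f g, L f g -> exists2 h, A f h & ip nu f g = ip nu f h.
Hypothesis Agap : (0 < spectral_gap nu A)%E.
Hypothesis A1 : A (cst 1) (cst 0).

Let kinv t : 0 <= t -> kernel_inv nu (P t).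
Proof. by move=> t0 B; exact: Pinv. Qed.

Lemma gen_sub f f' g g' : L f f' -> L g g' -> mean0 nu f -> mean0 nu g ->
  L (f \- g) (f' \- g').
Proof.
move=> Lf Lg f0 g0.
have [_ Lf'] := generator_L2 PL Lf; have [_ Lg'] := generator_L2 PL Lg.
have f'0 : mean0 nu f' by split=> //; exact: (generator_mean kinv PL) Lf.
have g'0 : mean0 nu g' by split=> //; exact: (generator_mean kinv PL) Lg.
have := generates_lin (ip0_bilinear nu) (ip0_ge0 (nu := nu)) (act0_lin kinv) (-1)
  ((act0_generates kinv PL (mkL20 g0) (mkL20 g'0)).2 Lg)
  ((act0_generates kinv PL (mkL20 f0) (mkL20 f'0)).2 Lf).
move/(act0_generates kinv PL).
have E (h k : T -> R) : -1 *: h + k = k \- h.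
  by apply/funext => x; change (-1 * h x + k x = k x - h x); rewrite mulN1r addrC.
by rewrite /= !E.
Qed.

(** The domain of [A] is dense by self-adjointness, and [C] is a core for [A]. As [C] is also
    contained in the domain of [L], this is how the latter is seen to be dense. *)
Lemma core_dense f : L2 nu f -> forall e : R, 0 < e ->
  exists g, C g /\ nrm (f \- g) <= e.
Proof.
move=> Lf e e0; have e20 : 0 < e / 2 by rewrite divr_gt0.
have [u [Du uf]] := Asa.1 f Lf.
have Lu n : L2 nu (u n) by have [v /(sa_L2 Asa)[]] := Du n.
have /(cvgL2P Lu Lf)/(_ _ e20)[n0 /(_ n0 (leqnn _)) h1] := uf.
have [v Auv] := Du n0.
have [w [w' [Cw wu _]]] := Acore.2 _ _ Auv.
have Lw n : L2 nu (w n) by have [_ /(sa_L2 Asa)[]] := Cw n.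
have /(cvgL2P Lw (Lu n0))/(_ _ e20)[n1 /(_ n1 (leqnn _)) h2] := wu.
exists (w n1); split; first by have [] := Cw n1.
have Lfu := L2B Lf (Lu n0); have Luw := L2B (Lu n0) (Lw n1).
have nrmB (a b : T -> R) : L2 nu a -> L2 nu b -> nrm (a \- b) = nrm (b \- a).
  move=> La Lb; congr Num.sqrt; rewrite !(ipBl, ipBr)//; try exact: L2B.
  by rewrite (ipC nu b a); ring.
rewrite (_ : f \- w n1 = (f \- u n0) \+ (u n0 \- w n1)); last first.
  by apply/funext => x /=; rewrite addrA subrK.
apply: (le_trans (nrmD Lfu Luw)).
rewrite (nrmB f (u n0))// (nrmB (u n0) (w n1))//; lra.
Qed.

Lemma asvar_compare f : mean0 nu f ->
  [/\ asvar_defined nu L f, asvar_defined nu A f & asvar nu L f <= asvar nu A f].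
Proof.
move=> f0; have [D [E [DE AE]]] := Aform.
have [lam lam0 gapA] := spectral_gapP Agap (sa_L2 Asa).
have gapL g h : L g h -> \int[nu]_x g x = 0 -> lam * ip nu g g <= - ip nu g h.
  by move=> /LA[k Agk ->]; exact: gapA.
have cA : op_energy_complete nu A.
  apply: (form_energy_complete DE AE) => [g g' h h' Ag Ah _ _|g h Agh].
    exact: (sa_sub Asa).
  by exists h.
have cL : op_energy_complete nu L by exact: (form_energy_complete DE AE gen_sub LA).
have dL g : L2 nu g -> forall e : R, 0 < e ->
    exists h h', L h h' /\ nrm (g \- h) <= e.
  move=> Lg e e0; have [h [Ch gh]] := core_dense Lg e0.
  by have [h' Lh] := CL Ch; exists h, h'.
have dA : asvar_defined nu A f.
  split; first exact: (sa_poisson Asa lam0 gapA A1 cA).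
  exact: (sa_poisson_unique Asa lam0 gapA).
have dLf : asvar_defined nu L f.
  split; first exact: (generator_poisson kinv PL Pm Pc lam0 gapL cL dL).
  move=> g g' [g0 Lg] [g0' Lg'].
  have [Lg2 Lg2'] := (g0.1, g0'.1).
  apply: ip_sub_ae => //.
  have := gapL _ _ (gen_sub Lg Lg' g0 g0').
  rewrite RintegralB ?g0.2 ?g0'.2 ?subrr//; try exact: L2_integrable.
  move=> /(_ erefl); rewrite (_ : (\- f) \- (\- f) = cst 0); last first.
    by apply/funext => x /=; rewrite subrr.
  rewrite ip_cstr ?mul0r ?oppr0; last exact: L2B.
  by rewrite pmulr_rle0// => h; apply/eqP; rewrite eq_le h; exact: ip_ge0.
split=> //.
have [[g pg] _] := dLf; have [[h ph] _] := dA; have Lf := f0.1.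
rewrite (asvar_eq Lf dLf pg) (asvar_eq Lf dA ph) ler_pM2l//.
move: pg ph => [[Lg g0] Lgf] [[Lh h0] Ahf].
have [v Agv ipv] := LA Lgf; have [_ Lv] := sa_L2 Asa Agv.
have LNf := L2N Lf.
(* Expansion of - <g - h, A (g - h)> >= 0, with [v] = A g, in general different from L g. Since <g,
   A g> = <g, L g> = - <f, g> and <h, A g> = <A h, g> = - <f, g>, what remains is <f, h> - <f,
   g>. *)
have := gapA _ _ (sa_sub Asa Agv Ahf).
rewrite RintegralB ?g0 ?h0 ?subrr//; try exact: L2_integrable.
move=> /(_ erefl); have := mulr_ge0 (ltW lam0) (ip_ge0 nu (g \- h)).
move=> le1 /(le_trans le1) {le1}.
have LvNf := L2B Lv LNf.
rewrite ipBl// !ipBr// -ipv (ipC nu h v) -(sa_sym Asa Agv Ahf) !ipNr//.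
by rewrite (ipC nu h f) (ipC nu f g); lra.
Qed.

End operators.
End comparison.

(** * The product of a finite set and Euclidean space *)

Section product.
Context {R : realType} {X : finType} {x0 : X} {d : nat}.
Variable M : model R x0 d.
Local Notation wt := (wt M).
Local Notation pi := (piX M).
Local Notation rho := (rho M).
Local Notation pihat := (pihat M).
Implicit Types f g : fspace x0 * Rd R d -> R.

Lemma fspace_measurable_fun (disp : measure_display) (T : measurableType disp)
  (F : fspace x0 -> T) : measurable_fun [set: fspace x0] F.
Proof. by []. Qed.

Lemma wt_ge0 x : 0 <= wt x. Proof. exact: fine_ge0. Qed.

Lemma EFin_wt x : (wt x)%:E = pi [set (x : fspace x0)].
Proof. by rewrite /wt fineK//; exact: fin_num_measure. Qed.

Lemma integral_piX (F : fspace x0 -> \bar R) : (forall x, 0 <= F x)%E ->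
  (\int[pi]_x F x = \sum_(x : X) (wt x)%:E * F x)%E.
Proof.
move=> F0.
have D : [set: fspace x0] = \big[setU/set0]_(x <- enum X) [set (x : fspace x0)].
  rewrite -bigcup_seq; apply/seteqP; split => // x _.
  by exists x => //=; rewrite mem_enum.
rewrite D ge0_integral_bigsetU//; last 2 first.
- exact: enum_uniq.
- by apply/trivIsetP => i j _ _ /eqP ij; apply/seteqP; split => // y /= [-> ].
rewrite big_enum/=; apply: eq_bigr => x _.
rewrite (eq_integral (fun=> F x)); last by move=> y; rewrite inE/= => ->.
by rewrite integral_cst// EFin_wt muleC.
Qed.

Lemma measurable_sec f : measurable_fun [set: fspace x0 * Rd R d] f ->
  forall x, measurable_fun [set: Rd R d] (sec f x).
Proof.
move=> mf x; have mp := @pair1_measurable _ _ (fspace x0) (Rd R d) x.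
exact: (measurableT_comp mf mp).
Qed.

Lemma measurable_of_sec f : (forall x, measurable_fun [set: Rd R d] (sec f x)) ->
  measurable_fun [set: fspace x0 * Rd R d] f.
Proof.
move=> h _ B mB; rewrite setTI.
rewrite (_ : f @^-1` B = \big[setU/set0]_(x <- enum X)
  ([set (x : fspace x0)] `*` (sec f x @^-1` B))).
  apply: bigsetU_measurable => x _; apply: measurableX => //.
  by rewrite -[X in measurable X]setTI; exact: h.
rewrite -bigcup_seq; apply/seteqP; split => [[x p] /= Bx|[x p] [y _ [/= -> //]]].
by exists x => //=; rewrite mem_enum.
Qed.

Lemma integral_pihat (F : fspace x0 * Rd R d -> \bar R) :
  (forall z, 0 <= F z)%E -> measurable_fun [set: fspace x0 * Rd R d] F ->
  (\int[pihat]_z F z = \sum_(x : X) (wt x)%:E * \int[rho]_p F (x, p))%E.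
Proof.
move=> F0 mF; rewrite -integral_piX => [|x]; last exact: integral_ge0.
exact: fubini_tonelli1.
Qed.

Lemma L2_pihatP f : L2 pihat f <->
  (forall x, measurable_fun [set: Rd R d] (sec f x)) /\
  (forall x, wt x != 0 -> L2 rho (sec f x)).
Proof.
have E : measurable_fun [set: fspace x0 * Rd R d] f ->
    (\int[pihat]_z (f z ^+ 2)%:E
     = \sum_(x : X) (wt x)%:E * \int[rho]_p (sec f x p ^+ 2)%:E)%E.
  move=> mf; rewrite integral_pihat// => [z|].
    by rewrite lee_fin sqr_ge0.
  by apply/measurable_EFinP/measurable_funX.
have t0 x : (0 <= (wt x)%:E * \int[rho]_p (sec f x p ^+ 2)%:E)%E.
  rewrite mule_ge0 ?lee_fin ?wt_ge0// integral_ge0// => p _.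
  by rewrite lee_fin sqr_ge0.
split=> [/L2P[mf]|[ms Ls]].
  rewrite E// => fin; split=> [|x wx]; first exact: measurable_sec.
  apply/L2P; split; first exact: measurable_sec.
  have : ((wt x)%:E * \int[rho]_p (sec f x p ^+ 2)%:E < +oo)%E.
    apply: le_lt_trans fin; rewrite (bigD1 x)//= leeDl//.
    by apply: sume_ge0 => y _.
  have wx0 : 0 < wt x by rewrite lt_neqAle eq_sym wx wt_ge0.
  rewrite !ltey; apply: contra => /eqP ->.
  by rewrite gt0_muley ?lte_fin.
have mf := measurable_of_sec ms.
apply/L2P; split; first exact: mf.
rewrite E//; apply: lte_sum_pinfty => x _.
have [->|wx] := eqVneq (wt x) 0; first by rewrite mul0e.
have /L2P[_ fin] := Ls x wx.
by rewrite lte_mul_pinfty// ?lee_fin ?wt_ge0.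
Qed.

Lemma L2_sec f x : L2 pihat f -> wt x != 0 -> L2 rho (sec f x).
Proof. by move=> /L2_pihatP[_]; exact. Qed.

Lemma ip_pihat_sq f : L2 pihat f ->
  ip pihat f f = \sum_x wt x * ip rho (sec f x) (sec f x).
Proof.
move=> Lf; apply: EFin_inj; rewrite EFin_ip// integral_pihat; last 2 first.
- by move=> z; rewrite lee_fin -expr2 sqr_ge0.
- by apply/measurable_EFinP/measurable_funM; exact: (L2_measurable Lf).
rewrite -sumEFin; apply: eq_bigr => x _; rewrite EFinM.
have [->|wx] := eqVneq (wt x) 0; first by rewrite !mul0e.
by rewrite EFin_ip//; exact: L2_sec.
Qed.

(** By polarization: Tonelli's theorem covers the squares of [f], [g] and [f \+ g], and the mixed
    product is a combination of them. *)
Lemma ip_pihat f g : L2 pihat f -> L2 pihat g ->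
  ip pihat f g = \sum_x wt x * ip rho (sec f x) (sec g x).
Proof.
move=> Lf Lg; have := ip_pihat_sq (L2D Lf Lg).
rewrite ipDl ?ipDr//; try exact: L2D.
rewrite (ipC _ g f) (ip_pihat_sq Lf) (ip_pihat_sq Lg) => h.
have {}h : 2 * ip pihat f g = \sum_x wt x * ip rho (sec (f \+ g) x) (sec (f \+ g) x)
   - \sum_x wt x * ip rho (sec f x) (sec f x) - \sum_x wt x * ip rho (sec g x) (sec g x).
  by rewrite -h; ring.
apply: (@mulfI _ 2) => //; rewrite h -!sumrB mulr_sumr; apply: eq_bigr => x _.
have [->|wx] := eqVneq (wt x) 0; first by rewrite !mul0r mulr0 !subr0.
have Lfx := L2_sec Lf wx; have Lgx := L2_sec Lg wx.
rewrite (_ : sec (f \+ g) x = sec f x \+ sec g x)//.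
rewrite ipDl ?ipDr//; try exact: L2D.
rewrite (ipC _ (sec g x) (sec f x)); ring.
Qed.

Lemma mean_pihat f : L2 pihat f ->
  \int[pihat]_z f z = \sum_x wt x * \int[rho]_p sec f x p.
Proof.
move=> Lf; rewrite -ip_cst1 ip_pihat//; last exact: L2_cst.
by apply: eq_bigr => x _; rewrite -ip_cst1.
Qed.

Lemma L2_piX (F : fspace x0 -> R) : L2 pi F.
Proof.
apply/L2P; split; first exact: fspace_measurable_fun.
rewrite integral_piX => [|x]; last by rewrite lee_fin sqr_ge0.
by apply: lte_sum_pinfty => x _; rewrite -EFinM ltry.
Qed.

Lemma ip_piX (F G : fspace x0 -> R) : ip pi F G = \sum_x wt x * (F x * G x).
Proof.
have sq (H : fspace x0 -> R) : ip pi H H = \sum_x wt x * (H x * H x).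
  apply: EFin_inj; rewrite EFin_ip; try exact: L2_piX.
  rewrite integral_piX => [|x]; last by rewrite lee_fin -expr2 sqr_ge0.
  by rewrite -sumEFin.
have LF := L2_piX F; have LG := L2_piX G.
have := sq (F \+ G).
rewrite ipDl ?ipDr//; try exact: L2D.
rewrite (ipC _ G F) !sq => h.
have {}h : 2 * ip pi F G = \sum_x wt x * ((F \+ G) x * (F \+ G) x)
   - \sum_x wt x * (F x * F x) - \sum_x wt x * (G x * G x).
  by rewrite -h; ring.
apply: (@mulfI _ 2) => //; rewrite h -!sumrB mulr_sumr; apply: eq_bigr => x _ /=.
ring.
Qed.

Lemma mean_piX (F : fspace x0 -> R) : \int[pi]_x F x = \sum_x wt x * F x.
Proof. by rewrite -ip_cst1 ip_piX; apply: eq_bigr => x _; rewrite mulr1. Qed.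

Lemma sum_wt : \sum_x wt x = 1.
Proof.
by rewrite -(mean_cst pi 1) mean_piX; apply: eq_bigr => x _; rewrite mulr1.
Qed.

Lemma ae_piXP (Q : fspace x0 -> Prop) :
  (\forall x \ae pi, Q x) <-> (forall x, wt x != 0 -> Q x).
Proof.
split=> [[N [mN N0 QN]] x wx|h].
  apply: contrapT => nQ; move/eqP : wx; apply; apply: EFin_inj.
  have le : (pi [set (x : fspace x0)] <= pi N)%E.
    by apply: le_measure; rewrite ?inE// => y -> ; exact: QN.
  rewrite EFin_wt; apply: le_anti; apply/andP; split; last exact: measure_ge0.
  by apply: (le_trans le); rewrite N0.
exists [set x | ~ Q x]; split => //.
set A := [set x | ~ Q x].
have := @integral_indic _ _ _ pi setT measurableT A I; rewrite setIT => <-.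
rewrite integral_piX => [|x]; last by rewrite lee_fin.
apply: big1 => x _; have [->|wx] := eqVneq (wt x) 0; first by rewrite mul0e.
rewrite indicE (_ : (x \in A) = false) ?mule0//.
by apply/negP; rewrite inE /A /=; apply; exact: h.
Qed.

Lemma L2_tau (F : fspace x0 -> R) : L2 pihat (tau_lift F).
Proof.
apply/L2_pihatP; split=> x; last by move=> _; exact: (L2_cst rho (F x)).
by rewrite (_ : sec _ x = cst (F x)).
Qed.

Lemma mean_tau (F : fspace x0 -> R) : \int[pihat]_z tau_lift F z = \int[pi]_x F x.
Proof.
rewrite (mean_pihat (L2_tau F)) mean_piX; apply: eq_bigr => x _.
by congr (_ * _); exact: (mean_cst rho (F x)).
Qed.

Lemma ip_tau_tau (F G : fspace x0 -> R) :
  ip pihat (tau_lift F) (tau_lift G) = ip pi F G.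
Proof.
rewrite ip_pihat ?ip_piX; try exact: L2_tau.
by apply: eq_bigr => x _; congr (_ * _); exact: (mean_cst rho (F x * G x)).
Qed.

Lemma ip_tau (F : fspace x0 -> R) g : L2 pihat g ->
  ip pihat (tau_lift F) g = \sum_x wt x * (F x * \int[rho]_p sec g x p).
Proof.
move=> Lg; rewrite ip_pihat//; last exact: L2_tau.
apply: eq_bigr => x _; have [->|wx] := eqVneq (wt x) 0; first by rewrite !mul0r.
by congr (_ * _); rewrite ipC; exact: (ip_cstr (F x) (L2_sec Lg wx)).
Qed.

End product.

(** * Reversible generators on a finite set *)

Lemma finite_solve (F : fieldType) (X : finType) (N : X -> X -> F) :
  (forall v : X -> F, (forall y, \sum_x v x * N x y = 0) -> forall x, v x = 0) ->
  forall b : X -> F, exists v : X -> F, forall y, \sum_x v x * N x y = b y.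
Proof.
move=> inj b; pose A : 'M[F]_#|X| := \matrix_(i, j) N (enum_val i) (enum_val j).
have vA (v : 'rV[F]_#|X|) y : (v *m A) 0 (enum_rank y)
    = \sum_x v 0 (enum_rank x) * N x y.
  rewrite mxE (reindex (@enum_rank X)) /=; last exact/onW_bij/enum_rank_bij.
  by apply: eq_bigr => x _; rewrite mxE !enum_rankK.
have rf : row_free A.
  apply: inj_row_free => v vA0; apply/rowP => i; rewrite mxE -(enum_valK i).
  by apply: (inj (fun x => v 0 (enum_rank x))) => y; rewrite -vA vA0 mxE.
rewrite row_free_unit in rf.
pose v := (\row_j b (enum_val j)) *m invmx A.
exists (fun x => v 0 (enum_rank x)) => y.
by rewrite -vA /v mulmxKV// mxE enum_rankK.
Qed.

Record rev_matrix (R : realType) (X : finType) (w : X -> R) (K : X -> X -> R)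
  : Prop := RevMatrix {
  rev_rowsum : forall x, \sum_y K x y = 0 ;
  rev_sym : forall x y, w x * K x y = w y * K y x ;
  rev_ge0 : forall x y, x != y -> 0 <= K x y }.

Section rev_matrix.
Context {R : realType} {X : finType} {w : X -> R}.
Hypothesis w_ge0 : forall x, 0 <= w x.
Implicit Types (K : X -> X -> R) (F G : X -> R).

Definition mform K F G : R := - \sum_x w x * (F x * \sum_y K x y * G y).

Definition mdir K F : R := 2^-1 * \sum_x \sum_y w x * K x y * (F x - F y) ^+ 2.

Lemma mformC K F G : rev_matrix w K -> mform K F G = mform K G F.
Proof.
move=> rK; rewrite /mform; congr (- _).
under eq_bigr do rewrite !mulr_sumr.
under [RHS]eq_bigr do rewrite !mulr_sumr.
rewrite exchange_big; apply: eq_bigr => x _; apply: eq_bigr => y _.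
transitivity ((w y * K y x) * F y * G x); first by ring.
by rewrite (rev_sym rK y x); ring.
Qed.

(** After expanding the square, detailed balance moves the weight to the other index, and both
    diagonal terms vanish because rows sum to zero. *)
Lemma mformE K F : rev_matrix w K -> mform K F F = mdir K F.
Proof.
move=> rK; rewrite /mdir.
have E x y : w x * K x y * (F x - F y) ^+ 2 = w x * F x ^+ 2 * K x y
    + w y * F y ^+ 2 * K y x - 2 * (w x * (F x * (K x y * F y))).
  have := rev_sym rK x y => h.
  transitivity (F x ^+ 2 * (w x * K x y) + F y ^+ 2 * (w x * K x y)
    - 2 * (w x * (F x * (K x y * F y)))); first by ring.
  by rewrite {2}h; ring.
have -> : \sum_x \sum_y w x * K x y * (F x - F y) ^+ 2
    = \sum_x \sum_y w x * F x ^+ 2 * K x y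
      + \sum_x \sum_y w y * F y ^+ 2 * K y x
      - \sum_x \sum_y 2 * (w x * (F x * (K x y * F y))).
  rewrite -big_split -sumrB; apply: eq_bigr => x _.
  by rewrite -big_split -sumrB; apply: eq_bigr => y _; exact: E.
have -> : \sum_x \sum_y w y * F y ^+ 2 * K y x = 0.
  rewrite exchange_big big1// => x _.
  by rewrite -mulr_sumr (rev_rowsum rK) mulr0.
have -> : \sum_x \sum_y w x * F x ^+ 2 * K x y = 0.
  by rewrite big1// => x _; rewrite -mulr_sumr (rev_rowsum rK) mulr0.
have -> : \sum_x \sum_y 2 * (w x * (F x * (K x y * F y)))
    = 2 * \sum_x w x * (F x * \sum_y K x y * F y).
  rewrite mulr_sumr; apply: eq_bigr => x _.
  by rewrite !mulr_sumr.
by rewrite /mform; field.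
Qed.

Lemma mdir_term_ge0 K F x y : rev_matrix w K -> 0 <= w x * K x y * (F x - F y) ^+ 2.
Proof.
move=> rK; have [->|xy] := eqVneq x y.
  by rewrite subrr expr0n mulr0.
apply: mulr_ge0; last exact: sqr_ge0.
by apply: mulr_ge0; [exact: w_ge0|exact: (rev_ge0 rK xy)].
Qed.

Lemma mdir_ge0 K F : rev_matrix w K -> 0 <= mdir K F.
Proof.
move=> rK; rewrite mulr_ge0 ?invr_ge0//.
by apply: sumr_ge0 => x _; apply: sumr_ge0 => y _; exact: mdir_term_ge0.
Qed.

Lemma mform_ge0 K F : rev_matrix w K -> 0 <= mform K F F.
Proof. by move=> rK; rewrite mformE// mdir_ge0. Qed.

Lemma mdir_le K K' (c : R) F : rev_matrix w K ->
  (forall x y, x != y -> w x != 0 -> c * K x y <= K' x y) ->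
  c * mdir K F <= mdir K' F.
Proof.
move=> rK h; rewrite /mdir mulrCA ler_pM2l ?invr_gt0// mulr_sumr.
apply: ler_sum => x _; rewrite mulr_sumr; apply: ler_sum => y _.
have [->|xy] := eqVneq x y; first by rewrite subrr expr0n !mulr0.
have [->|wx] := eqVneq (w x) 0; first by rewrite !mul0r mulr0.
have -> : c * (w x * K x y * (F x - F y) ^+ 2)
  = w x * (c * K x y) * (F x - F y) ^+ 2 by ring.
apply: ler_wpM2r; first exact: sqr_ge0.
by apply: ler_wpM2l => //; exact: h.
Qed.

Lemma mform_lin K (a : R) F G H :
  mform K (fun x => a * F x + G x) H = a * mform K F H + mform K G H.
Proof.
rewrite /mform mulrN -opprD; congr (- _); rewrite mulr_sumr -big_split.
by apply: eq_bigr => x _ /=; ring.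
Qed.

Lemma mform_cs K F G : rev_matrix w K ->
  mform K F G ^+ 2 <= mform K G G * mform K F F.
Proof.
move=> rK; apply: quad_discr; rewrite ?mform_ge0// => s.
have := mform_ge0 (fun x => s * F x + G x) rK.
rewrite mform_lin !(mformC _ (fun x => s * F x + G x) rK) !mform_lin.
rewrite (mformC G F rK); lra.
Qed.

End rev_matrix.

Section matrix_poisson.
Context {R : realType} {X : finType} {x0 : X} {d : nat}.
Variable M : model R x0 d.
Local Notation wt := (wt M).
Local Notation pi := (piX M).
Variable K : X -> X -> R.
Hypothesis rK : rev_matrix wt K.
Hypothesis irr : forall F : X -> R, \sum_x wt x * F x = 0 ->
  mform (w := wt) K F F = 0 -> forall x, wt x != 0 -> F x = 0.

Lemma matrix_poissonP (f g : fspace x0 -> R) :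
  poisson pi (matrix_op M K) f g <-> \sum_x wt x * g x = 0 /\
  forall x, wt x != 0 -> \sum_y K x y * g y = - f x.
Proof.
split=> [[[_ g0]] /ae_piXP h|[g0 h]].
  by rewrite -mean_piX; split=> // x wx; rewrite -h.
split; first by split; [exact: L2_piX|rewrite mean_piX].
by apply/ae_piXP => x wx _; rewrite h.
Qed.

(** Uniqueness is [irr] applied to a difference. For existence the singular system is completed to
    an injective square one, whose solution turns out to have mean zero and hence to solve the
    original equation. *)
Lemma matrix_asvar_defined (f : fspace x0 -> R) : mean0 pi f ->
  asvar_defined pi (matrix_op M K) f.
Proof.
move=> [_]; rewrite mean_piX => f0; split; last first.
  move=> g g' /matrix_poissonP[g0 hg] /matrix_poissonP[g0' hg'].
  apply/ae_piXP => x wx _; apply/eqP; rewrite -subr_eq0; apply/eqP.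
  apply: (irr (F := fun x => g x - g' x)) => //.
    under eq_bigr do rewrite mulrBr.
    by rewrite sumrB g0 g0' subrr.
  rewrite /mform big1 ?oppr0// => y _.
  have [->|wy] := eqVneq (wt y) 0; first by rewrite mul0r.
  under eq_bigr do rewrite mulrBr.
  by rewrite sumrB hg// hg'// subrr !mulr0.
(* The rows and columns outside the support are replaced by the identity, and
   the rank-one term removes the constants from the kernel. *)
pose dl x y : R := if (x == y) && (wt x == 0) then 1 else 0.
pose N (x y : X) := - (wt y * K y x) + wt x * wt y + dl y x.
have NE (v : X -> R) y : \sum_x v x * N x y
    = - (wt y * \sum_x K y x * v x) + wt y * \sum_x wt x * v x
      + (if wt y == 0 then v y else 0).
  have -> : (if wt y == 0 then v y else 0) = \sum_x v x * dl y x.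
    rewrite (bigD1 y)//= big1 ?addr0 => [|x xy].
      by rewrite /dl eqxx /=; case: ifP; rewrite ?mulr1 ?mulr0.
    by rewrite /dl eq_sym (negPf xy) mulr0.
  rewrite !mulr_sumr -sumrN -!big_split; apply: eq_bigr => x _ /=.
  by rewrite /N; ring.
have sumN (v : X -> R) : \sum_y wt y * \sum_x K y x * v x = 0.
  under eq_bigr do rewrite mulr_sumr.
  rewrite exchange_big big1// => x _.
  under eq_bigr do rewrite mulrA (rev_sym rK) mulrAC.
  by rewrite -mulr_sumr (rev_rowsum rK) mulr0.
(* Summing all equations removes [K], by detailed balance and zero row sums, and leaves the mean of
   [v]. For [b = 0], and for [b] = wt f with [f] of mean zero, the rank-one term is therefore zero
   at the solution. *)
have tot (v b : X -> R) : (forall y, \sum_x v x * N x y = b y) ->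
    (forall x, wt x = 0 -> v x = 0) -> \sum_x wt x * v x = \sum_y b y.
  move=> hv v0; rewrite -(eq_bigr _ (fun y _ => hv y)).
  under [RHS]eq_bigr do rewrite NE.
  rewrite !big_split/= sumrN sumN oppr0 add0r -mulr_suml sum_wt mul1r.
  by rewrite [X in _ + X]big1 ?addr0// => y _; case: eqP => // wy; exact: v0.
have [v hv|v hv] := @finite_solve R X N _ (fun y => wt y * f y).
  pose m := \sum_x wt x * v x.
  have v0 x : wt x = 0 -> v x = 0.
    by move=> wx; have := hv x; rewrite NE wx !mul0r oppr0 !add0r eqxx.
  have m0 : m = 0 by rewrite /m (tot _ _ hv v0) big1.
  move=> x; have [/v0//|wx] := eqVneq (wt x) 0.
  apply: irr => //.
  rewrite /mform big1 ?oppr0// => y _.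
  have [->|wy] := eqVneq (wt y) 0; first by rewrite mul0r.
  have := hv y; rewrite NE -/m m0 mulr0 (negPf wy) !addr0 => /eqP.
  by rewrite oppr_eq0 mulf_eq0 (negPf wy) => /eqP ->; rewrite !mulr0.
pose m := \sum_x wt x * v x.
have v0 x : wt x = 0 -> v x = 0.
  by move=> wx; have := hv x; rewrite NE wx !mul0r oppr0 !add0r eqxx.
have m0 : m = 0 by rewrite /m (tot _ _ hv v0).
exists v; apply/matrix_poissonP; split=> // x wx.
have := hv x; rewrite NE -/m m0 mulr0 (negPf wx) !addr0 -mulrN => /(mulfI wx) <-.
by rewrite opprK.
Qed.

Lemma matrix_poisson_form (f g h : fspace x0 -> R) :
  poisson pi (matrix_op M K) f g -> mform (w := wt) K h g = ip pi h f.
Proof.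
move=> /matrix_poissonP[_ hg]; rewrite ip_piX /mform -sumrN.
apply: eq_bigr => x _; have [->|wx] := eqVneq (wt x) 0; first by rewrite !mul0r oppr0.
by rewrite hg// mulrN mulrN opprK.
Qed.

End matrix_poisson.

(** With a = <f, g'> and b = <f, g>, the number a is both the [K]-form of (g', g) and the [K']-form
    of (g', g'). Cauchy-Schwarz for the [K]-form and the comparison give c a^2 <= b a. *)
Lemma matrix_asvar_le (R : realType) (X : finType) (x0 : X) (d : nat)
    (M : model R x0 d) (K K' : X -> X -> R) (c : R) f g g' : 0 < c ->
  rev_matrix (wt M) K -> rev_matrix (wt M) K' ->
  (forall F, c * mform (w := wt M) K F F <= mform (w := wt M) K' F F) ->
  poisson (piX M) (matrix_op M K) f g -> poisson (piX M) (matrix_op M K') f g' ->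
  ip (piX M) f g' <= c^-1 * ip (piX M) f g.
Proof.
move=> c0 rK rK' h pg pg'.
set a := ip _ f g'; set b := ip _ f g.
have w0 := wt_ge0 M.
have E1 : mform (w := wt M) K g' g = a by rewrite (matrix_poisson_form _ pg) ipC.
have E2 : mform (w := wt M) K g g = b by rewrite (matrix_poisson_form _ pg) ipC.
have E3 : mform (w := wt M) K' g' g' = a by rewrite (matrix_poisson_form _ pg') ipC.
have := mform_cs w0 g' g rK; rewrite E1 E2 => cs.
have b0 : 0 <= b by rewrite -E2; exact: mform_ge0.
have a0 : 0 <= a by rewrite -E3; exact: mform_ge0.
have := h g'; rewrite E3 => hc.
have : c * a ^+ 2 <= b * a.
  rewrite (le_trans (ler_wpM2l (ltW c0) cs))// mulrCA.
  exact: ler_wpM2l.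
have [->|an] := eqVneq a 0; first by move=> _; rewrite mulr_ge0// invr_ge0 ltW.
have ap : 0 < a by rewrite lt_neqAle eq_sym an.
by rewrite expr2 mulrA ler_pM2r// => ca; rewrite mulrC ler_pdivlMr// mulrC.
Qed.

(** * Finite sums, extension from a core, uniqueness of operator values *)

Section finite_sums.
Context {R : realType} {disp : measure_display} {T : measurableType disp}.
Variable nu : probability T R.

Lemma L2_sum (I : finType) (F : I -> T -> R) : (forall i, L2 nu (F i)) ->
  L2 nu (fun x => \sum_i F i x).
Proof.
move=> LF; elim: (index_enum I) => [|i r IH].
  by under eq_fun do rewrite big_nil; exact: L2_cst.
by under eq_fun do rewrite big_cons; exact: L2D.
Qed.

Lemma Rintegral_sum (I : finType) (F : I -> T -> R) :
  (forall i, nu.-integrable [set: T] (EFin \o F i)) ->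
  \int[nu]_x (\sum_i F i x) = \sum_i \int[nu]_x F i x.
Proof.
move=> FI.
have sumI (r : seq I) : nu.-integrable [set: T] (EFin \o (fun x => \sum_(i <- r) F i x)).
  elim: r => [|i r IH].
    rewrite (_ : _ \o _ = EFin \o cst 0); first exact: L2_integrable (L2_cst _ _).
    by apply/funext => x /=; rewrite big_nil.
  rewrite (_ : _ \o _ =
    ((EFin \o F i) \+ (EFin \o (fun x => (\sum_(i <- r) F i x)%R)))%E).
    exact: integrableD.
  by apply/funext => x /=; rewrite big_cons EFinD.
elim: (index_enum I) => [|i r IH].
  by under eq_Rintegral do rewrite big_nil; rewrite big_nil mean_cst.
by under eq_Rintegral do rewrite big_cons; rewrite RintegralD// IH big_cons.
Qed.

Lemma nrm_cvg_ip (a f g : T -> R) (e : R) : L2 nu a -> L2 nu f -> L2 nu g ->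
  Num.sqrt (ip nu (f \- g) (f \- g)) <= e ->
  `|ip nu a f - ip nu a g| <= Num.sqrt (ip nu a a) * e.
Proof.
move=> La Lf Lg fg; rewrite -ipBr//; have Lfg := L2B Lf Lg.
apply: (@le_trans _ _ (Num.sqrt (ip nu a a) * Num.sqrt (ip nu (f \- g) (f \- g)))).
  rewrite -ler_sqr ?nnegrE ?mulr_ge0 ?sqrtr_ge0// real_normK ?num_real//.
  by rewrite exprMn !sqr_sqrtr ?ip_ge0// mulrC ip_cs.
by rewrite ler_wpM2l// sqrtr_ge0.
Qed.

(** The relation is continuous for the graph norm. It allows membership in the domain of a
    self-adjoint operator to be checked on a core. *)
Lemma core_ip_ext (C : set (T -> R)) (A : operator R T) a b :
  (forall f g, A f g -> L2 nu f /\ L2 nu g) -> core nu C A -> L2 nu a -> L2 nu b ->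
  (forall u v, C u -> A u v -> ip nu a v = ip nu b u) ->
  forall u v, A u v -> ip nu a v = ip nu b u.
Proof.
move=> AL2 [_ Acore] La Lb h u v Auv; have [Lu Lv] := AL2 _ _ Auv.
have [s [s' [Cs su sv]]] := Acore _ _ Auv.
have Ls n := (AL2 _ _ (Cs n).2).1; have Ls' n := (AL2 _ _ (Cs n).2).2.
apply/eqP; rewrite -subr_eq0 -normr_le0; apply/ler_addgt0Pr => e e0; rewrite add0r.
pose K := Num.sqrt (ip nu a a) + Num.sqrt (ip nu b b) + 1.
have K0 : 0 < K by rewrite ltr_wpDl// addr_ge0 ?sqrtr_ge0.
have eK : 0 < e / K by rewrite divr_gt0.
have /(cvgL2P Ls Lu)/(_ _ eK)[n1 h1] := su.
have /(cvgL2P Ls' Lv)/(_ _ eK)[n2 h2] := sv.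
pose n := maxn n1 n2.
have {}h1 := nrm_cvg_ip Lb (Ls n) Lu (h1 n (leq_maxl _ _)).
have {}h2 := nrm_cvg_ip La (Ls' n) Lv (h2 n (leq_maxr _ _)).
rewrite -(h _ _ (Cs n).1 (Cs n).2) in h1.
have h3 : `|ip nu a v - ip nu b u| <= `|ip nu a (s' n) - ip nu b u|
    + `|ip nu a (s' n) - ip nu a v|.
  apply: (le_trans (ler_distD (ip nu a (s' n)) _ _)).
  by rewrite addrC (distrC (ip nu a v)).
rewrite (le_trans h3)// (le_trans (lerD h1 h2))// -mulrDl.
apply: (@le_trans _ _ (K * (e / K))); last by rewrite mulrC divfK ?gt_eqF.
by apply: ler_wpM2r; [exact: ltW|rewrite /K; lra].
Qed.

End finite_sums.

(** By symmetry the difference of two values is orthogonal to the domain, which is dense. This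
    identifies an arbitrary value of [Lrev] with the one given by its formula. *)
Lemma sa_unique (R : realType) (disp : measure_display) (T : measurableType disp)
    (nu : probability T R) (A : operator R T) f g g' :
  self_adjoint nu A -> A f g -> A f g' -> ip nu (g \- g') (g \- g') = 0.
Proof.
move=> Asa Ag Ag'; have [Lf Lg] := sa_L2 Asa Ag; have [_ Lg'] := sa_L2 Asa Ag'.
have Lw := L2B Lg Lg'; set w := g \- g' in Lw *.
have orth h h' : A h h' -> ip nu w h = 0.
  move=> Ah; have [Lh _] := sa_L2 Asa Ah.
  by rewrite ipBl// -(sa_sym Asa Ag Ah) -(sa_sym Asa Ag' Ah) subrr.
have [u [Du uw]] := Asa.1 w Lw.
have Lu n : L2 nu (u n) by have [v /(sa_L2 Asa)[]] := Du n.
apply/eqP; rewrite -normr_le0; apply/ler_addgt0Pr => e e0; rewrite add0r.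
pose K := Num.sqrt (ip nu w w) + 1.
have K0 : 0 < K by rewrite ltr_wpDl// sqrtr_ge0.
have eK : 0 < e / K by rewrite divr_gt0.
have /(cvgL2P Lu Lw)/(_ _ eK)[n1 /(_ n1 (leqnn _)) h1] := uw.
have := nrm_cvg_ip Lw (Lu n1) Lw h1.
have [v /orth ->] := Du n1; rewrite sub0r normrN => /le_trans; apply.
apply: (@le_trans _ _ (K * (e / K))); last by rewrite mulrC divfK ?gt_eqF.
by apply: ler_wpM2r; [exact: ltW|rewrite /K lerDl].
Qed.

Lemma generator_unique (R : realType) (disp : measure_display) (T : measurableType disp)
    (nu : probability T R) (P : R -> R.-pker T ~> T) (L : operator R T) f g g' :
  (forall t, 0 <= t -> kernel_inv nu (P t)) -> generator_of nu P L ->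
  L f g -> L f g' -> g = g' %[ae nu].
Proof.
move=> Pinv PL /(generatorP Pinv PL)[Lf Lg h] /(generatorP Pinv PL)[_ Lg' h'].
have Lgg := L2B Lg Lg'.
apply: ip_sub_ae => //.
suff le0 : Num.sqrt (ip nu (g \- g') (g \- g')) <= 0.
  have s0 : Num.sqrt (ip nu (g \- g') (g \- g')) = 0.
    by apply/eqP; rewrite eq_le le0 sqrtr_ge0.
  by rewrite -(sqr_sqrtr (ip_ge0 nu (g \- g'))) s0 expr0n.
have : Num.sqrt (ip nu (g \- g') (g \- g')) <= 0.
  apply/ler_addgt0Pr => e e0; rewrite add0r; have e20 : 0 < e / 2 by rewrite divr_gt0.
  have [d1 d10 h1] := h _ e20; have [d2 d20 h2] := h' _ e20.
  pose t := Num.min d1 d2 / 2.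
  have m0 : 0 < Num.min d1 d2 by rewrite lt_min d10.
  have t0 : 0 < t by rewrite divr_gt0.
  have tm : t < Num.min d1 d2 by rewrite ltr_pdivrMr// ltr_pMr// ltr1n.
  move: tm; rewrite lt_min => /andP[td1 td2].
  have {}h1 := h1 t; rewrite t0 td1 in h1; have {}h1 := h1 isT.
  have {}h2 := h2 t; rewrite t0 td2 in h2; have {}h2 := h2 isT.
  have L1 := L2_increment Pinv (ltW t0) Lf Lg.
  have L2' := L2_increment Pinv (ltW t0) Lf Lg'.
  rewrite -(ler_pM2l t0) -[X in X * _ <= _](gtr0_norm t0) -nrmZ//.
  rewrite (_ : (fun x => t * _) = (fun x => kernel_act (P t) f x - f x - t * g' x)
    \+ (fun x => -1 * (kernel_act (P t) f x - f x - t * g x))); last first.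
    by apply/funext => x /=; ring.
  apply: (le_trans (nrmD L2' (L2Z (-1) L1))); rewrite nrmZ// normrN1 mul1r; lra.
by [].
Qed.

(** * The reversible part of the lifted generator *)

Section model_facts.
Context {R : realType} {X : finType} {x0 : X} {d : nat}.
Variable M : model R x0 d.
Hypothesis Mok : model_ok M.
Local Notation wt := (wt M).
Local Notation pi := (piX M).
Local Notation rho := (rho M).
Local Notation pihat := (pihat M).
Local Notation Qrev := (Qrev M).
Local Notation LD := (LD M).
Implicit Types f g u v : fspace x0 * Rd R d -> R.

(** Everything holds for each fixed p: off the diagonal [Qrev] averages [Q] with its adjoint in
    L^2(pi), whence detailed balance, and the subtracted diagonal of [q] restores the zero row
    sums. *)
Lemma Qrev_rev p : rev_matrix wt (Qrev p).
Proof.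
split=> [x|x y|x y xy].
- rewrite /Defs.Qrev -mulr_sumr big_split /= /Qdag sumrB.
  have -> : \sum_y Q M p x y = 0.
    by rewrite (bigD1 x)//= (Q_diag Mok) addNr.
  have -> : \sum_y (if x == y then q M x p else 0) = q M x p.
    rewrite (bigD1 x)//= eqxx big1 ?addr0// => y yx.
    by rewrite eq_sym (negPf yx).
  rewrite /q; case: eqP => [_|_]; last by rewrite subrr addr0 mulr0.
  by rewrite big1// subrr addr0 mulr0.
- have [->//|xy] := eqVneq x y.
  rewrite /Defs.Qrev /Qdag [y == x]eq_sym (negPf xy) !subr0.
  have [wx|wx] := eqVneq (wt x) 0.
    rewrite wx mul0r (Q_supp Mok p (or_intror wx)) mulr0 mul0r.
    by rewrite if_same addr0 !mulr0.
  have [wy|wy] := eqVneq (wt y) 0.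
    rewrite wy mul0r (Q_supp Mok p (or_intror wy)) mulr0 mul0r.
    by rewrite addr0 !mulr0.
  by field; rewrite wx wy.
- rewrite /Defs.Qrev /Qdag (negPf xy) subr0 mulr_ge0 ?invr_ge0//.
  rewrite addr_ge0 ?(Q_ge0 Mok)//; case: ifP => // _.
  by rewrite !mulr_ge0 ?invr_ge0 ?wt_ge0// (Q_ge0 Mok)// eq_sym.
Qed.

Lemma Qrev_L2 x y : L2 rho (fun p => Qrev p x y).
Proof.
apply: L2Z; apply: L2D; first exact: Q_L2 Mok x y.
have LQ a b (c : R) : L2 rho (fun p => Q M p a b * c).
  under eq_fun do rewrite mulrC; apply: L2Z; exact: Q_L2 Mok a b.
apply: L2B.
  have [_|wx] := eqVneq (wt x) 0; first exact: L2_cst.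
  by under eq_fun do rewrite -mulrA; exact: LQ.
case: (x == y); last exact: L2_cst.
rewrite /q; case: eqP => [_|_]; first exact: L2_cst.
by apply: L2_sum => z; under eq_fun do rewrite -mulrA; exact: LQ.
Qed.

Lemma EQrev_rev : rev_matrix wt (EQrev M).
Proof.
split=> [x|x y|x y xy].
- rewrite -Rintegral_sum => [|y]; last exact: L2_integrable (Qrev_L2 x y).
  under eq_Rintegral do rewrite (rev_rowsum (Qrev_rev _)).
  exact: mean_cst.
- rewrite /EQrev -!RintegralZl//; try exact: L2_integrable (Qrev_L2 _ _).
  by apply: eq_Rintegral => p _; exact: rev_sym (Qrev_rev p) x y.
- by apply: Rintegral_ge0 => p _; exact: (rev_ge0 (Qrev_rev p) xy).
Qed.

Lemma ip_fiber f g : L2 pihat f -> L2 pihat g ->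
  ip pihat f g = \int[rho]_p (\sum_x wt x * (f (x, p) * g (x, p))).
Proof.
move=> Lf Lg; rewrite ip_pihat// Rintegral_sum => [|x]; last first.
  have [->|wx] := eqVneq (wt x) 0.
    under eq_fun do rewrite mul0r.
    exact: L2_integrable (L2_cst _ _).
  under eq_fun do rewrite mulrA.
  by apply: L2_integrableM; [apply: L2Z; exact: L2_sec|exact: L2_sec].
apply: eq_bigr => x _; have [->|wx] := eqVneq (wt x) 0.
  by under [RHS]eq_Rintegral do rewrite mul0r; rewrite mul0r mean_cst.
by rewrite RintegralZl//; apply: L2_integrableM; exact: L2_sec.
Qed.

Definition Qact (f : fspace x0 * Rd R d -> R) : fspace x0 * Rd R d -> R :=
  fun z => \sum_y Qrev z.2 z.1 y * f (y, z.2).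

Lemma ip_QactC f g : L2 pihat f -> L2 pihat g ->
  L2 pihat (Qact f) -> L2 pihat (Qact g) ->
  ip pihat f (Qact g) = ip pihat (Qact f) g.
Proof.
move=> Lf Lg LQf LQg; rewrite (ipC _ (Qact f)) !ip_fiber//.
apply: eq_Rintegral => p _ /=.
have := mformC (fun x => f (x, p)) (fun x => g (x, p)) (Qrev_rev p).
by rewrite /mform => /oppr_inj.
Qed.

Lemma ip_Qact_le0 f : L2 pihat f -> L2 pihat (Qact f) -> ip pihat f (Qact f) <= 0.
Proof.
move=> Lf LQf; rewrite -oppr_ge0 -ipNl// ip_fiber//; last exact: L2N.
apply: Rintegral_ge0 => p _ /=.
rewrite (_ : \sum_x _
  = mform (w := wt) (Qrev p) (fun x => f (x, p)) (fun x => f (x, p))).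
  by apply: mform_ge0; [exact: wt_ge0|exact: Qrev_rev].
by rewrite /mform -sumrN; apply: eq_bigr => x _; rewrite mulNr mulrN.
Qed.

(** Reversibility tested against the whole space is invariance. *)
Lemma LD_inv : exists P : R -> R.-pker (Rd R d) ~> (Rd R d),
  (forall t, 0 <= t -> kernel_inv rho (P t)) /\ generator_of rho P LD.
Proof.
have [P [_ Prev _ PLD]] := LD_gen Mok; exists P; split=> // t t0 B mB.
rewrite (Prev t setT B)// (eq_integral (cst 1%E)) => [|x _]; last exact: prob_kernel.
by rewrite integral_cst// mul1e.
Qed.

Lemma LD_mean (u v : Rd R d -> R) : LD u v -> \int[rho]_p v p = 0.
Proof. by have [P [Pinv PLD]] := LD_inv; exact: (generator_mean Pinv PLD). Qed.

Lemma LD_unique (u v v' : Rd R d -> R) : LD u v -> LD u v' -> v = v' %[ae rho].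
Proof. by have [P [Pinv PLD]] := LD_inv; exact: (generator_unique Pinv PLD). Qed.

Lemma LD_L2 (u v : Rd R d -> R) : LD u v -> L2 rho u /\ L2 rho v.
Proof. by have [P [_ PLD]] := LD_inv; exact: (generator_L2 PLD). Qed.

Lemma L2_Qact_tau (F : fspace x0 -> R) : L2 pihat (Qact (tau_lift F)).
Proof.
have h x : L2 rho (sec (Qact (tau_lift F)) x).
  apply: L2_sum => y; rewrite (_ : (fun _ => _) = (fun p => F y * Qrev p x y)).
    exact: L2Z (Qrev_L2 x y).
  by apply/funext => p; rewrite mulrC.
by apply/L2_pihatP; split=> x; [exact: L2_measurable (h x)|move=> _; exact: h].
Qed.

Lemma mean_Qact_tau (F : fspace x0 -> R) x :
  \int[rho]_p sec (Qact (tau_lift F)) x p = \sum_y EQrev M x y * F y.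
Proof.
transitivity (\int[rho]_p (\sum_y F y * Qrev p x y)).
  by apply: eq_Rintegral => p _; apply: eq_bigr => y _; rewrite mulrC.
rewrite Rintegral_sum => [|y]; last exact: L2_integrable (L2Z (F y) (Qrev_L2 x y)).
apply: eq_bigr => y _; rewrite RintegralZl 1?mulrC//.
exact: L2_integrable (Qrev_L2 x y).
Qed.

Lemma ip_tau_Qact (F G : fspace x0 -> R) :
  ip pihat (tau_lift F) (Qact (tau_lift G)) = - mform (w := wt) (EQrev M) F G.
Proof.
rewrite (ip_tau F (L2_Qact_tau G)) /mform opprK; apply: eq_bigr => x _.
by rewrite mean_Qact_tau.
Qed.

Section fixed_gamma.
Variables (gamma : R) (Lrev : operator R (fspace x0 * Rd R d)).
Hypothesis Lsa : self_adjoint pihat Lrev.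
Hypothesis Lcore : core pihat Ccinfty_ext Lrev.
Hypothesis Lexpr : forall f, Ccinfty_ext f ->
  exists2 g, LDhat M f g & Lrev f (Lrev_formula M gamma f g).

Lemma Qact_L2 f g : LDhat M f g -> L2 pihat (Lrev_formula M gamma f g) ->
  L2 pihat (Qact f).
Proof.
move=> [_ Lg _] LF.
rewrite (_ : Qact f = Lrev_formula M gamma f g \- (fun z => gamma * g z)).
  by apply: L2B => //; exact: L2Z.
by apply/funext => z /=; rewrite /Lrev_formula addrK.
Qed.

Lemma ip_Lrev_formula f g h : LDhat M f g -> L2 pihat (Lrev_formula M gamma f g) ->
  L2 pihat h -> ip pihat h (Lrev_formula M gamma f g)
    = ip pihat h (Qact f) + gamma * ip pihat h g.
Proof.
move=> Dfg LF Lh; have LQ := Qact_L2 Dfg LF; have [_ Lg _] := Dfg.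
by rewrite -(ipZr gamma Lg Lh) -ipDr//; exact: L2Z.
Qed.

Lemma ip_LDhat_tau (F : fspace x0 -> R) f g : LDhat M f g ->
  ip pihat (tau_lift F) g = 0.
Proof.
move=> [_ Lg Dfg]; rewrite ip_tau// big1// => x _.
have [->|wx] := eqVneq (wt x) 0; first by rewrite mul0r.
by rewrite (LD_mean (Dfg x wx)) !mulr0.
Qed.

(** A function of x alone need not have compact support in p, so it is not taken from the core. It
    enters the domain through self-adjointness: against core functions the [LD] part has zero mean
    on each fibre, and the jump part is symmetric. *)
Lemma Lrev_tau (F : fspace x0 -> R) : Lrev (tau_lift F) (Qact (tau_lift F)).
Proof.
have LF := L2_tau M F; have LQF := L2_Qact_tau F.
apply/Lsa.2; split=> //; apply: (core_ip_ext (sa_L2 Lsa) Lcore LF LQF) => u v Cu Luv.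
have [g Dug Lug] := Lexpr Cu.
have [Lu Lv] := sa_L2 Lsa Luv; have [_ Lfo] := sa_L2 Lsa Lug.
rewrite ipC (ip_sub_eq0 Lv Lfo LF (sa_unique Lsa Luv Lug)) ipC.
rewrite (ip_Lrev_formula Dug Lfo LF) (ip_LDhat_tau F Dug) mulr0 addr0.
by rewrite ip_QactC//; exact: Qact_L2 Dug Lfo.
Qed.

Lemma Lrev_one : Lrev (cst 1) (cst 0).
Proof.
have := Lrev_tau (cst 1); rewrite (_ : Qact _ = cst 0)//.
apply/funext => z; rewrite /Qact /=; under eq_bigr do rewrite mulr1.
by rewrite (rev_rowsum (Qrev_rev _)).
Qed.

Context {lam : R}.
Hypothesis gap : forall f g, Lrev f g -> \int[pihat]_x f x = 0 ->
  lam * ip pihat f f <= - ip pihat f g.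

Lemma EQrev_gap (F : fspace x0 -> R) : \sum_x wt x * F x = 0 ->
  lam * ip pi F F <= mform (w := wt) (EQrev M) F F.
Proof.
move=> F0; have := gap (Lrev_tau F); rewrite mean_tau mean_piX => /(_ F0).
by rewrite ip_tau_tau ip_tau_Qact opprK.
Qed.

(** On a function of p alone the jump part vanishes, the rows of [Qrev] summing to zero, so [Lrev]
    acts as gamma times [LD]; the spectral gap is applied to this function minus its mean. *)
Lemma LD_gap (u v : Rd R d -> R) : Ccinfty u -> LD u v ->
  lam * (ip rho u u - (\int[rho]_p u p) ^+ 2) <= gamma * - ip rho u v.
Proof.
move=> Cu Duv; have [Lu Lv] := LD_L2 Duv.
pose U : fspace x0 * Rd R d -> R := u \o snd.
have CU : Ccinfty_ext U by move=> x.
have [g DUg LUg] := Lexpr CU.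
have FE : Lrev_formula M gamma U g = (fun z => gamma * g z).
  apply/funext => z; rewrite /Lrev_formula /U /= -mulr_suml.
  by rewrite (rev_rowsum (Qrev_rev _)) mul0r add0r.
rewrite FE in LUg; have [LU _] := sa_L2 Lsa LUg; have [_ Lg Dg] := DUg.
pose c := \int[rho]_p u p.
have cE : \int[pihat]_z U z = c.
  rewrite mean_pihat//; transitivity (\sum_x wt x * c) => //.
  by rewrite -mulr_suml sum_wt mul1r.
have Lc := L2_cst pihat c.
have := gap (sa_center Lsa Lrev_one LUg) (center_mean0 LU).2; rewrite cE.
have LUc : L2 pihat (U \- cst c) by exact: L2B.
rewrite ipZr// -mulrN.
have -> : ip pihat (U \- cst c) (U \- cst c) = ip rho u u - c ^+ 2.
  rewrite ip_pihat//.
  transitivity (\sum_x wt x * ip rho (u \- cst c) (u \- cst c)) => //.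
  rewrite -mulr_suml sum_wt mul1r.
  have Lcr := L2_cst rho c.
  rewrite ipBl//; last exact: L2B.
  rewrite !ipBr// (ipC _ (cst c) u) !ip_cstr// mean_cst -/c; ring.
(* On fibres of positive weight [g] agrees with [v] up to null sets, by uniqueness of the values of
   [LD]; the constant drops out because these values have mean zero. *)
suff -> : ip pihat (U \- cst c) g = ip rho u v by [].
rewrite ip_pihat// -[RHS]mul1r -(sum_wt M) mulr_suml; apply: eq_bigr => x _.
have [->|wx] := eqVneq (wt x) 0; first by rewrite !mul0r.
congr (_ * _); have Dx := Dg x wx; have [_ Lgx] := LD_L2 Dx.
change (ip rho (u \- cst c) (sec g x) = ip rho u v).
have Lcr := L2_cst rho c.
rewrite ipBl// (ipC _ (cst c)) ip_cstr// (LD_mean Dx) mulr0 subr0.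
by rewrite ipC [RHS]ipC; apply: ae_ip => //; exact: LD_unique Dx Duv.
Qed.

End fixed_gamma.

End model_facts.

(** * The variance defect for large gamma *)

Section rate.
Context {R : realType} {X : finType} {x0 : X} {d : nat}.
Variable M : model R x0 d.
Hypothesis Mok : model_ok M.
Local Notation wt := (wt M).
Local Notation pi := (piX M).
Local Notation rho := (rho M).
Local Notation pihat := (pihat M).
Local Notation nrm f := (Num.sqrt (ip pihat f f)).
Implicit Types f g u v w : fspace x0 * Rd R d -> R.

Definition fiber_mean w : fspace x0 -> R := fun x => \int[rho]_p sec w x p.

Definition fiber_center w := w \- tau_lift (fiber_mean w).

Lemma L2_fiber_center w : L2 pihat w -> L2 pihat (fiber_center w).
Proof. by move=> Lw; apply: L2B => //; exact: L2_tau. Qed.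

Lemma ip_sub_tau w (F : fspace x0 -> R) : L2 pihat w ->
  ip pihat (w \- tau_lift F) (w \- tau_lift F)
  = ip pihat w w + \sum_x wt x * ((F x - fiber_mean w x) ^+ 2 - fiber_mean w x ^+ 2).
Proof.
move=> Lw; have LF := L2_tau M F; have LwF := L2B Lw LF.
rewrite ipBl// !ipBr// (ipC _ w (tau_lift F)) ip_tau// ip_tau_tau ip_piX.
set A := \sum_x wt x * (F x * _); set B := \sum_x wt x * (F x * F x).
have -> : \sum_x wt x * ((F x - fiber_mean w x) ^+ 2 - fiber_mean w x ^+ 2) = B - 2 * A.
  rewrite /A /B mulr_sumr -sumrB; apply: eq_bigr => x _.
  by rewrite /fiber_mean; ring.
ring.
Qed.

(* [fiber_center w] is the projection of w off the functions of x alone. *)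
Lemma nrm_fiber_center_le w (F : fspace x0 -> R) : L2 pihat w ->
  nrm (fiber_center w) <= nrm (w \- tau_lift F).
Proof.
move=> Lw; apply: ler_wsqrtr; rewrite !ip_sub_tau// lerD2l; apply: ler_sum => x _.
by rewrite ler_wpM2l ?wt_ge0// lerB// subrr expr0n sqr_ge0.
Qed.

Lemma ip_fiber_center w : L2 pihat w ->
  ip pihat (fiber_center w) (fiber_center w)
  = \sum_x wt x * (ip rho (sec w x) (sec w x) - fiber_mean w x ^+ 2).
Proof.
move=> Lw; rewrite ip_sub_tau// ip_pihat// -big_split; apply: eq_bigr => x _ /=.
by rewrite subrr expr0n sub0r mulrBr mulrN.
Qed.

Variables (gamma kp : R) (Lrev : operator R (fspace x0 * Rd R d)).
Hypothesis gamma0 : 0 <= gamma.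
Hypothesis kp0 : 0 <= kp.
Hypothesis Lsa : self_adjoint pihat Lrev.
Hypothesis Lcore : core pihat Ccinfty_ext Lrev.
Hypothesis Lexpr : forall f, Ccinfty_ext f ->
  exists2 g, LDhat M f g & Lrev f (Lrev_formula M gamma f g).
Hypothesis LDgap : forall u v : Rd R d -> R, Ccinfty u -> LD M u v ->
  kp * (ip rho u u - (\int[rho]_p u p) ^+ 2) <= - ip rho u v.
Let k := gamma * kp.

(** The jump part has a sign and is dropped; the rest is the Poincare inequality of [LD] on each
    fibre, weighted by [wt]. *)
Lemma fiber_poincare_core u v : Ccinfty_ext u -> Lrev u v ->
  k * ip pihat (fiber_center u) (fiber_center u) <= - ip pihat u v.
Proof.
move=> Cu Luv; have [g Dug Lug] := Lexpr Cu.
have [Lu Lv] := sa_L2 Lsa Luv; have [_ Lfo] := sa_L2 Lsa Lug.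
rewrite (ipC _ u v) (ip_sub_eq0 Lv Lfo Lu (sa_unique Lsa Luv Lug)) ipC.
rewrite (ip_Lrev_formula Dug Lfo Lu) opprD.
have LQ := Qact_L2 Dug Lfo; have h := ip_Qact_le0 Mok Lu LQ.
rewrite -[leLHS]add0r lerD ?oppr_ge0// /k -mulrA -mulrN ler_wpM2l//.
have [_ Lg Dg] := Dug.
rewrite ip_fiber_center// ip_pihat// mulr_sumr -sumrN; apply: ler_sum => x _.
have [->|wx] := eqVneq (wt x) 0; first by rewrite !mul0r mulr0 oppr0.
rewrite mulrCA -[leRHS]mulrN; apply: ler_wpM2l; first exact: wt_ge0.
exact: LDgap (Cu x) (Dg x wx).
Qed.

Lemma fiber_poincare w v : Lrev w v ->
  k * ip pihat (fiber_center w) (fiber_center w) <= - ip pihat w v.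
Proof.
move=> Lwv; have [Lw Lv] := sa_L2 Lsa Lwv; apply/ler_addgt0Pr => e e0.
have k0 : 0 <= k by rewrite mulr_ge0.
have sq f : nrm f ^+ 2 = ip pihat f f by rewrite sqr_sqrtr// ip_ge0.
pose nw := nrm w; pose nv := nrm v.
have nw0 : 0 <= nw by exact: sqrtr_ge0.
have nv0 : 0 <= nv by exact: sqrtr_ge0.
(* The coefficients of [et] in the errors: nw + 1 for replacing u' by [v], nv for replacing [u] by
   [w], and k (2 nw + 3) for the centred norms; the last 1 ensures positivity. *)
pose K := (nw + 1 + nv) + k * (2 * nw + 3) + 1.
have K0 : 0 < K.
  by rewrite ltr_wpDl// addr_ge0// ?mulr_ge0// ?addr_ge0// ?mulr_ge0.
pose et := Num.min 1 (e / K).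
have et0 : 0 < et by rewrite lt_min ltr01 divr_gt0.
have et1 : et <= 1 by rewrite ge_min lexx.
have etK : et * K <= e by rewrite -ler_pdivlMr// ge_min lexx orbT.
have [s [s' [Cs sw sv]]] := Lcore.2 _ _ Lwv.
have Ls n := (sa_L2 Lsa (Cs n).2).1; have Ls' n := (sa_L2 Lsa (Cs n).2).2.
have /(cvgL2P Ls Lw)/(_ _ et0)[n1 h1] := sw.
have /(cvgL2P Ls' Lv)/(_ _ et0)[n2 h2] := sv.
pose n := maxn n1 n2.
have {}h1 := h1 n (leq_maxl _ _); have {}h2 := h2 n (leq_maxr _ _).
have Lu := Ls n; have Lu' := Ls' n.
have core := fiber_poincare_core (Cs n).1 (Cs n).2.
set u := s n in Lu h1 core *; set u' := s' n in Lu' h2 core.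
have nu_le : nrm u <= nw + et.
  have := nrmD Lw (L2B Lu Lw).
  rewrite (_ : w \+ (u \- w) = u) => [h|]; first by apply: (le_trans h); rewrite lerD2l.
  by apply/funext => z /=; rewrite addrC subrK.
pose a := nrm (fiber_center w); pose b := nrm (fiber_center u).
have a0 : 0 <= a by exact: sqrtr_ge0.
have b0 : 0 <= b by exact: sqrtr_ge0.
have b_le : b <= nw + 1.
  have := nrm_fiber_center_le (cst 0) Lu.
  rewrite (_ : u \- tau_lift (cst 0) = u) => [h|]; first by rewrite /b; lra.
  by apply/funext => z /=; rewrite /tau_lift /= subr0.
have ab : a <= b + et.
  have LwBu := L2B Lw Lu; have Lcu := L2_fiber_center Lu.
  have h3 := nrm_fiber_center_le (fiber_mean u) Lw.
  have h4 := nrmD LwBu Lcu.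
  rewrite (_ : (w \- u) \+ fiber_center u = w \- tau_lift (fiber_mean u)) in h4; last first.
    by apply/funext => z; rewrite /fiber_center /= addrA subrK.
  have h5 : nrm (w \- u) = nrm (u \- w).
    congr Num.sqrt; rewrite !(ipBl, ipBr)//; try exact: L2B.
    by rewrite (ipC _ u w); ring.
  by rewrite /a /b; lra.
(* From (b + et)^2 with b <= nw + 1 and et <= 1. *)
have a2 : a ^+ 2 <= b ^+ 2 + et * (2 * nw + 3).
  have : a ^+ 2 <= (b + et) ^+ 2 by rewrite ler_sqr ?nnegrE// addr_ge0// ltW.
  have e1 := ler_wpM2l (ltW et0) b_le; have e2 := ler_wpM2l (ltW et0) et1.
  by rewrite sqrrD; move: e1 e2; rewrite -expr2; lra.
have h3 := nrm_cvg_ip Lu Lu' Lv h2.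
have h4 := nrm_cvg_ip Lv Lu Lw h1.
rewrite (ipC _ v u) (ipC _ v w) -/nv in h4.
have h5 : nrm u * et <= (nw + 1) * et.
  by apply: ler_wpM2r; [exact: ltW|apply: (le_trans nu_le); rewrite lerD2l].
rewrite distrC in h3; rewrite distrC in h4.
have h8 := ler_norm (ip pihat u v - ip pihat u u').
have h9 := ler_norm (ip pihat w v - ip pihat u v).
have h10 := ler_wpM2l k0 a2.
rewrite -(sq (fiber_center u)) -/b in core; rewrite -(sq (fiber_center w)) -/a.
have h11 : et * K = et * (nw + 1 + nv) + k * (et * (2 * nw + 3)) + et.
  by rewrite /K; ring.
clear -h10 core h8 h3 h5 h9 h4 h11 etK et0; clearbody k K nw nv a b et.
lra.
Qed.

(** What the solution [h] of the averaged equation leaves over in the lifted equation. If [h] solves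
    it, the fibre means vanish wherever [wt] does not; moreover gamma does not enter. *)
Definition residual (ft h : fspace x0 -> R) : fspace x0 * Rd R d -> R :=
  tau_lift ft \+ Qact M (tau_lift h).

Lemma rev_rate (ft h : fspace x0 -> R) g : 0 < k ->
  poisson pihat Lrev (tau_lift ft) g -> poisson pi (matrix_op M (EQrev M)) ft h ->
  0 <= ip pihat (tau_lift ft) g - ip pi ft h
    <= ip pihat (residual ft h) (residual ft h) / k.
Proof.
move=> k0 [[Lg g0] Lgf] ph; set r := residual ft h.
have Lf := L2_tau M ft; have Lh := L2_tau M h; have LQ := L2_Qact_tau Mok h.
have Lt := Lrev_tau Mok Lsa Lcore Lexpr h.
pose w := g \- tau_lift h; have Lw : L2 pihat w by exact: L2B.
have Lr : L2 pihat r by exact: L2D.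
have Lwv := sa_sub Lsa Lgf Lt.
rewrite (_ : (\- tau_lift ft) \- Qact M (tau_lift h) = \- r) -/w in Lwv; last first.
  by apply/funext => z; rewrite /r /residual /= opprD.
have hh := matrix_poisson_form h ph.
(* This is the variance defect up to the factor 2: <g, Q h> = <Lrev g, h> = - <ft, h> by symmetry,
   and <h, Q h> cancels <h, ft> by the averaged equation. *)
pose D := ip pihat w r.
have DE : D = ip pihat (tau_lift ft) g - ip pi ft h.
  rewrite /D /r /residual ipDr// /w !ipBl// (sa_sym Lsa Lgf Lt) ipNl// !ip_tau_tau.
  rewrite (ip_tau_Qact Mok) hh (ipC pi h ft) (ipC pihat g); ring.
have P := fiber_poincare Lwv; rewrite ipNr// opprK -/D in P.
set a2 := ip pihat (fiber_center w) (fiber_center w) in P.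
have a20 : 0 <= a2 by exact: ip_ge0.
have D0 : 0 <= D by apply: le_trans P; rewrite mulr_ge0// ltW.
(* The residual is orthogonal to functions of x alone, by the averaged Poisson equation. *)
have Dc : D = ip pihat (fiber_center w) r.
  have Lm := L2_tau M (fiber_mean w).
  rewrite /fiber_center ipBl// [X in _ - X](_ : _ = 0) ?subr0//.
  rewrite ip_tau// big1// => x _.
  have [->|wx] := eqVneq (wt x) 0; first by rewrite mul0r.
  rewrite (_ : \int[rho]_p sec r x p = 0) ?mulr0//.
  have /matrix_poissonP[_ /(_ x wx) hx] := ph.
  have Lfx := L2_sec Lf wx; have LQx := L2_sec LQ wx.
  transitivity (\int[rho]_p (sec (tau_lift ft) x p + sec (Qact M (tau_lift h)) x p)) => //.
  rewrite RintegralD//; [|exact: L2_integrable Lfx|exact: L2_integrable LQx].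
  rewrite (mean_Qact_tau Mok) hx [X in X + _](_ : _ = ft x) ?subrr//.
  exact: (mean_cst rho (ft x)).
rewrite -DE D0 /= ler_pdivlMr//.
(* D^2 <= |r|^2 a2 and k a2 <= D give k D^2 <= |r|^2 D, and one factor D cancels. *)
have := ip_cs (L2_fiber_center Lw) Lr; rewrite -Dc -/a2 => cs.
have r0 := ip_ge0 pihat r.
have : k * D ^+ 2 <= ip pihat r r * D.
  rewrite (le_trans (ler_wpM2l (ltW k0) cs))// mulrCA.
  exact: ler_wpM2l.
have [->|Dn] := eqVneq D 0; first by rewrite mul0r.
have Dp : 0 < D by rewrite lt_neqAle eq_sym Dn.
by rewrite expr2 mulrA ler_pM2r// mulrC.
Qed.

End rate.

Section conclusions.
Context {R : realType} {X : finType} {x0 : X} {d : nat}.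
Variable M : model R x0 d.
Hypothesis Mok : model_ok M.
Local Notation wt := (wt M).
Local Notation pi := (piX M).
Local Notation rho := (rho M).
Local Notation pihat := (pihat M).

Lemma admissible_compare gamma L Lrev f : admissible M gamma L Lrev ->
  mean0 pihat f ->
  [/\ asvar_defined pihat L f, asvar_defined pihat Lrev f
    & asvar pihat L f <= asvar pihat Lrev f].
Proof.
move=> [_ [[P [Pm Pinv Pc PL]] _ [CL _]] [expr sa form core LA] gap] f0.
apply: (asvar_compare Pm Pinv Pc PL CL sa form core LA gap _ f0).
exact: (Lrev_one Mok sa core expr).
Qed.

Lemma mean0_tau ft : mean0 pi ft -> mean0 pihat (tau_lift ft).
Proof. by move=> [_ f0]; split; [exact: L2_tau|rewrite mean_tau]. Qed.

(** Irreducibility of the averaged matrix is not assumed: it follows from the spectral gap of [Lrev]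
    at a single admissible gamma, tested on functions of x. *)
Lemma EQrev_irr gamma L Lrev : admissible M gamma L Lrev ->
  forall F : X -> R, \sum_x wt x * F x = 0 ->
  mform (w := wt) (EQrev M) F F = 0 -> forall x, wt x != 0 -> F x = 0.
Proof.
move=> [_ _ [expr sa _ core _] gap] F F0 m0 x wx.
have [lam lam0 glam] := spectral_gapP gap (sa_L2 sa).
have := EQrev_gap Mok sa core expr glam F0; rewrite m0 pmulr_rle0// ip_piX => le0.
have t0 y : 0 <= wt y * (F y * F y) by rewrite mulr_ge0 ?wt_ge0// -expr2 sqr_ge0.
have /psumr_eq0P : \sum_y wt y * (F y * F y) = 0.
  by apply/eqP; rewrite eq_le le0 sumr_ge0.
move=> /(_ (fun y _ => t0 y) x erefl) /eqP.
by rewrite mulf_eq0 (negPf wx) /= mulf_eq0 orbb => /eqP.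
Qed.

(** The gap at [gamma0] yields the Poincare constant [lam / gamma0] of [LD], valid for all gamma
    since [LD] is fixed. The constant [K] is quantified before gamma and is 2 |r|^2 divided by this
    constant, the 2 being that of [asvar]. *)
Lemma admissible_rate gamma0 L0 Lrev0 ft : 0 < gamma0 ->
  admissible M gamma0 L0 Lrev0 -> mean0 pi ft ->
  exists K : R, forall gamma L Lrev, 0 < gamma -> admissible M gamma L Lrev ->
    `|asvar pihat Lrev (tau_lift ft) - asvar pi (matrix_op M (EQrev M)) ft|
      <= K * gamma^-1.
Proof.
move=> g0 adm0 f0.
have dE := matrix_asvar_defined (EQrev_rev Mok) (EQrev_irr adm0) f0.
have [[h ph] _] := dE.
have [_ _ [expr0 sa0 _ core0 _] gap0] := adm0.
have [lam lam0 glam] := spectral_gapP gap0 (sa_L2 sa0).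
pose kp := lam / gamma0; have kp0 : 0 < kp by rewrite divr_gt0.
have LDg (u v : Rd R d -> R) : Ccinfty u -> LD M u v ->
    kp * (ip rho u u - (\int[rho]_p u p) ^+ 2) <= - ip rho u v.
  move=> Cu Duv; have := LD_gap Mok sa0 core0 expr0 glam Cu Duv.
  by rewrite /kp mulrAC ler_pdivrMr// [_ * gamma0]mulrC.
pose CR := ip pihat (residual M ft h) (residual M ft h).
exists (2 * CR / kp) => gamma L Lrev gm0 adm.
have [_ dr _] := admissible_compare adm (mean0_tau f0).
have [[g pg] _] := dr; have [_ _ [expr sa _ core _] _] := adm.
rewrite (asvar_eq (L2_tau M ft) dr pg) (asvar_eq (L2_piX M ft) dE ph) -mulrBr.
have k0 : 0 < gamma * kp by rewrite mulr_gt0.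
have /andP[D0 D1] := rev_rate Mok (ltW gm0) (ltW kp0) sa core expr LDg k0 pg ph.
rewrite ger0_norm; last by rewrite mulr_ge0.
rewrite -!mulrA ler_pM2l// -invfM [kp * _]mulrC; exact: D1.
Qed.

End conclusions.

(** * Factorized rates *)

Section factorized_form.
Context {R : realType} {X : finType} {x0 : X} {d : nat}.
Variable M : model R x0 d.
Hypothesis Mok : model_ok M.
Variables (Qbar : X -> X -> R) (H : X -> X -> Rd R d -> R).
Variables (sigma : X -> X -> 'rV[R]_d) (s : Rd R d -> 'rV[R]_d).
Hypothesis Fok : factorized M Qbar H sigma s.
Local Notation wt := (wt M).
Local Notation rho := (rho M).

Lemma Qbar_revm : rev_matrix wt Qbar.
Proof.
split=> [x|x y|x y xy]; [|exact: Qbar_rev Fok x y|exact: (Qbar_ge0 Fok xy)].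
by rewrite (bigD1 x)//= (Qbar_diag Fok) addNr.
Qed.

Lemma Qbar_wt x y : 0 < Qbar x y -> wt x != 0 /\ wt y != 0.
Proof.
move=> q0; split; apply/eqP => w0; move: q0.
  by rewrite (Qbar_supp Fok (or_introl w0)) ltxx.
by rewrite (Qbar_supp Fok (or_intror w0)) ltxx.
Qed.

Lemma Qbar_sym_gt0 x y : 0 < Qbar x y -> 0 < Qbar y x.
Proof.
move=> q0; have [wx wy] := Qbar_wt q0.
have wx0 : 0 < wt x by rewrite lt_neqAle eq_sym wx wt_ge0.
have wy0 : 0 < wt y by rewrite lt_neqAle eq_sym wy wt_ge0.
by have := mulr_gt0 wx0 q0; rewrite (Qbar_rev Fok) pmulr_rgt0.
Qed.

Definition Hsum x y : R := \int[rho]_p (H x y p + H y x p).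

(** Detailed balance of [Qbar] turns the reversed rate pi_y Qbar_yx / pi_x into Qbar_xy, which then
    factors out. *)
Lemma EQrev_gt0 x y : x != y -> 0 < Qbar x y ->
  EQrev M x y = Qbar x y * (2^-1 * Hsum x y).
Proof.
move=> xy q0; have [wx wy] := Qbar_wt q0; have q0' := Qbar_sym_gt0 q0.
have yx : y != x by rewrite eq_sym.
have E p : Qrev M p x y = Qbar x y * 2^-1 * (H x y p + H y x p).
  rewrite /Qrev /Qdag (negPf xy) subr0 (negPf wx).
  rewrite !(Q_fact Fok)// q0 q0'.
  have -> : Qbar y x * H y x p * wt y / wt x = (wt y * Qbar y x) / wt x * H y x p by ring.
  rewrite -(Qbar_rev Fok) [wt x * _]mulrC mulfK//; ring.
rewrite /EQrev; under eq_Rintegral do rewrite E.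
rewrite RintegralZl//; first by rewrite mulrA.
exact: (L2_integrable (L2D (H_L2 Fok q0) (H_L2 Fok q0'))).
Qed.

Lemma EQrev_eq0 x y : x != y -> ~~ (0 < Qbar x y) -> EQrev M x y = 0.
Proof.
move=> xy q0; have yx : y != x by rewrite eq_sym.
have q0' : ~~ (0 < Qbar y x) by apply: contra q0; exact: Qbar_sym_gt0.
rewrite /EQrev (_ : (fun p => _) = cst 0) ?mean_cst//.
apply/funext => p; rewrite /Qrev /Qdag (negPf xy) subr0.
by rewrite !(Q_fact Fok)// (negPf q0) (negPf q0') !mul0r if_same addr0 mulr0.
Qed.

Lemma Hsum_ge x y : 0 < Qbar x y ->
  (\int[rho]_p (`|dot (sigma x y) (s p)|%:E) <= (Hsum x y)%:E)%E.
Proof.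
move=> q0; have q0' := Qbar_sym_gt0 q0.
have LH := H_L2 Fok q0; have LH' := H_L2 Fok q0'.
have [leb [r [G [_ _ _ _ [_ Ls]]]]] := s_grad_log Fok.
have Ld : L2 rho (fun p => dot (sigma x y) (s p)).
  by apply: L2_sum => i; exact: L2Z (Ls i).
have LB := L2B LH LH'; have LD' := L2D LH LH'.
rewrite (@ae_eq_integral _ _ _ _ _ (fun p => `|H x y p - H y x p|%:E)%E)//; last first.
- apply: filterS (H_sub Fok q0) => p /= -> _.
  by rewrite normrN.
- apply/measurable_EFinP; apply: measurableT_comp => //; exact: L2_measurable LB.
- apply/measurable_EFinP; apply: measurableT_comp => //; exact: L2_measurable Ld.
rewrite /Hsum /Rintegral fineK; last exact: integrable_fin_num (L2_integrable LD').
apply: ge0_le_integral => //.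
- apply/measurable_EFinP; apply: measurableT_comp => //; exact: L2_measurable LB.
- by apply/measurable_EFinP; exact: L2_measurable LD'.
- move=> p _; rewrite lee_fin.
  have h1 := H_ge0 Fok p q0; have h2 := H_ge0 Fok p q0'.
  by rewrite (le_trans (ler_normB _ _))// !ger0_norm.
Qed.

Lemma Cmin_le x y : x != y -> 0 < Qbar x y -> (Cmin M Qbar sigma s <= (Hsum x y)%:E)%E.
Proof.
move=> xy q0; apply: (le_trans _ (Hsum_ge q0)).
by apply: (@bigmin_inf _ _ _ _ (x, y)) => //=; rewrite xy.
Qed.

Lemma Cmin_ge0 : (0 <= Cmin M Qbar sigma s)%E.
Proof.
rewrite /Cmin; elim/big_ind: _ => //= [a b a0 b0|[x y] _]; first by rewrite le_min a0.
by apply: integral_ge0 => p _; rewrite lee_fin.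
Qed.

(** Zero energy for [Qbar] makes [F] constant across every positive rate, and [EQrev] has no other
    jumps. This passes irreducibility from [EQrev] to [Qbar] even when C = 0, where the quantitative
    comparison says nothing. *)
Lemma mdir_EQrev0 F : mdir (w := wt) Qbar F = 0 -> mdir (w := wt) (EQrev M) F = 0.
Proof.
move=> /eqP; rewrite mulf_eq0 invr_eq0 pnatr_eq0 /= => /eqP m0.
have t0 x y := mdir_term_ge0 (wt_ge0 M) F x y Qbar_revm.
have s0 x : 0 <= \sum_y wt x * Qbar x y * (F x - F y) ^+ 2.
  by apply: sumr_ge0 => y _; exact: t0.
rewrite /mdir big1 ?mulr0// => x _; rewrite big1// => y _.
have /psumr_eq0P h1 := m0; have {}h1 := h1 (fun z _ => s0 z) x erefl.
have /psumr_eq0P h2 := h1; have {}h2 := h2 (fun z _ => t0 x z) y erefl.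
have [->|xy] := eqVneq x y; first by rewrite subrr expr0n mulr0.
have [q0|q0] := boolP (0 < Qbar x y); last by rewrite EQrev_eq0// mulr0 mul0r.
rewrite EQrev_gt0// (_ : _ * _ = wt x * Qbar x y * (F x - F y) ^+ 2 * (2^-1 * Hsum x y)).
  by rewrite h2 mul0r.
ring.
Qed.

Lemma factorized_bound (ft h g : fspace x0 -> R) (r a : R) :
  poisson (piX M) (matrix_op M (EQrev M)) ft h ->
  poisson (piX M) (matrix_op M Qbar) ft g ->
  a <= 2 * ip (piX M) ft h + r ->
  (a%:E <= Cbound M Qbar sigma s (2 * ip (piX M) ft g) + r%:E)%E.
Proof.
move=> ph pg ar; rewrite /Cbound; case: eqP => [_|/eqP C0].
  by rewrite addye// leey.
have rE := EQrev_rev Mok; have rQ := Qbar_revm.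
have := Cmin_ge0; have := Cmin_le; case: (Cmin M Qbar sigma s) C0 => [c||//] C0 Cle Cge.
  rewrite lee_fin in Cge; have c0 : 0 < c by rewrite lt_neqAle eq_sym -eqe C0.
  (* The origin of the 2 in the bound: [EQrev] is [Qbar] times half of [Hsum], and [Hsum] is at
     least [c] on every positive rate. *)
  have c20 : 0 < c / 2 by rewrite divr_gt0.
  have le F : c / 2 * mform (w := wt) Qbar F F <= mform (w := wt) (EQrev M) F F.
    rewrite !mformE//; apply: (mdir_le (wt_ge0 M)) => // x y xy wx.
    have [q0|q0] := boolP (0 < Qbar x y); last first.
      have -> : Qbar x y = 0.
        by apply/eqP; rewrite eq_le (Qbar_ge0 Fok) ?andbT// leNgt.
      by rewrite mulr0 EQrev_eq0.
    rewrite EQrev_gt0// mulrC ler_pM2l// mulrC ler_pM2l ?invr_gt0//.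
    by have := Cle x y xy q0; rewrite lee_fin.
  have := matrix_asvar_le c20 rQ rE le pg ph.
  rewrite inver (gt_eqF c0) -!EFinM -EFinD lee_fin invf_div => h1.
  by apply: (le_trans ar); rewrite lerD2r mulrCA ler_pM2l.
(* Here C = +oo, so its inverse is 0 and the variance term of the bound vanishes. As [Hsum] is
   finite, no rate is positive, and the averaged variance is zero as well. *)
rewrite invey mule0 mul0e add0e lee_fin.
suff h0 : ip (piX M) ft h = 0 by rewrite h0 mulr0 add0r in ar.
rewrite ipC -(matrix_poisson_form h ph) mformE//.
apply: mdir_EQrev0; rewrite /mdir big1 ?mulr0// => x _; rewrite big1// => y _.
have [->|xy] := eqVneq x y; first by rewrite subrr expr0n mulr0.
have -> : Qbar x y = 0.
  apply/eqP; rewrite eq_le (Qbar_ge0 Fok)// andbT leNgt; apply/negP => q0.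
  by have := Cle x y xy q0; rewrite leye_eq.
by rewrite mulr0 mul0r.
Qed.

End factorized_form.

Theorem proposition4p4 (R : realType) (X : finType) (x0 : X) (d : nat)
    (M : model R x0 d) (L Lrev : R -> operator R (fspace x0 * Rd R d)) :
  (0 < d)%N -> model_ok M ->
  [/\ (forall gamma, admissible M gamma (L gamma) (Lrev gamma) ->
        forall f, mean0 (pihat M) f ->
        [/\ asvar_defined (pihat M) (L gamma) f,
            asvar_defined (pihat M) (Lrev gamma) f
          & asvar (pihat M) (L gamma) f <= asvar (pihat M) (Lrev gamma) f]),
      (forall ft, mean0 (piX M) ft ->
        (forall gamma, admissible M gamma (L gamma) (Lrev gamma) ->
          [/\ asvar_defined (pihat M) (L gamma) (tau_lift ft),
              asvar_defined (pihat M) (Lrev gamma) (tau_lift ft)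
            & asvar (pihat M) (L gamma) (tau_lift ft)
                <= asvar (pihat M) (Lrev gamma) (tau_lift ft)]) /\
        ((\forall gamma \near +oo,
            admissible M gamma (L gamma) (Lrev gamma)) ->
          asvar_defined (piX M) (matrix_op M (EQrev M)) ft /\
          exists2 r : R -> R, bigO_inv r &
            \forall gamma \near +oo,
              asvar (pihat M) (Lrev gamma) (tau_lift ft)
                = asvar (piX M) (matrix_op M (EQrev M)) ft + r gamma))
    & (forall Qbar H sigma s, factorized M Qbar H sigma s ->
        (\forall gamma \near +oo,
            admissible M gamma (L gamma) (Lrev gamma)) ->
        forall ft, mean0 (piX M) ft ->
        asvar_defined (piX M) (matrix_op M Qbar) ft /\
        exists2 r : R -> R, bigO_inv r &
          \forall gamma \near +oo,
            ((asvar (pihat M) (L gamma) (tau_lift ft))%:E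
              <= Cbound M Qbar sigma s (asvar (piX M) (matrix_op M Qbar) ft)
                 + (r gamma)%:E)%E)].
Proof.
move=> _ Mok.
(* A neighbourhood of +oo contains a ray, hence an admissible value that is also positive, by which
   the gap can be divided. *)
have pos : (\forall gamma \near +oo, admissible M gamma (L gamma) (Lrev gamma)) ->
    exists2 gamma, 0 < gamma & admissible M gamma (L gamma) (Lrev gamma).
  move=> [m [_ hm]]; exists (Num.max m 0 + 1).
    by rewrite ltr_wpDl// le_max lexx orbT.
  by apply: hm; rewrite (@le_lt_trans _ _ (Num.max m 0)) ?le_max ?lexx// ltrDl.
have comp gamma : admissible M gamma (L gamma) (Lrev gamma) ->
    forall ft, mean0 (piX M) ft -> [/\ asvar_defined (pihat M) (L gamma) (tau_lift ft),
      asvar_defined (pihat M) (Lrev gamma) (tau_lift ft)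
      & asvar (pihat M) (L gamma) (tau_lift ft)
        <= asvar (pihat M) (Lrev gamma) (tau_lift ft)].
  move=> adm ft f0.
  by have := admissible_compare Mok adm (mean0_tau f0).
have defE ft : mean0 (piX M) ft ->
    (\forall gamma \near +oo, admissible M gamma (L gamma) (Lrev gamma)) ->
    asvar_defined (piX M) (matrix_op M (EQrev M)) ft.
  move=> f0 /pos[g g0 adm].
  exact: (matrix_asvar_defined (EQrev_rev Mok) (EQrev_irr Mok adm) f0).
(* The error is the exact difference, so the equality holds for every gamma; the same error serves
   for the factorized bound. *)
pose r ft gamma := asvar (pihat M) (Lrev gamma) (tau_lift ft)
  - asvar (piX M) (matrix_op M (EQrev M)) ft.
have rO ft : mean0 (piX M) ft ->
    (\forall gamma \near +oo, admissible M gamma (L gamma) (Lrev gamma)) ->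
    bigO_inv (r ft).
  move=> f0 adm; have [g g0 adm0] := pos adm.
  have [K hK] := admissible_rate Mok g0 adm0 f0.
  exists K; apply: filterS2 (nbhs_pinfty_gt (num_real 0)) adm => gamma gm0 ag.
  exact: (hK _ _ _ gm0 ag).
split=> [gamma adm f f0|ft f0|Qbar H sigma s Fok adm ft f0].
- exact: (admissible_compare Mok adm f0).
- split=> [gamma adm|adm]; first exact: (comp _ adm _ f0).
  split; first exact: defE.
  exists (r ft); first exact: rO.
  by apply: nearW => gamma; rewrite /r addrC subrK.
- have dE := defE ft f0 adm; have [g g0 adm0] := pos adm.
  have w0 := wt_ge0 M.
  (* [Qbar] inherits irreducibility from [EQrev], hence from the spectral gap. *)
  have dQ : asvar_defined (piX M) (matrix_op M Qbar) ft.
    apply: (matrix_asvar_defined (Qbar_revm Fok) _ f0) => F F0.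
    rewrite (mformE _ (Qbar_revm Fok)) => m0; apply: (EQrev_irr Mok adm0 F0).
    by rewrite (mformE _ (EQrev_rev Mok)); exact: (mdir_EQrev0 Fok m0).
  split=> //; exists (r ft); first exact: rO.
  have [[h ph] _] := dE; have [[k pk] _] := dQ.
  apply: filterS adm => gamma /comp /(_ ft f0)[_ _ le].
  rewrite (asvar_eq (L2_piX M ft) dQ pk).
  apply: (factorized_bound Mok Fok ph pk); apply: (le_trans le).
  by rewrite /r (asvar_eq (L2_piX M ft) dE ph) addrC subrK.
Qed.
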